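(* Fix $\star\in\{0,\boldsymbol n,s\}$. For all $\beta\ge 2$ the following holds. The bilinear form $a^\star:U\times U\to\mathbb R$ is $U$-coercive, $$\|\boldsymbol u\|_U^2\le C_1\,a^\star(\boldsymbol u,\boldsymbol u)\quad\text{for all }\boldsymbol u\in U,$$ and bounded, $$|a^\star(\boldsymbol u,\boldsymbol v)|\le (C_2^2\beta+1)\|\boldsymbol u\|_U\|\boldsymbol v\|_U\quad\text{for all }\boldsymbol u,\boldsymbol v\in U.$$ The constant $C_1>0$ depends only on $\Omega$, and $C_2>0$ is the continuity constant of $b:U\times V\to\mathbb R$ (i.e. $|b(\boldsymbol u,\boldsymbol v)|\le C_2\|\boldsymbol u\|_U\|\boldsymbol v\|_V$ for all $\boldsymbol u\in U$, $\boldsymbol v\in V$). In particular, the variational inequality $$\text{find }\boldsymbol u\in K^\star:\qquad a^\star(\boldsymbol u,\boldsymbol v-\boldsymbol u)\ge F(\boldsymbol v-\boldsymbol u)\quad\text{for all }\boldsymbol v\in K^\star\qquad(\mathrm{VI})$$ is uniquely solvable and equivalent to the Signorini problem $$-\Delta u+u=f\ \text{in }\Omega,\qquad u\ge0,\quad \frac{\partial u}{\partial\boldsymbol n}\ge0,\quad u\frac{\partial u}{\partial\boldsymbol n}=0\ \text{on }\Gamma\qquad(\mathrm{SP})$$ in the following sense: if $u\in H^1(\Omega)$ solves (SP), then $\boldsymbol u=(u,\boldsymbol\sigma,\widehat u,\widehat\sigma)\in K^\star$ with $\boldsymbol\sigma:=\nabla u$, $\widehat u|_{\partial T}:=u|_{\partial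 T}$, $\widehat\sigma|_{\partial T}:=\nabla u\cdot\boldsymbol n_T|_{\partial T}$ for all $T\in\mathcal T$ solves (VI). On the other hand, if $\boldsymbol u=(u,\boldsymbol\sigma,\widehat u,\widehat\sigma)\in K^\star$ solves (VI), then $u\in H^1(\Omega)$ solves (SP). Moreover, the unique solution $\boldsymbol u\in K^\star$ of (VI) satisfies $$b(\boldsymbol u,\Theta_\beta\boldsymbol w)=F(\boldsymbol w)\quad\text{for all }\boldsymbol w\in U.$$
   Context: Domain and mesh. $\Omega\subset\mathbb R^d$ ($d\in\{2,3\}$) is a bounded simply connected Lipschitz domain with boundary $\Gamma=\partial\Omega$ and outer unit normal $\boldsymbol n=\boldsymbol n_\Omega$; $f\in L^2(\Omega)$. $(\cdot,\cdot)$ and $\|\cdot\|$ are the $L^2(\Omega)$ inner product and norm; $\langle\cdot,\cdot\rangle_{\partial\omega}$ is the (extended) $L^2(\partial\omega)$ duality. $\mathcal T$ is a finite disjoint partition of $\Omega$ into open Lipschitz sets $T$ with $\bigcup_{T\in\mathcal T}\overline T=\overline\Omega$; $\boldsymbol n_T$ is the outer unit normal on $\partial T$; $\mathcal S=\{\partial T: T\in\mathcal T\}$ is the skeleton. $\nabla_{\mathcal T}$, $\mathrm{div}_{\mathcal T}$ are the $\mathcal T$-piecewise gradient and divergence. Spaces. $H^1(\mathcal T)=\{w\in L^2(\Omega): w|_T\in H^1(T)\ \forall T\in\mathcal T\}$, $\boldsymbol H(\mathrm{div},\mathcal T)=\{\boldsymbol q\in L^2(\Omega)^d:\boldsymbol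 q|_T\in\boldsymbol H(\mathrm{div},T)\ \forall T\in\mathcal T\}$. $H^{1/2}(\mathcal S)$ is the set of $\widehat u\in\prod_{T}H^{1/2}(\partial T)$ for which there is $w\in H^1(\Omega)$ with $\widehat u|_{\partial T}=w|_{\partial T}$ for all $T$; $H^{-1/2}(\mathcal S)$ is the set of $\widehat\sigma\in\prod_T H^{-1/2}(\partial T)$ for which there is $\boldsymbol q\in\boldsymbol H(\mathrm{div},\Omega)$ with $\widehat\sigma|_{\partial T}=(\boldsymbol q\cdot\boldsymbol n_T)|_{\partial T}$ for all $T$. Norms: $\|\widehat u\|_{1/2,\mathcal S}$ is the infimum of $(\|w\|^2+\|\nabla w\|^2)^{1/2}$ over all such $w$; $\|\widehat\sigma\|_{-1/2,\mathcal S}$ is the infimum of $(\|\boldsymbol q\|^2+\|\mathrm{div}\,\boldsymbol q\|^2)^{1/2}$ over all such $\boldsymbol q$. The restrictions to $\Gamma$ are $\widehat u|_\Gamma:=w|_\Gamma\in H^{1/2}(\Gamma)$ and $\widehat\sigma|_\Gamma:=(\boldsymbol q\cdot\boldsymbol n_\Omega)|_\Gamma\in H^{-1/2}(\Gamma)$ (independent of the chosen $w$, $\boldsymbol q$). Set $\langle\widehat u,\boldsymbol\tau\cdot\boldsymbol n\rangle_{\mathcal S}=\sum_T\langle\widehat u|_{\partial T},\boldsymbol\tau\cdot\boldsymbol n_T\rangle_{\partial T}$ and $\langle\widehat\sigma,v\rangle_{\mathcal S}=\sum_T\langle\widehat\sigma|_{\partial T},v\rangle_{\partial T}$. $U=L^2(\Omega)\times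 L^2(\Omega)^d\times H^{1/2}(\mathcal S)\times H^{-1/2}(\mathcal S)$ with $\|(u,\boldsymbol\sigma,\widehat u,\widehat\sigma)\|_U^2=\|u\|^2+\|\boldsymbol\sigma\|^2+\|\widehat u\|_{1/2,\mathcal S}^2+\|\widehat\sigma\|_{-1/2,\mathcal S}^2$; $V=H^1(\mathcal T)\times\boldsymbol H(\mathrm{div},\mathcal T)$ with $\|(v,\boldsymbol\tau)\|_V^2=\|v\|^2+\|\nabla_{\mathcal T}v\|^2+\|\boldsymbol\tau\|^2+\|\mathrm{div}_{\mathcal T}\boldsymbol\tau\|^2$ and the inner product $(\cdot,\cdot)_V$ inducing it. Forms. For $\boldsymbol u=(u,\boldsymbol\sigma,\widehat u,\widehat\sigma)\in U$, $\boldsymbol v=(v,\boldsymbol\tau)\in V$: $b(\boldsymbol u,\boldsymbol v)=(\boldsymbol\sigma,\nabla_{\mathcal T}v)+(u,v)-\langle\widehat\sigma,v\rangle_{\mathcal S}+(\boldsymbol\sigma,\boldsymbol\tau)+(u,\mathrm{div}_{\mathcal T}\boldsymbol\tau)-\langle\widehat u,\boldsymbol\tau\cdot\boldsymbol n\rangle_{\mathcal S}$, $L(\boldsymbol v)=(f,v)$. The operator $\Theta:U\to V$ is defined by $(\Theta\boldsymbol u,\boldsymbol v)_V=b(\boldsymbol u,\boldsymbol v)$ for all $\boldsymbol v\in V$, and $\Theta_\beta:=\beta\Theta$. Trace operators: $\gamma_0\boldsymbol u=\widehat u|_\Gamma$, $\gamma_{\boldsymbol n}\boldsymbol u=\widehat\sigma|_\Gamma$.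 For $\boldsymbol u,\boldsymbol v\in U$: $a^0(\boldsymbol u,\boldsymbol v)=b(\boldsymbol u,\Theta_\beta\boldsymbol v)+\langle\gamma_{\boldsymbol n}\boldsymbol u,\gamma_0\boldsymbol v\rangle_\Gamma$, $a^{\boldsymbol n}(\boldsymbol u,\boldsymbol v)=b(\boldsymbol u,\Theta_\beta\boldsymbol v)+\langle\gamma_{\boldsymbol n}\boldsymbol v,\gamma_0\boldsymbol u\rangle_\Gamma$, $a^s(\boldsymbol u,\boldsymbol v)=b(\boldsymbol u,\Theta_\beta\boldsymbol v)+\tfrac12(\langle\gamma_{\boldsymbol n}\boldsymbol u,\gamma_0\boldsymbol v\rangle_\Gamma+\langle\gamma_{\boldsymbol n}\boldsymbol v,\gamma_0\boldsymbol u\rangle_\Gamma)$, $F(\boldsymbol v)=L(\Theta_\beta\boldsymbol v)$. Orderings and cones. $\widehat v\ge0$ in $H^{1/2}(\Gamma)$ means that $\widehat v$ is the weak $H^{1/2}(\Gamma)$-limit of a sequence of non-negative Lipschitz continuous functions on $\Gamma$. $\widehat\sigma\ge0$ in $H^{-1/2}(\Gamma)$ means $\langle\widehat\sigma,\widehat v\rangle_\Gamma\ge0$ for all $\widehat v\in H^{1/2}(\Gamma)$ with $\widehat v\ge0$. $K^0=\{\boldsymbol u\in U:\gamma_0\boldsymbol u\ge0\}$, $K^{\boldsymbol n}=\{\boldsymbol u\in U:\gamma_{\boldsymbol n}\boldsymbol u\ge0\}$, $K^s=K^0\cap K^{\boldsymbol n}$. In (SP) the boundary conditions are understood with $u|_\Gamma$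 the trace in $H^{1/2}(\Gamma)$, $\partial u/\partial\boldsymbol n\in H^{-1/2}(\Gamma)$ defined by duality, and the last condition meaning $\langle\partial u/\partial\boldsymbol n,u\rangle_\Gamma=0$. *)

(* Defs.v *)
From HB Require Import structures.
From mathcomp Require Import all_boot all_order all_algebra.
From mathcomp Require Import all_classical all_reals all_analysis.
Import Order.TTheory GRing.Theory Num.Theory.
Import numFieldNormedType.Exports.

Set Implicit Arguments.
Unset Strict Implicit.
Unset Printing Implicit Defensive.

Local Open Scope classical_set_scope.
Local Open Scope ring_scope.
(* Conventions.
   - Elements of L^2(D) are functions on R^d = 'rV[R]_d, equal when they agree
     a.e. on D; only their values on D matter.  In particular the restriction
     of u to a subset T of D is u itself.
   - H^{1/2}(bd D) is the trace space H^1(D)/H^1_0(D): an element is represented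
     by any w in H^1(D) having it as trace, and w, w' have the same trace when
     w - w' lies in H^1_0(D), the H^1(D)-closure of C_c^oo(D).
   - H^{-1/2}(bd D) is the dual of H^{1/2}(bd D): its elements are the bounded
     functionals on H^1(D) that vanish on H^1_0(D), equal when they agree on
     H^1(D).  The duality pairing is function application, and q . n is the
     functional given by Green's formula.
   Weak gradients and divergences, the extensions behind the traces on Gamma and
   the Riesz representatives behind Theta are picked by [xget]; each is unique
   up to the equalities above. *)

(* 'rV[T]_n carries the product sigma-algebra, i.e., the Borel sets if T is R *)
Definition rV_display : measure_display -> measure_display.
Proof. exact. Qed.

Section rV_measurable.
Context {disp : measure_display} {T : measurableType disp} (n : nat).

Let coor (i : 'I_n) (x : 'rV[T]_n) : T := x ord0 i.

Let rv0 : g_sigma_preimage coor set0.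
Proof. exact: sigma_algebra0. Qed.

Let rvC A : g_sigma_preimage coor A -> g_sigma_preimage coor (~` A).
Proof. exact: sigma_algebraC. Qed.

Let rvU (F : _^nat) : (forall i, g_sigma_preimage coor (F i)) ->
  g_sigma_preimage coor (\bigcup_i F i).
Proof. exact: sigma_algebra_bigcup. Qed.

HB.instance Definition _ :=
  @isMeasurable.Build (rV_display disp) 'rV[T]_n (g_sigma_preimage coor)
    rv0 rvC rvU.

Lemma measurable_rV_coord (i : 'I_n) :
  measurable_fun [set: 'rV[T]_n] (fun x : 'rV[T]_n => x ord0 i).
Proof.
move=> _ Y mY; rewrite setTI; apply: sub_sigma_algebra => /=.
rewrite -bigcup_seq/=; exists i => /=; first by rewrite mem_index_enum.
by exists Y => //; rewrite setTI.
Qed.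

Lemma measurable_fun_rV {d1} {T1 : measurableType d1} (f : T1 -> 'rV[T]_n) :
  (forall i, measurable_fun [set: T1] (fun x => f x ord0 i)) ->
  measurable_fun [set: T1] f.
Proof.
move=> mf; apply: (@measurability _ _ _ _ _ _
  (\big[setU/set0]_(i < n) preimage_set_system setT (coor i) measurable)) => //.
move=> _ [A + <-]; rewrite -bigcup_seq => -[i _ [B mB <-]].
by rewrite setTI; exact: mf.
Qed.

End rV_measurable.

Section lebesgue_rV.
Context {R : realType}.

Definition rV_cons n (p : R * 'rV[R]_n) : 'rV[R]_n.+1 :=
  row_mx (const_mx p.1 : 'rV[R]_1) p.2.

Lemma measurable_rV_cons n : measurable_fun [set: R * 'rV[R]_n] (@rV_cons n).
Proof.
apply: measurable_fun_rV => i.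
case: (split_ordP (i : 'I_(1 + n))) => j ->.
  apply: (eq_measurable_fun fst) => [x _|]; last exact: measurable_fst.
  by rewrite [RHS]row_mxEl mxE.
apply: (eq_measurable_fun (fun x : R * 'rV[R]_n => x.2 ord0 j)) => [x _|].
  by rewrite [RHS]row_mxEr.
exact: (measurableT_comp (measurable_rV_coord j) measurable_snd).
Qed.
Section rV_product.
Context (n : nat) (mu : {sigma_finite_measure set 'rV[R]_n -> \bar R}).

Let leb : {sigma_finite_measure set (measurableTypeR R) -> \bar R} :=
  @lebesgue_measure R.
Let prod : {measure set (measurableTypeR R * 'rV[R]_n)%type -> \bar R} :=
  (leb \x mu)%E.

Definition rV_product : set 'rV[R]_n.+1 -> \bar R :=
  pushforward prod (@rV_cons n).

Let mcons : measurable_fun [set: measurableTypeR R * 'rV[R]_n] (@rV_cons n) :=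
  @measurable_rV_cons n.

Let mpre A : measurable A -> measurable (@rV_cons n @^-1` A).
Proof. by move=> mA; rewrite -[X in measurable X]setTI; exact: mcons. Qed.

Let rV_product0 : rV_product set0 = 0%E.
Proof. by rewrite /rV_product /pushforward preimage_set0 measure0. Qed.

Let rV_product_ge0 A : (0 <= rV_product A)%E.
Proof. exact: measure_ge0. Qed.

Let rV_product_sigma_additive : semi_sigma_additive rV_product.
Proof.
move=> F mF tF mUF; rewrite /rV_product /pushforward preimage_bigcup.
apply: measure_semi_sigma_additive.
- by move=> k; exact: mpre.
- apply/trivIsetP => /= i j _ _ ij; rewrite -preimage_setI.
  by move/trivIsetP : tF => /(_ _ _ _ _ ij) ->//; rewrite preimage_set0.
- by rewrite -preimage_bigcup; exact: mpre.
Qed.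

HB.instance Definition _ := isMeasure.Build _ _ _ rV_product
  rV_product0 rV_product_ge0 rV_product_sigma_additive.

Let rV_product_sigma_finite : sigma_finite setT rV_product.
Proof.
have /sigma_finiteP[F [TF ndF Foo]] := sigma_finiteT leb.
have /sigma_finiteP[G [TG ndG Goo]] := sigma_finiteT mu.
pose hd (x : 'rV[R]_n.+1) : R := x ord0 ord0.
pose tl (x : 'rV[R]_n.+1) : 'rV[R]_n := \row_j x ord0 (lift ord0 j).
have hdK p : hd (rV_cons p) = p.1.
  rewrite /hd (_ : ord0 = lshift n (ord0 : 'I_1)); last exact/val_inj.
  by rewrite [LHS]row_mxEl mxE.
have tlK p : tl (rV_cons p) = p.2.
  apply/rowP => j; rewrite mxE.
  rewrite (_ : lift ord0 j = rshift 1 j); last exact/val_inj.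
  by rewrite [LHS]row_mxEr.
have mhd : measurable_fun setT hd by exact: measurable_rV_coord.
have mtl : measurable_fun setT tl.
  apply: measurable_fun_rV => i.
  apply: (eq_measurable_fun (fun x : 'rV[R]_n.+1 => x ord0 (lift ord0 i))).
    by move=> x _; rewrite mxE.
  exact: measurable_rV_coord.
exists (fun k => hd @^-1` F k `&` tl @^-1` G k).
  apply/seteqP; split => // x _.
  have [i _ Fi] : (\bigcup_i F i) (hd x) by rewrite -TF.
  have [k _ Gk] : (\bigcup_i G i) (tl x) by rewrite -TG.
  exists (maxn i k) => //; split.
    by move: Fi; rewrite /preimage/=; move: (hd x); apply/subsetPset/ndF/leq_maxl.
  by move: Gk; rewrite /preimage/=; move: (tl x); apply/subsetPset/ndG/leq_maxr.
move=> k; have [mF ?] := Foo k; have [mG ?] := Goo k; split.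
  apply: measurableI.
    by rewrite -[X in measurable X]setTI; exact: mhd.
  by rewrite -[X in measurable X]setTI; exact: mtl.
rewrite /rV_product /pushforward.
rewrite (_ : _ @^-1` _ = F k `*` G k).
  have -> : prod (F k `*` G k) = (leb (F k) * mu (G k))%E.
    exact: product_measure1E.
  by rewrite lte_mul_pinfty// ge0_fin_numE.
by apply/seteqP; split=> p /=; rewrite hdK tlK.
Qed.

HB.instance Definition _ := Measure_isSigmaFinite.Build _ _ _ rV_product
  rV_product_sigma_finite.

End rV_product.

(* d-dimensional Lebesgue measure, as an iterated product of lebesgue_measure *)
Fixpoint lebesgue_rV n : {sigma_finite_measure set 'rV[R]_n -> \bar R} :=
  if n is m.+1 then rV_product (lebesgue_rV m)
  else (\d_(0 : 'rV[R]_0) : set 'rV[R]_0 -> \bar R).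

End lebesgue_rV.

Section euclidean.
Context {R : realType} {d : nat}.
Local Notation E := 'rV[R]_d.
Implicit Types (x y : E) (D : set E).

Definition dot x y : R := \sum_i x ord0 i * y ord0 i.

Definition bdry D : set E := closure D `\` D°.

(* Near each boundary point, D is the strict subgraph, in some unit direction e,
   of a Lipschitz function phi of the component orthogonal to e. *)
Definition lipschitz_boundary D := forall p, bdry D p ->
  exists (e : E) (r : R) (phi : E -> R),
    [/\ dot e e = 1, 0 < r, lipschitz phi &
     forall x, ball p r x -> (D x <-> dot x e < phi (x - dot x e *: e))].

Definition lipschitz_set D := [/\ open D, bounded_set D & lipschitz_boundary D].

Definition simply_connected D :=
  forall g : R -> E, {within `[0, 1], continuous g} ->
    g @` `[0, 1] `<=` D -> g 0 = g 1 ->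
  exists H : R * R -> E,
    [/\ {within `[0, 1] `*` `[0, 1], continuous H},
        H @` (`[0, 1] `*` `[0, 1]) `<=` D,
        (forall t, t \in `[0, 1] -> H (0, t) = g t /\ H (1, t) = g 0) &
        forall s, s \in `[0, 1] -> H (s, 0) = g 0 /\ H (s, 1) = g 0].

Definition lipschitz_domain D :=
  [/\ D !=set0, connected D & lipschitz_set D].

Definition is_mesh (Om : set E) (N : nat) (T : 'I_N -> set E) :=
  [/\ forall i, [/\ T i !=set0, T i `<=` Om & lipschitz_set (T i)],
      trivIset setT T &
      \bigcup_i closure (T i) = closure Om].

End euclidean.

Section sobolev.
Context {R : realType} {d : nat}.
Local Notation E := 'rV[R]_d.
Local Notation leb := (@lebesgue_rV R d).
Implicit Types (D : set E) (u v w phi : E -> R) (p q : E -> E).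

Definition L2 D : set (E -> R) :=
  [set u | patch (fun=> 0) D u \in Lfun leb 2%:E].

Definition L2v D : set (E -> E) :=
  [set q | forall i, L2 D (fun x => q x ord0 i)].

Definition ip D u v : R := \int[leb]_(x in D) (u x * v x).

Definition ipv D p q : R := \int[leb]_(x in D) dot (p x) (q x).

Definition partial (i : 'I_d) u : E -> R := fun x => 'D_(delta_mx ord0 i) u x.

Definition cgrad u : E -> E := fun x => \row_i partial i u x.

Definition smooth u :=
  forall (s : seq 'I_d) (x : E), differentiable (foldr partial u s) x.

Definition testfun D : set (E -> R) :=
  [set phi | [/\ smooth phi, compact (closure [set x | phi x != 0]) &
                 closure [set x | phi x != 0] `<=` D]].

Definition is_wgrad D u p := L2v D p /\
  forall phi, testfun D phi -> forall i,
    ip D u (partial i phi) = - ip D (fun x => p x ord0 i) phi.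

Definition is_wdiv D q u := L2 D u /\
  forall phi, testfun D phi -> ipv D q (cgrad phi) = - ip D u phi.

Definition grad D u : E -> E := xget 0 [set p | is_wgrad D u p].

Definition wdiv D q : E -> R := xget 0 [set u | is_wdiv D q u].

Definition H1 D : set (E -> R) :=
  [set u | L2 D u /\ exists p, is_wgrad D u p].

Definition Hdiv D : set (E -> E) :=
  [set q | L2v D q /\ exists u, is_wdiv D q u].

Definition normH1 D u : R :=
  Num.sqrt (ip D u u + ipv D (grad D u) (grad D u)).

Definition normHdiv D q : R :=
  Num.sqrt (ipv D q q + ip D (wdiv D q) (wdiv D q)).

Definition H10 D : set (E -> R) :=
  [set u | H1 D u /\ exists phi : nat -> E -> R,
     (forall n, testfun D (phi n)) /\
     normH1 D (u - phi n) @[n --> \oo] --> (0 : R)].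

Definition same_trace D u v := H10 D (u - v).

Definition Hm12 D : set ((E -> R) -> R) :=
  [set l | [/\ forall (c : R) u v, H1 D u -> H1 D v ->
                 l (c *: u + v) = c * l u + l v,
               forall u, H10 D u -> l u = 0 &
               exists C : R, forall u, H1 D u -> `|l u| <= C * normH1 D u]].

(* (q . n)|_{bd D}, n the outer unit normal *)
Definition ntrace D q : (E -> R) -> R :=
  fun u => ipv D q (grad D u) + ip D (wdiv D q) u.

(* A Lipschitz function g on bd D extends to a Lipschitz function G on R^d, and
   u has trace g iff u and G have the same trace. *)
Definition lipschitz_trace D u (g : E -> R) :=
  [lipschitz g x | x in bdry D] /\
  exists G : E -> R,
    [/\ lipschitz G, (forall x, bdry D x -> G x = g x) & same_trace D u G].

Definition ge0_H12 D u := H1 D u /\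
  exists (v : nat -> E -> R) (g : nat -> E -> R),
    [/\ forall n, [/\ H1 D (v n), lipschitz_trace D (v n) (g n) &
                      forall x, bdry D x -> 0 <= g n x] &
        forall l, Hm12 D l -> l (v n) @[n --> \oo] --> l u].

Definition ge0_Hm12 D (l : (E -> R) -> R) :=
  forall v, ge0_H12 D v -> 0 <= l v.

Definition signorini (Om : set E) (f : E -> R) u :=
  [/\ H1 Om u /\ Hdiv Om (grad Om u),
      - wdiv Om (grad Om u) + u = f %[ae leb in Om],
      ge0_H12 Om u,
      ge0_Hm12 Om (ntrace Om (grad Om u)) &
      ntrace Om (grad Om u) u = 0].

End sobolev.

Variant bc_form := form_0 | form_n | form_s.

Section ultraweak.
Context {R : realType} {d : nat} (Om : set 'rV[R]_d).
Context {N : nat} (T : 'I_N -> set 'rV[R]_d).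
Local Notation E := 'rV[R]_d.
Local Notation leb := (@lebesgue_rV R d).

Definition piecewise {W : nmodType} (g : 'I_N -> E -> W) : E -> W :=
  fun x => \sum_i patch (fun=> 0) (T i) (g i) x.

Definition gradT (v : E -> R) : E -> E := piecewise (fun i => grad (T i) v).

Definition divT (q : E -> E) : E -> R := piecewise (fun i => wdiv (T i) q).

Definition Vspace : Type := ((E -> R) * (E -> E))%type.

Definition inV (v : Vspace) :=
  [/\ L2 Om v.1, forall i, H1 (T i) v.1,
      L2v Om v.2 & forall i, Hdiv (T i) v.2].

Definition ipV (v w : Vspace) : R :=
  ip Om v.1 w.1 + ipv Om (gradT v.1) (gradT w.1) +
  ipv Om v.2 w.2 + ip Om (divT v.2) (divT w.2).

Definition normV (v : Vspace) : R := Num.sqrt (ipV v v).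

(* w in H^1(Om) with w|_{bd T} = uh|_{bd T} for all T *)
Definition ext12 (uh : 'I_N -> E -> R) : set (E -> R) :=
  [set w | H1 Om w /\ forall i, same_trace (T i) (uh i) w].

(* q in H(div,Om) with (q . n_T)|_{bd T} = sh|_{bd T} for all T *)
Definition extm12 (sh : 'I_N -> (E -> R) -> R) : set (E -> E) :=
  [set q | Hdiv Om q /\
     forall i v, H1 (T i) v -> sh i v = ntrace (T i) q v].

Definition H12S (uh : 'I_N -> E -> R) :=
  (forall i, H1 (T i) (uh i)) /\ ext12 uh !=set0.

Definition Hm12S (sh : 'I_N -> (E -> R) -> R) :=
  (forall i, Hm12 (T i) (sh i)) /\ extm12 sh !=set0.

Definition norm12S uh : R := inf [set normH1 Om w | w in ext12 uh].

Definition normm12S sh : R := inf [set normHdiv Om q | q in extm12 sh].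

Definition Uspace : Type :=
  ((E -> R) * (E -> E) * ('I_N -> E -> R) * ('I_N -> (E -> R) -> R))%type.

Definition U_u (u : Uspace) : E -> R := u.1.1.1.
Definition U_sigma (u : Uspace) : E -> E := u.1.1.2.
Definition U_uhat (u : Uspace) : 'I_N -> E -> R := u.1.2.
Definition U_sigmahat (u : Uspace) : 'I_N -> (E -> R) -> R := u.2.

Definition inU (u : Uspace) :=
  [/\ L2 Om (U_u u), L2v Om (U_sigma u), H12S (U_uhat u) &
      Hm12S (U_sigmahat u)].

(* equality in L^2 x L^2^d x H^{1/2}(S) x H^{-1/2}(S), see the conventions above *)
Definition eqU (u v : Uspace) :=
  [/\ U_u u = U_u v %[ae leb in Om],
      U_sigma u = U_sigma v %[ae leb in Om],
      forall i, same_trace (T i) (U_uhat u i) (U_uhat v i) &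
      forall i w, H1 (T i) w -> U_sigmahat u i w = U_sigmahat v i w].

Definition normU (u : Uspace) : R :=
  Num.sqrt (ip Om (U_u u) (U_u u) + ipv Om (U_sigma u) (U_sigma u) +
            norm12S (U_uhat u) ^+ 2 + normm12S (U_sigmahat u) ^+ 2).

Definition bform (u : Uspace) (v : Vspace) : R :=
  ipv Om (U_sigma u) (gradT v.1) + ip Om (U_u u) v.1
  - \sum_i U_sigmahat u i v.1
  + ipv Om (U_sigma u) v.2 + ip Om (U_u u) (divT v.2)
  - \sum_i ntrace (T i) v.2 (U_uhat u i).

Definition Theta (u : Uspace) : Vspace :=
  xget 0 [set z : Vspace | inV z /\ forall v, inV v -> ipV z v = bform u v].

Definition gamma0 (u : Uspace) : E -> R := xget 0 (ext12 (U_uhat u)).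

Definition gamman (u : Uspace) : (E -> R) -> R :=
  ntrace Om (xget 0 (extm12 (U_sigmahat u))).

Definition aform (star : bc_form) (beta : R) (u v : Uspace) : R :=
  bform u (beta *: Theta v) +
  match star with
  | form_0 => gamman u (gamma0 v)
  | form_n => gamman v (gamma0 u)
  | form_s => 2^-1 * (gamman u (gamma0 v) + gamman v (gamma0 u))
  end.

Definition Frhs (f : E -> R) (beta : R) (v : Uspace) : R :=
  ip Om f (beta *: Theta v).1.

Definition cone (star : bc_form) (u : Uspace) :=
  inU u /\
  match star with
  | form_0 => ge0_H12 Om (gamma0 u)
  | form_n => ge0_Hm12 Om (gamman u)
  | form_s => ge0_H12 Om (gamma0 u) /\ ge0_Hm12 Om (gamman u)
  end.

Definition solves_VI (star : bc_form) (f : E -> R) (beta : R) (u : Uspace) :=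
  cone star u /\
  forall v, cone star v -> Frhs f beta (v - u) <= aform star beta u (v - u).

Definition is_continuity_constant (C : R) :=
  0 < C /\
  forall u v, inU u -> inV v -> `|bform u v| <= C * normU u * normV v.

Definition U_of_SP (u : E -> R) : Uspace :=
  (u, grad Om u, fun=> u, fun i => ntrace (T i) (grad Om u)).

End ultraweak.

(* Main.v *)
(* The mesh is removed from b by integrating by parts: if w in H^1(Om) and q in
   H(div,Om) extend the skeleton traces of u = (u, sigma, uhat, sigmahat), then
   b(u,(v,tau)) = (sigma - q, grad_T v) + (u - div q, v)
                + (sigma - grad w, tau) + (u - w, div_T tau),
   and <gamma_n u, gamma_0 u> is the Green functional of q at w.

   Coercivity tests Theta u, of norm b, against explicit functions.  With w the
   H^1-minimal extension of gamma_0 u and W its norm, (w, - grad w) gives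
   <gamma_n u, gamma_0 u> >= W^2 / 2 - b^2.  With v in H^1_0 solving
   (v, phi)_{H^1} = (u, phi) + (sigma, grad phi), the function (v, sigma - grad v)
   gives |(u, sigma)| <= b + W.  The minimal extensions of uhat and sigmahat to
   Om satisfy div grad w = w and grad div q = q on each element, and (0, grad w)
   and (div q, 0) bound the two trace norms by b + |(u, sigma)|.

   (SP) is solved by minimisation over the H^1-closure of the functions whose
   trace is Lipschitz and nonnegative.  Its solution u satisfies b(u,(v,tau)) =
   (f,v), so that a(u, v - u) - F(v - u) reduces to boundary pairings, which are
   nonnegative on the cone.  Coercivity makes it the only solution of (VI). *)

Require Import Defs.
From HB Require Import structures.
From mathcomp Require Import all_boot all_order all_algebra.
From mathcomp Require Import all_classical all_reals all_analysis.
From mathcomp Require Import measurable_realfun ring lra.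
Import Order.TTheory GRing.Theory Num.Theory.
Import numFieldNormedType.Exports.
Local Open Scope classical_set_scope.
Local Open Scope ring_scope.

(** * Variational inequalities in semi-inner-product spaces *)

(** Elements of all spaces are functions, not classes, so every norm is a seminorm and every form
    obeys its laws only on a set of admissible functions. Hence the Hilbert space arguments are made
    for a form [B] on a subset [S], and equality of weak derivatives is used through pairings with
    L2 functions. Reading a trace space as a quotient by [H10] and a normal trace as Green's
    functional turns every trace estimate into a Cauchy-Schwarz inequality with constant 1; with the
    explicit test functions this yields a numerical coercivity constant. Of the factor [beta] before
    the squared norm of [Theta u], one unit absorbs the negative term in the lower bound of the
    boundary pairing and at least one unit remains: hence [2 <= beta]. The norm of U is built from
    infima over extensions. Solvability of (VI) is therefore drawn from (SP), where the minimisation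
    takes place in [H1], whose completeness descends from that of L2. Completeness of V serves the
    Riesz representatives. Splitting integrals over the elements requires their boundaries to be
    null sets; this is where the Lipschitz regularity of the elements enters. *)

Section semi_inner_product.
Context {R : realType} {X : lmodType R}.
Implicit Types (S C : set X) (B : X -> X -> R) (l : X -> R).

(** Linearity is asked on [S] alone, because the integral of a non-integrable function is a default
    value that obeys no law. [B u u = 0] does not give [u = 0]: functions that agree almost
    everywhere are not identified. *)
Record semi_inner S B : Prop := SemiInner {
  semi_inner_nonempty : S 0;
  semi_inner_lin : forall (c : R) u v, S u -> S v -> S (c *: u + v);
  semi_innerC : forall u v, S u -> S v -> B u v = B v u;
  semi_inner_linl : forall (c : R) u v w, S u -> S v -> S w ->
    B (c *: u + v) w = c * B u w + B v w;
  semi_inner_ge0 : forall u, S u -> 0 <= B u u }.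

Definition sconv B (x : nat -> X) y := forall e : R, 0 < e ->
  exists N : nat, forall n, (N <= n)%N -> B (x n - y) (x n - y) < e.

Definition scauchy B (x : nat -> X) := forall e : R, 0 < e ->
  exists N : nat, forall m n, (N <= m)%N -> (N <= n)%N ->
    B (x m - x n) (x m - x n) < e.

Definition scomplete S B := forall x : nat -> X, (forall n, S (x n)) ->
  scauchy B x -> exists2 y, S y & sconv B x y.

Definition snorm B u := Num.sqrt (B u u).

Definition linear_on S l := forall (c : R) u v, S u -> S v ->
  l (c *: u + v) = c * l u + l v.

Section theory.
Context S B (SB : semi_inner S B).

Lemma semi_innerZ (c : R) u : S u -> S (c *: u).
Proof.
by move=> Su; rewrite -[_ *: _]addr0; apply: (semi_inner_lin _ _ SB) => //;
  exact: (semi_inner_nonempty _ _ SB).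
Qed.

Lemma semi_innerD u v : S u -> S v -> S (u + v).
Proof. by move=> Su Sv; rewrite -[u]scale1r; apply: (semi_inner_lin _ _ SB). Qed.

Lemma semi_innerN u : S u -> S (- u).
Proof. by move=> Su; rewrite -scaleN1r; apply: semi_innerZ. Qed.

Lemma semi_innerB u v : S u -> S v -> S (u - v).
Proof. by move=> Su Sv; apply: semi_innerD => //; apply: semi_innerN. Qed.

Lemma linear_on0 l : linear_on S l -> l 0 = 0.
Proof.
move=> ll; have S0 := semi_inner_nonempty _ _ SB.
have := ll 1 0 0 S0 S0; rewrite scaler0 addr0 mul1r; lra.
Qed.

Lemma linear_onZ l (c : R) u : linear_on S l -> S u -> l (c *: u) = c * l u.
Proof.
move=> ll Su; have S0 := semi_inner_nonempty _ _ SB.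
by have := ll c u 0 Su S0; rewrite addr0 (linear_on0 _ ll) addr0.
Qed.

Lemma linear_onD l u v : linear_on S l -> S u -> S v -> l (u + v) = l u + l v.
Proof. by move=> ll Su Sv; rewrite -{1}[u]scale1r ll// mul1r. Qed.

Lemma linear_onB l u v : linear_on S l -> S u -> S v -> l (u - v) = l u - l v.
Proof.
move=> ll Su Sv; rewrite linear_onD//; last exact: semi_innerN.
by rewrite -scaleN1r linear_onZ// mulN1r.
Qed.

Lemma semi_inner_linear_onl w : S w -> linear_on S (B^~ w).
Proof. by move=> Sw c u v Su Sv; rewrite (semi_inner_linl _ _ SB). Qed.

Lemma semi_inner_linear_onr w : S w -> linear_on S (B w).
Proof.
move=> Sw c u v Su Sv; rewrite (semi_innerC _ _ SB)//.
  by rewrite (semi_inner_linl _ _ SB)// (semi_innerC _ _ SB u)//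
    (semi_innerC _ _ SB v).
exact: (semi_inner_lin _ _ SB).
Qed.

Lemma semi_innerDD (c : R) u v : S u -> S v ->
  B (u + c *: v) (u + c *: v) = B u u + 2 * c * B u v + c ^+ 2 * B v v.
Proof.
move=> Su Sv; have Scv : S (c *: v) by exact: semi_innerZ.
have Suv : S (u + c *: v) by exact: semi_innerD.
rewrite (linear_onD _ _ _ (semi_inner_linear_onl _ Suv))//.
rewrite !(linear_onD _ _ _ (semi_inner_linear_onr _ _))//.
rewrite !(linear_onZ _ _ _ (semi_inner_linear_onr _ _))//.
rewrite !(linear_onZ _ _ _ (semi_inner_linear_onl _ _))//.
rewrite (semi_innerC _ _ SB v u)//; ring.
Qed.

Lemma snorm_ge0 u : 0 <= snorm B u. Proof. exact: sqrtr_ge0. Qed.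

Lemma sqr_snorm u : S u -> snorm B u ^+ 2 = B u u.
Proof. by move=> Su; rewrite sqr_sqrtr// (semi_inner_ge0 _ _ SB). Qed.

Lemma semi_inner_CS u v : S u -> S v -> `|B u v| <= snorm B u * snorm B v.
Proof.
move=> Su Sv.
have Q c : 0 <= B u u + 2 * c * B u v + c ^+ 2 * B v v.
  rewrite -semi_innerDD//; apply: (semi_inner_ge0 _ _ SB).
  by apply: semi_innerD => //; exact: semi_innerZ.
have u0 := semi_inner_ge0 _ _ SB _ Su; have v0 := semi_inner_ge0 _ _ SB _ Sv.
have H : B u v ^+ 2 <= B u u * B v v.
  have [vv|vv] := eqVneq (B v v) 0.
    (* For a null vector [v] the quadratic is affine in [c]; were [B u v] nonzero, this [c] would
       give it the value -1. *)
    have := Q (- (B u u + 1) / (2 * B u v)).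
    rewrite vv !mulr0 addr0.
    have [->|uv] := eqVneq (B u v) 0; first by rewrite expr0n.
    have -> : 2 * (- (B u u + 1) / (2 * B u v)) * B u v = - (B u u + 1).
      by field.
    lra.
  have vp : 0 < B v v by rewrite lt_neqAle eq_sym vv.
  (* The minimiser of the quadratic. *)
  have := Q (- B u v / B v v).
  have -> : B u u + 2 * (- B u v / B v v) * B u v + (- B u v / B v v) ^+ 2 * B v v
     = B u u - B u v ^+ 2 / B v v by field.
  by rewrite subr_ge0 ler_pdivrMr.
rewrite -sqrtrM// -sqrtr_sqr ler_sqrt//; exact: mulr_ge0.
Qed.

Lemma snormZ (c : R) u : S u -> snorm B (c *: u) = `|c| * snorm B u.
Proof.
move=> Su; have Scu : S (c *: u) by exact: semi_innerZ.
rewrite /snorm (linear_onZ _ _ _ (semi_inner_linear_onl _ _))//.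
rewrite (linear_onZ _ _ _ (semi_inner_linear_onr _ _))//.
by rewrite mulrA -expr2 sqrtrM ?sqr_ge0// sqrtr_sqr.
Qed.

Lemma snormN u : S u -> snorm B (- u) = snorm B u.
Proof. by move=> Su; rewrite -scaleN1r snormZ// normrN1 mul1r. Qed.

Lemma semi_innerBC u v : S u -> S v -> B (u - v) (u - v) = B (v - u) (v - u).
Proof.
move=> Su Sv; have Svu : S (v - u) by exact: semi_innerB.
rewrite -[in LHS](opprB v u) -!sqr_snorm//; last exact: semi_innerN.
by rewrite snormN.
Qed.

Lemma ler_snormD u v : S u -> S v -> snorm B (u + v) <= snorm B u + snorm B v.
Proof.
move=> Su Sv; rewrite -(@ler_pXn2r _ 2) ?nnegrE ?addr_ge0 ?snorm_ge0//.
rewrite sqr_snorm; last exact: semi_innerD.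
have := semi_innerDD 1 _ _ Su Sv; rewrite scale1r => ->.
rewrite -!sqr_snorm//; have := semi_inner_CS _ _ Su Sv.
have := ler_norm (B u v); nra.
Qed.

Lemma snorm_lt u e : S u -> 0 < e -> (snorm B u < e) = (B u u < e ^+ 2).
Proof.
move=> Su e0; rewrite -sqr_snorm// ltr_pXn2r// ?nnegrE ?snorm_ge0//.
exact: ltW.
Qed.

Lemma sconv_snorm x y : (forall n, S (x n)) -> S y -> sconv B x y ->
  forall e : R, 0 < e -> exists N : nat, forall n, (N <= n)%N ->
    snorm B (x n - y) < e.
Proof.
move=> Sx Sy xy e e0; have [|N HN] := xy (e ^+ 2); first exact: exprn_gt0.
exists N => n Nn; rewrite snorm_lt ?HN//; exact: semi_innerB.
Qed.

Definition convex_on C := forall (t : R) u v, 0 <= t -> t <= 1 -> C u -> C v ->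
  C (u + t *: (v - u)).

(** Phrased by approximation, so that a closed set also contains every member of [S] at distance
    zero from it. *)
Definition sclosed C := forall u, S u ->
  (forall e : R, 0 < e -> exists2 v, C v & B (u - v) (u - v) < e) -> C u.

(** First variation: divide by [t] and let [t] tend to 0. If [a] were negative, the explicit [t]
    would satisfy [t * |b| < - a], and the linear term would win. *)
Let quad_ge0 (a b : R) :
  (forall t, 0 < t -> t <= 1 -> 0 <= t * a + t ^+ 2 * b) -> 0 <= a.
Proof.
move=> H; rewrite leNgt; apply/negP => a0.
pose t := - a / (2 * (`|b| - a)).
have b0 := normr_ge0 b; have bb := ler_norm b.
have d0 : 0 < 2 * (`|b| - a) by lra.
have t0 : 0 < t by rewrite divr_gt0// oppr_gt0.
have t1 : t <= 1 by rewrite ler_pdivrMr//; lra.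
have tE : t * (2 * (`|b| - a)) = - a by rewrite /t divfK// gt_eqF.
have := H _ t0 t1; nra.
Qed.

(** Direct method for [J v = B v v / 2 - l v]: the parallelogram law makes a minimising sequence
    Cauchy, its limit lies in [C] and minimises, and the first variation along the segment from [u]
    to [v] is the inequality. In a seminorm a minimiser is determined up to null vectors. *)
Theorem variational_inequality C l (M : R) :
  scomplete S B -> C `<=` S -> C !=set0 -> convex_on C -> sclosed C ->
  linear_on S l -> (forall u, S u -> `|l u| <= M * snorm B u) ->
  exists2 u, C u & forall v, C v -> l (v - u) <= B u (v - u).
Proof.
move=> cS CS [c0 Cc0] Ccvx Ccl ll lM.
pose J v := B v v / 2 - l v.
(* Completing the square in the norm of [v]. *)
have Jlb v : S v -> - (M ^+ 2) / 2 <= J v.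
  move=> Sv; rewrite /J -sqr_snorm//.
  have := lM _ Sv; have := ler_norm (l v); have := sqr_ge0 (snorm B v - M); nra.
pose m := inf [set J v | v in C].
have Jm v : C v -> m <= J v.
  move=> Cv; apply: inf_lbound; last by exists v.
  by exists (- (M ^+ 2) / 2) => _ [w Cw <-]; apply: Jlb; exact: CS.
have JE u (c : R) w : S u -> S w ->
    J (u + c *: w) = J u + c * (B u w - l w) + c ^+ 2 * (B w w / 2).
  move=> Su Sw; rewrite /J semi_innerDD//.
  rewrite (linear_onD _ _ _ ll)//; last exact: semi_innerZ.
  by rewrite (linear_onZ _ _ _ ll)//; field.
have Ex n : exists v, C v /\ J v < m + n.+1%:R^-1.
  have hi : has_inf [set J v | v in C].
    split; first by exists (J c0), c0.
    by exists (- (M ^+ 2) / 2) => _ [w Cw <-]; apply: Jlb; exact: CS.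
  have [_ [v Cv <-] Hv] := inf_adherent (ltac:(by rewrite invr_gt0 ltr0n) : 0 < n.+1%:R^-1 :> R) hi.
  by exists v.
clearbody m; clearbody J; have [x Hx] := choice Ex.
have Cx n : C (x n) by have [] := Hx n.
have Sx n : S (x n) by apply: CS.
have Jx n : J (x n) < m + n.+1%:R^-1 by have [] := Hx n.
have inv_small e : 0 < e -> exists N : nat, forall n, (N <= n)%N -> n.+1%:R^-1 < e :> R.
  move=> e0; exists (Num.truncn e^-1) => n Nn.
  rewrite -[e]invrK ltf_pV2 ?posrE ?ltr0n ?invr_gt0//.
  have /andP[_ h] := truncn_itv (ltW (ltac:(by rewrite invr_gt0) : 0 < e^-1)).
  by apply: lt_le_trans h _; rewrite ler_nat ltnS.
(* Parallelogram law: the midpoint lies in [C], and there [J] equals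
   [(J u + J v) / 2 - B (u - v) (u - v) / 8], which is at least [m]. *)
have par u v : C u -> C v -> B (u - v) (u - v) <= 4 * (J u + J v - 2 * m).
  move=> Cu Cv; have Su := CS _ Cu; have Sv := CS _ Cv.
  have Svu : S (v - u) by exact: semi_innerB.
  have := Jm _ (Ccvx 2^-1 u v ltac:(lra) ltac:(lra) Cu Cv).
  rewrite JE//.
  have := JE u 1 (v - u) Su Svu.
  rewrite scale1r addrC subrK => ->.
  rewrite semi_innerBC//; rewrite expr1n; lra.
have [|u Su xu] := cS x Sx.
  move=> e e0; have [N HN] := inv_small (e / 8) ltac:(lra).
  exists N => p q Np Nq.
  have := par _ _ (Cx p) (Cx q); have := Jx p; have := Jx q.
  have := HN _ Np; have := HN _ Nq.
  by move: (J (x p)) (J (x q)) (p.+1%:R^-1) (q.+1%:R^-1) => ? ? ? ?; lra.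
have Cu : C u.
  apply: Ccl => // e e0; have [N HN] := xu _ e0.
  by exists (x N) => //; rewrite semi_innerBC//; exact: HN.
(* Semicontinuity at the limit: [J u <= J (x n) + (snorm B u + |M|) * snorm B (x n - u)]; the
   quadratic remainder has the favourable sign. *)
have Ju : J u <= m.
  apply/ler_addgt0Pr => e e0.
  pose K := snorm B u + `|M| + 1.
  have K0 : 0 < K by rewrite /K; have := snorm_ge0 u; have := normr_ge0 M; lra.
  have [N1 HN1] := sconv_snorm _ _ Sx Su xu (e / 2 / K) ltac:(by rewrite !divr_gt0).
  have [N2 HN2] := inv_small (e / 2) ltac:(lra).
  pose n := maxn N1 N2.
  have h1 := HN1 n (leq_maxl _ _); have h2 := HN2 n (leq_maxr _ _).
  have Sd : S (x n - u) by exact: semi_innerB.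
  have JJ := JE u 1 (x n - u) Su Sd.
  have xE : u + 1 *: (x n - u) = x n by rewrite scale1r addrC subrK.
  rewrite xE expr1n !mul1r in JJ.
  have := semi_inner_ge0 _ _ SB _ Sd.
  have := lM _ Sd; have := semi_inner_CS _ _ Su Sd.
  have l1 := ler_norm (l (x n - u)); have l2 := ler_norm (- B u (x n - u)).
  rewrite normrN in l2.
  have := Jx n; have Mn := ler_norm M; have dn := snorm_ge0 (x n - u).
  have : snorm B (x n - u) * K < e / 2 by rewrite -ltr_pdivlMr.
  have : M * snorm B (x n - u) <= `|M| * snorm B (x n - u) by exact: ler_wpM2r.
  rewrite /K !mulrDr mulr1; move: h2 JJ; move: (n.+1%:R^-1) => ? ? ?; lra.
exists u => // v Cv; have Sv := CS _ Cv.
have Svu : S (v - u) by exact: semi_innerB.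
rewrite -subr_ge0; apply: (quad_ge0 _ (B (v - u) (v - u) / 2)) => t t0 t1.
have := Jm _ (Ccvx t u v (ltW t0) t1 Cu Cv); rewrite JE//.
lra.
Qed.

(** On a subspace the inequality can be tested with [u - v] and with [u + v], which gives both
    signs. *)
Lemma variational_equality C l (M : R) :
  scomplete S B -> C `<=` S -> C 0 ->
  (forall (c : R) u v, C u -> C v -> C (c *: u + v)) -> sclosed C ->
  linear_on S l -> (forall u, S u -> `|l u| <= M * snorm B u) ->
  exists2 u, C u & forall v, C v -> B u v = l v.
Proof.
move=> cS CS C0 Clin Ccl ll lM.
have CD u v : C u -> C v -> C (u + v).
  by move=> Cu Cv; rewrite -[u]scale1r; exact: Clin.
have CZ (c : R) u : C u -> C (c *: u).
  by move=> Cu; rewrite -[_ *: _]addr0; exact: Clin.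
have [||u Cu Hu] := variational_inequality C l M cS CS _ _ Ccl ll lM.
- by exists 0.
- move=> t u v _ _ Cu Cv; apply: (CD u) => //; apply: (CZ t); apply: (CD v) => //.
  by rewrite -scaleN1r; exact: CZ.
exists u => // v Cv; apply/eqP; rewrite eq_le; apply/andP; split.
  have := Hu (u - v); rewrite (addrAC u) subrr add0r.
  have Sv := CS _ Cv.
  rewrite -scaleN1r (linear_onZ _ _ _ ll)// (linear_onZ _ _ _ (semi_inner_linear_onr _ (CS _ Cu)))//.
  rewrite !mulN1r lerN2; apply; rewrite addrC; exact: Clin.
have := Hu (v + u); rewrite addrK; apply; exact: CD.
Qed.

Lemma riesz l (M : R) : scomplete S B ->
  linear_on S l -> (forall u, S u -> `|l u| <= M * snorm B u) ->
  exists2 u, S u & forall v, S v -> B u v = l v.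
Proof.
move=> cS ll lM; apply: (variational_equality S l M) => //.
- exact: (semi_inner_nonempty _ _ SB).
- exact: (semi_inner_lin _ _ SB).
Qed.

End theory.
End semi_inner_product.

Set Implicit Arguments.
Unset Strict Implicit.
Unset Printing Implicit Defensive.

Lemma semi_innerBB (R : realType) (X : lmodType R) (S : set X) (B : X -> X -> R)
  (SB : semi_inner S B) u v : S u -> S v ->
  B (u - v) (u - v) = B u u - 2 * B u v + B v v.
Proof.
move=> Su Sv; have := semi_innerDD _ _ SB (-1) _ _ Su Sv; rewrite scaleN1r => ->.
by move: (B u u) (B u v) (B v v) => *; ring.
Qed.

(** [x - y] is the orthogonal projection of [x] on [C], so [y] has least norm in the class of [x]
    modulo [C]. With [C] the functions of zero trace, [y] is the minimal extension of the trace of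
    [x]. *)
Lemma orthogonal_complement_proj (R : realType) (X : lmodType R) (S : set X) (B : X -> X -> R)
    (SB : semi_inner S B) (C : set X) (x : X) :
  scomplete S B -> C `<=` S -> C 0 ->
  (forall (c : R) u v, C u -> C v -> C (c *: u + v)) -> sclosed S B C ->
  S x -> exists y, [/\ S y, C (x - y) & forall v, C v -> B y v = 0].
Proof.
move=> cS CS C0 Clin Ccl Sx.
have [p Cp Hp] := variational_equality _ _ SB C (B x) (snorm B x) cS CS C0 Clin Ccl
  (semi_inner_linear_onr _ _ SB _ Sx)
  (fun u Su => semi_inner_CS _ _ SB _ _ Sx Su).
have Sp := CS _ Cp; exists (x - p); split; first exact: (semi_innerB _ _ SB).
  by rewrite opprB addrCA subrr addr0.
move=> v Cv; have Sv := CS _ Cv.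
rewrite (linear_onB _ _ SB _ _ _ (semi_inner_linear_onl _ _ SB _ Sv))//.
by rewrite Hp// subrr.
Qed.

(** * Lebesgue measure on R^d: open sets, translations, cubes *)

Section rV_measure.
Context {R : realType}.

Lemma measurable_rV_coordP n (i : 'I_n) (P : set R) :
  measurable P -> measurable [set x : 'rV[R]_n | P (x ord0 i)].
Proof.
move=> mP; rewrite -[X in measurable X]setTI.
exact: (measurable_rV_coord i measurableT mP).
Qed.

Lemma measurable_rV_forall n (P : 'I_n -> set R) :
  (forall i, measurable (P i)) ->
  measurable [set x : 'rV[R]_n | forall i, P i (x ord0 i)].
Proof.
move=> mP.
rewrite (_ : [set _ | _] = \bigcap_(i in [set: 'I_n]) [set x : 'rV[R]_n | P i (x ord0 i)]).
  apply: fin_bigcap_measurable; first exact: finite_finset.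
  by move=> i _; exact: measurable_rV_coordP.
by apply/seteqP; split=> x /= H i; [move=> _|]; exact: H.
Qed.

Lemma rV_ballE n (x y : 'rV[R]_n) e : 0 < e ->
  ball x e y <-> forall i, `|x ord0 i - y ord0 i| < e.
Proof.
move=> e0; split; first by move=> [_ h] i; exact: h.
by move=> h; split => // i j; rewrite (ord1 i); exact: h.
Qed.

Lemma measurable_rV_ball n (x : 'rV[R]_n) e : measurable (ball x e).
Proof.
have [e0|e0] := ltP 0 e; last first.
  rewrite (_ : ball x e = set0)//; apply/seteqP; split => // y [e0'].
  by move: e0; rewrite leNgt e0'.
rewrite (_ : ball x e = [set y | forall i, ball (x ord0 i) e (y ord0 i)]).
  by apply: (@measurable_rV_forall n (fun i => ball (x ord0 i) e)) => i; exact: measurable_realfun.measurable_ball.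
by apply/seteqP; split => y /= => [/rV_ballE|h]; [|apply/rV_ballE]; exact.
Qed.

(** The sigma-algebra is generated by the coordinates, so an open set has to be exhibited as a
    countable union of boxes: the sup-norm balls of rational centre and radius [1 / (k + 1)] that
    lie inside it. *)
Lemma open_measurable_rV n (A : set 'rV[R]_n) : open A -> measurable A.
Proof.
move=> oA.
pose c (p : 'rV[rat]_n * nat) : 'rV[R]_n := map_mx ratr p.1.
pose Q (p : 'rV[rat]_n * nat) : set 'rV[R]_n :=
  [set y | ball (c p) p.2.+1%:R^-1 y /\
           ball (c p) p.2.+1%:R^-1 `<=` A].
have -> : A = \bigcup_p Q p.
  apply/seteqP; split; last by move=> y [p _ [h]]; apply.
  move=> x Ax; have [e /= e0 eA] := (nbhs_ballP _ _).1 (open_nbhs_nbhs (conj oA Ax)).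
  have [k Hk] : exists k : nat, 2 * k.+1%:R^-1 < e.
    have /ltr_add_invr[k] : 0 < e / 2 by rewrite divr_gt0.
    by rewrite add0r => h; exists k; rewrite mulrC -ltr_pdivlMr.
  have k0 : 0 < k.+1%:R^-1 :> R by rewrite invr_gt0 ltr0n.
  have Hq i : exists q : rat, `|x ord0 i - ratr q| < k.+1%:R^-1.
    move: (k.+1%:R^-1 : R) k0 => t t0.
    have [|q] := @rat_in_itvoo R (x ord0 i - t) (x ord0 i + t); first lra.
    by rewrite in_itv/= => /andP[q1 q2]; exists q; rewrite ltr_norml; lra.
  have [q qE] := choice Hq.
  exists (\row_i q i, k) => //; split.
    by apply/rV_ballE => //= i; rewrite !mxE distrC.
  move=> y /rV_ballE /= => /(_ k0) yq; apply: eA; apply/rV_ballE => // i.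
  have := yq i; have := qE i; rewrite !mxE => h1 h2.
  apply: le_lt_trans (ler_distD (ratr (q i)) _ _) _.
  by move: (k.+1%:R^-1 : R) h1 h2 Hk => t; lra.
apply: countable_bigcupT_measurable; first exact: countableP.
move=> p; have [h|h] := pselect (ball (c p) p.2.+1%:R^-1 `<=` A).
  rewrite (_ : Q p = ball (c p) p.2.+1%:R^-1).
    exact: measurable_rV_ball.
  by apply/seteqP; split => y //= [].
rewrite (_ : Q p = set0)//.
by apply/seteqP; split => y //= [].
Qed.

Lemma closed_measurable_rV n (A : set 'rV[R]_n) : closed A -> measurable A.
Proof.
by move=> cA; rewrite -[A]setCK; apply: measurableC; apply: open_measurable_rV; rewrite openC.
Qed.

Lemma continuous_measurable_rV n (f : 'rV[R]_n -> R) : continuous f ->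
  measurable_fun [set: 'rV[R]_n] f.
Proof.
move=> cf; apply: (measurability _ (measurable_realfun.RGenOpens.measurableE R)).
move=> _ [_ [a [b ->]] <-]; rewrite setTI; apply: open_measurable_rV.
by apply: open_comp; [move=> + _; exact: cf|exact: interval_open].
Qed.

(** Lebesgue measure is determined by its values on half-open intervals, and its image under a
    translation has the same values there. *)
Lemma lebesgue_measure_shift (a : R) (A : set R) : measurable A ->
  lebesgue_measure ((fun x : R => x + a) @^-1` A) = lebesgue_measure A.
Proof.
move=> mA.
have mphi : measurable_fun [set: measurableTypeR R]
    (fun x : R => (x + a : measurableTypeR R)).
  exact: measurable_realfun.measurable_funD.
apply/esym/(@lebesgue_measure_unique R
  (measure_function_pushforward__canonical__measure_function_Measure
     (@lebesgue_measure R) mphi)) => //.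
move=> _ [[c b]] _ <-.
change (lebesgue_measure `]c, b]%classic =
  lebesgue_measure ((fun x : R => x + a) @^-1` `]c, b])).
rewrite (_ : _ @^-1` _ = `]c - a, b - a]%classic).
  rewrite !lebesgue_measure_itv/= !lte_fin ltrD2r; case: ifP => // _.
  by rewrite -!EFinB; congr (_%:E); ring.
by apply/seteqP; split => x /=; rewrite !in_itv/= ltrBlDr lerBrDr.
Qed.

Lemma measurable_rV_shift n (a : 'rV[R]_n) :
  measurable_fun setT (fun x : 'rV[R]_n => x + a).
Proof.
apply: measurable_fun_rV => i.
apply: (eq_measurable_fun (fun x : 'rV[R]_n => x ord0 i + a ord0 i)).
  by move=> x _; rewrite mxE.
by apply: measurable_realfun.measurable_funD => //; exact: measurable_rV_coord.
Qed.

Lemma rV_cons_head n (p : R * 'rV[R]_n) (j : 'I_1) :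
  rV_cons p ord0 (lshift n j) = p.1.
Proof. by rewrite [LHS]row_mxEl mxE. Qed.

Lemma rV_cons_tail n (p : R * 'rV[R]_n) j :
  rV_cons p ord0 (rshift 1 j) = p.2 ord0 j.
Proof. by rewrite [LHS]row_mxEr. Qed.

(** Induction on the dimension: a translated rectangle is the rectangle of the translated sides, and
    a product measure is determined by its values on rectangles. *)
Lemma lebesgue_rV_shift n (a : 'rV[R]_n) (A : set 'rV[R]_n) : measurable A ->
  lebesgue_rV n ((fun x => x + a) @^-1` A) = lebesgue_rV n A.
Proof.
elim: n a A => [|n IH] a A mA.
  congr (lebesgue_rV 0 _); apply/seteqP; split => x /=;
  by rewrite (_ : x + a = x)//; apply/rowP; case.
pose a0 := a ord0 ord0; pose a1 : 'rV[R]_n := \row_j a ord0 (lift ord0 j).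
pose tr (p : measurableTypeR R * 'rV[R]_n) := ((p.1 + a0 : measurableTypeR R), p.2 + a1).
have trE p : rV_cons (tr p) = rV_cons p + a.
  apply/rowP => i; rewrite [RHS]mxE; case: (split_ordP (i : 'I_(1 + n))) => j ->.
    rewrite !rV_cons_head /= /a0.
    by congr (_ + a _ _); apply/val_inj; rewrite /= (ord1 j).
  rewrite !rV_cons_tail /= mxE mxE.
  by congr (_ + a _ _); apply/val_inj.
have mtr : measurable_fun setT tr.
  apply/measurable_fun_pair => /=.
    apply: measurable_realfun.measurable_funD => //.
  exact: (measurableT_comp (measurable_rV_shift a1) measurable_snd).
have mpre B : measurable B -> measurable (@rV_cons R n @^-1` B).
  by move=> mB; rewrite -[X in measurable X]setTI; exact: measurable_rV_cons.
have H := product_measure_unique (m1 := @lebesgue_measure R) (m2 := lebesgue_rV n)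
  (m' := measure_function_pushforward__canonical__measure_function_Measure
    (@lebesgue_measure R \x lebesgue_rV n)%E mtr).
have {}H := H _ _ (mpre _ mA).
rewrite /= /rV_product /pushforward.
rewrite (_ : @rV_cons R n @^-1` _ = tr @^-1` (@rV_cons R n @^-1` A)); last first.
  by apply/seteqP; split => p /=; rewrite trE.
apply/esym/H => B C mB mC.
change ((@lebesgue_measure R \x lebesgue_rV n)%E (tr @^-1` (B `*` C)) =
  (@lebesgue_measure R B * lebesgue_rV n C)%E).
rewrite (_ : tr @^-1` _ = ((fun x : R => x + a0) @^-1` B) `*` ((fun y => y + a1) @^-1` C)) //.
rewrite product_measure1E.
- by congr (_ * _)%E; [exact: lebesgue_measure_shift|exact: IH].
- rewrite -[X in measurable X]setTI.
  have : measurable_fun setT (fun x : measurableTypeR R => (x + a0 : measurableTypeR R)).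
    exact: measurable_realfun.measurable_funD.
  exact.
- by rewrite -[X in measurable X]setTI; exact: measurable_rV_shift.
Qed.

Definition cube n (M : R) : set 'rV[R]_n :=
  [set x | forall i, x ord0 i \in `[- M, M]].
Arguments cube n M : clear implicits.

Lemma measurable_cube n M : measurable (cube n M).
Proof.
by apply: (@measurable_rV_forall n (fun=> `[- M, M]%classic)) => i; exact: measurable_itv.
Qed.

Lemma lebesgue_rV_cube n (M : R) : (lebesgue_rV n (cube n M) < +oo)%E.
Proof.
elim: n => [|n IH].
  by rewrite /= diracE; case: (_ \in _); rewrite ltry.
have preE : @rV_cons R n @^-1` cube n.+1 M = `[- M, M]%classic `*` cube n M.
  apply/seteqP; split => p /=.
    move=> H; split.
      by have := H (lshift n (ord0 : 'I_1)); rewrite rV_cons_head.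
    by move=> i; have := H (rshift 1 i); rewrite rV_cons_tail.
  move=> [h1 h2] i; case: (split_ordP (i : 'I_(1 + n))) => j ->.
    by rewrite rV_cons_head.
  by rewrite rV_cons_tail.
have -> : lebesgue_rV n.+1 (cube n.+1 M) =
    (lebesgue_measure `[(- M)%R, M]%classic * lebesgue_rV n (cube n M))%E.
  rewrite /= /rV_product /pushforward preE.
  by apply: product_measure1E => //; exact: measurable_cube.
have -> : lebesgue_measure `[- M, M]%classic = (if - M < M then M - - M else 0)%:E.
  by rewrite lebesgue_measure_itv/= lte_fin; case: ifP.
by apply: lte_mul_pinfty => //; case: ifP => // h; rewrite lee_fin; lra.
Qed.

Lemma rV_norm_coord n (x : 'rV[R]_n) i : `|x ord0 i| <= `|x|.
Proof.
apply/ler_addgt0Pr => e e0; apply: ltW.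
have xe0 : 0 < `|x| + e by rewrite ltr_wpDl.
have : ball (0 : 'rV[R]_n) (`|x| + e) x.
  by rewrite -ball_normE /ball_/= sub0r normrN ltrDl.
by move=> /(rV_ballE _ _ xe0) => /(_ i); rewrite mxE sub0r normrN.
Qed.

Lemma bounded_setP n (A : set 'rV[R]_n) : bounded_set A ->
  exists M : R, 0 < M /\ A `<=` cube n M.
Proof.
move=> [M [Mr HM]]; exists (`|M| + 1); split.
  by rewrite ltr_wpDl.
move=> x Ax i; rewrite in_itv/= -ler_norml; apply: le_trans (rV_norm_coord _ i) _.
by apply: HM => //; rewrite (le_lt_trans (ler_norm M))// ltrDl.
Qed.

End rV_measure.
Arguments cube {R} n M.

(** * Lipschitz boundaries are null sets *)

Section lipschitz_boundary.
Context {R : realType}.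

Lemma measurable_preimageT d1 d2 (T1 : measurableType d1) (T2 : measurableType d2)
    (f : T1 -> T2) A :
  measurable_fun setT f -> measurable A -> measurable (f @^-1` A).
Proof. by move=> mf mA; rewrite -[X in measurable X]setTI; exact: mf. Qed.

Lemma dotDl n (x y z : 'rV[R]_n) : dot (x + y) z = dot x z + dot y z.
Proof.
by rewrite /dot -big_split/=; apply: eq_bigr => i _; rewrite mxE mulrDl.
Qed.

Lemma dotZl n (c : R) (x z : 'rV[R]_n) : dot (c *: x) z = c * dot x z.
Proof. by rewrite /dot mulr_sumr; apply: eq_bigr => i _; rewrite mxE mulrA. Qed.

Lemma continuous_dotl n (e : 'rV[R]_n) : continuous (dot^~ e).
Proof.
move=> x; rewrite /dot /continuous_at.
apply: (@cvg_big R 'I_n +%R 0 xpredT (@add_continuous R) 'rV[R]_n (nbhs x)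
  (index_enum 'I_n) (fun i y => y ord0 i * e ord0 i) (fun i => x ord0 i * e ord0 i)) => i _.
by apply: cvgM; [exact: coord_continuous|exact: cvg_cst].
Qed.

Lemma lipschitz_ex n (phi : 'rV[R]_n -> R) : lipschitz phi ->
  exists2 K : R, 0 < K & forall x y, `|phi x - phi y| <= K * `|x - y|.
Proof.
move=> /pinfty_ex_gt0[K K0 HK]; exists K => // x y.
exact: (HK (x, y)).
Qed.

Lemma lipschitz_cts n (phi : 'rV[R]_n -> R) : lipschitz phi -> continuous phi.
Proof.
move=> /lipschitz_ex[K K0 HK] x.
apply/(@cvgrPdist_lt _ R^o _ (nbhs x) (nbhs_filter x)) => e e0.
have eK : 0 < e / K by rewrite divr_gt0.
apply/nbhs_ballP; exists (e / K) => //= y; rewrite -ball_normE /= => xy.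
by apply: le_lt_trans (HK _ _) _; rewrite mulrC -ltr_pdivlMr.
Qed.

(* Infinitely many disjoint translates of equal measure fit into a bounded set. *)
Lemma lebesgue_rV_translates0 n (G : set 'rV[R]_n) (e : 'rV[R]_n) :
  measurable G -> (exists M, G `<=` cube n M) ->
  (forall s t x y, G x -> G y -> x + s *: e = y + t *: e -> s = t) ->
  lebesgue_rV n G = 0%E.
Proof.
move=> mG [M GM] inj.
(* The translate of [G] by [e / (k + 1)]: the multiples of [e] are distinct and bounded, so the
   translates are disjoint and share a cube. *)
pose F k := (fun x => x + (- (k.+1%:R^-1) *: e)) @^-1` G.
have mF k : measurable (F k).
  by apply: measurable_preimageT mG; exact: measurable_rV_shift.
have FE k : lebesgue_rV n (F k) = lebesgue_rV n G by exact: lebesgue_rV_shift.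
have tF : trivIset setT F.
  apply/trivIsetP => i j _ _ ij; apply/seteqP; split => // x [Fi Fj].
  have : i.+1%:R^-1 = j.+1%:R^-1 :> R.
    by apply: (inj _ _ _ _ Fi Fj); rewrite !scaleNr !subrK.
  by move=> /invr_inj/eqP; rewrite eqr_nat eqSS (negbTE ij).
pose K := M + `|e|.
have FK k : F k `<=` cube n K.
  move=> x /GM H i; have := H i; rewrite !in_itv/= !mxE.
  have h1 := rV_norm_coord e i.
  have : `|- k.+1%:R^-1 * e ord0 i| <= `|e|.
    rewrite normrM normrN (@ger0_norm _ _%:R^-1) ?invr_ge0// -[leRHS]mul1r.
    apply: ler_pM; rewrite ?invr_ge0//.
    by rewrite invf_le1 ?ltr0n// ler1n.
  move: (_ * _) => z; rewrite /K ler_norml; lra.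
have bnd N : (lebesgue_rV n G *+ N <= lebesgue_rV n (cube n K))%E.
  have -> : (lebesgue_rV n G *+ N)%E = (\sum_(i < N) lebesgue_rV n (F i))%E.
    under eq_bigr do rewrite FE.
    by rewrite sumr_const card_ord.
  rewrite -(measure_bigsetU (lebesgue_rV n) mF tF N).
  apply: le_measure; rewrite ?inE.
  - exact: bigsetU_measurable.
  - exact: measurable_cube.
  - by elim/big_ind: _ => // A B hA hB x [/hA|/hB].
have finG : lebesgue_rV n G \is a fin_num.
  rewrite ge0_fin_numE//; apply: le_lt_trans (lebesgue_rV_cube n K).
  by rewrite -(FE 0%N); apply: le_measure; rewrite ?inE//; exact: measurable_cube.
have finK : lebesgue_rV n (cube n K) \is a fin_num.
  by rewrite ge0_fin_numE//; exact: lebesgue_rV_cube.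
rewrite -(fineK finG); congr (_%:E); apply/eqP; rewrite eq_le fine_ge0// andbT.
rewrite leNgt; apply/negP => g0.
(* Take more translates than the ratio of the two volumes allows. *)
have := bnd (Num.truncn (fine (lebesgue_rV n (cube n K)) / fine (lebesgue_rV n G))).+1.
rewrite -(fineK finG) -(fineK finK) -EFin_natmul lee_fin -mulr_natl.
rewrite -ler_pdivlMr// leNgt => /negP; apply.
by have /truncn_itv/andP[_] : 0 <= fine (lebesgue_rV n (cube n K)) / fine (lebesgue_rV n G)
  by rewrite divr_ge0// fine_ge0.
Qed.

Section lipschitz_graph.
Context n (e p : 'rV[R]_n) (r : R) (phi : 'rV[R]_n -> R) (lphi : lipschitz phi).

Let g (x : 'rV[R]_n) : R := dot x e - phi (x - dot x e *: e).

Let gE x : (g x = 0) = (dot x e = phi (x - dot x e *: e)).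
Proof.
apply/propext; split => h; last by rewrite /g {1}h subrr.
by apply/eqP; rewrite -subr_eq0 -/(g x) h.
Qed.

Let cg : continuous g.
Proof.
move=> x; have cd := @continuous_dotl _ e x.
have cp : (fun y : 'rV[R]_n => y - dot y e *: e) @ nbhs x --> x - dot x e *: e.
  by apply: (@cvgB _ _ _ (nbhs x)) => //; apply: (@cvgZr_tmp _ _ _ (nbhs x)).
apply: (@cvgB _ R^o _ (nbhs x)) => //.
exact: (cvg_comp _ _ cp (@lipschitz_cts _ _ lphi _)).
Qed.

Lemma measurable_lipschitz_graph :
  measurable (ball p r `&` [set x | dot x e = phi (x - dot x e *: e)]).
Proof.
apply: measurableI; first exact: measurable_rV_ball.
rewrite (_ : [set _ | _] = g @^-1` [set 0]).
  apply: measurable_preimageT; last exact: measurable_set1.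
  exact: continuous_measurable_rV.
by apply/seteqP; split => x /=; rewrite gE.
Qed.

(** Moving along [e] keeps the component orthogonal to [e], and over each such component the graph
    has a single point. Translates of the graph by different multiples of [e] are therefore
    disjoint. *)
Lemma lebesgue_rV_lipschitz_graph : dot e e = 1 ->
  lebesgue_rV n (ball p r `&` [set x | dot x e = phi (x - dot x e *: e)]) = 0%E.
Proof.
move=> ee; apply: (@lebesgue_rV_translates0 _ _ e).
- exact: measurable_lipschitz_graph.
- exists (`|p| + r) => x [] /[dup] -[r0 _] /(rV_ballE _ _ r0) pr _ i.
  have := pr i; have := rV_norm_coord p i.
  by rewrite in_itv/= ltr_norml ler_norml; lra.
- move=> s t x y [_ /= xG] [_ /= yG] xy.
  pose P (z : 'rV[R]_n) := z - dot z e *: e.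
  have Pe z a : P (z + a *: e) = P z.
    rewrite /P dotDl dotZl ee mulr1 scalerDl opprD addrACA.
    by rewrite subrr addr0.
  have PP : P x = P y by rewrite -(Pe x s) xy Pe.
  have xyd : dot x e = dot y e by rewrite xG yG -/(P x) -/(P y) PP.
  have := congr1 (dot^~ e) xy; rewrite !dotDl !dotZl ee !mulr1 xyd.
  exact: addrI.
Qed.

(** Near [p] the set is [g < 0] with [g] continuous: points with [g < 0] are interior, points with
    [g > 0] are outside the closure. *)
Lemma bdry_lipschitz_graph (D : set 'rV[R]_n) :
  (forall x, ball p r x -> (D x <-> dot x e < phi (x - dot x e *: e))) ->
  bdry D `&` ball p r `<=` [set x | dot x e = phi (x - dot x e *: e)].
Proof.
move=> H x [[clDx nDx] pr] /=; rewrite -gE.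
have {}H y : ball p r y -> (D y <-> g y < 0).
  by move=> /H; rewrite subr_lt0.
have nb : nbhs x (ball p r).
  have [r0 xp] := pr; apply: open_nbhs_nbhs; split => //.
  exact: ball_open.
apply/eqP; rewrite eq_le leNgt; apply/andP; split; last rewrite leNgt.
  apply/negP => g0.
  have n2 : nbhs x (g @^-1` [set z | 0 < z]).
    by apply: cg; apply: open_nbhs_nbhs; split => //; exact: open_gt.
  have [y [Dy [py /= gy]]] := clDx _ (filterI nb n2).
  by have := (H y py).1 Dy; rewrite ltNge ltW.
apply/negP => g0; apply: nDx.
have n2 : nbhs x (g @^-1` [set z | z < 0]).
  by apply: cg; apply: open_nbhs_nbhs; split => //; exact: open_lt.
by apply: filterS (filterI nb n2) => y [py gy]; apply/(H y py).
Qed.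

End lipschitz_graph.

(** The boundary is compact, so finitely many of the balls in the definition cover it, and in each
    of them it is part of a Lipschitz graph. *)
Lemma lebesgue_rV_bdry0 n (D : set 'rV[R]_n) :
  bounded_set D -> lipschitz_boundary D -> lebesgue_rV n (bdry D) = 0%E.
Proof.
move=> /bounded_setP[M [M0 DM]] lD.
have cl : closed (bdry D).
  rewrite /bdry setDE; apply: closedI; first exact: closed_closure.
  exact/open_closedC/open_interior.
have bdM : bdry D `<=` cube n M.
  move=> x [clD _] i.
  apply: (@preimage_closed _ R^o (fun x : 'rV[R]_n => x ord0 i) `[- M, M]%classic).
  - by move=> y _; exact: coord_continuous.
  - exact: interval_closed.
  - by apply: closureS clD => y /DM /(_ i).
have mbd := closed_measurable_rV cl.
have cbd : compact (bdry D).
  apply: bounded_closed_compact => //.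
  exists M; split; first exact: num_real.
  move=> y My x /bdM xM.
  rewrite /= [leLHS]mx_normrE; apply/bigmax_leP; split => /=.
    by rewrite ltW// (lt_trans M0).
  move=> [i j] _; rewrite (ord1 i) /= ler_norml; have := xM j.
  by rewrite in_itv/=; lra.
have /choice[er Her] : forall p, exists r : R, bdry D p ->
    0 < r /\ lebesgue_rV n (bdry D `&` ball p r) = 0%E.
  move=> p; have [pD|npD] := pselect (bdry D p); last by exists 0.
  have [e [r [phi [ee r0 lphi H]]]] := lD _ pD; exists r => _; split => //=.
  apply: (subset_measure0 _ _ _ (@lebesgue_rV_lipschitz_graph _ _ p r _ lphi ee)).
  - by apply: measurableI => //; exact: measurable_rV_ball.
  - exact: measurable_lipschitz_graph.
  - move=> x [h1 h2]; split=> //.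
    exact: (bdry_lipschitz_graph lphi H).
move: (cbd); rewrite compact_cover => cc.
have [||F FD FC] := cc _ (bdry D) (fun p => ball p (er p)).
- by move=> p /Her[h _]; exact: ball_open.
- by move=> p pD; exists p => //; have [h _] := Her _ pD; exact: ballxx.
apply: measure_negligible => //.
have : negligible (lebesgue_rV n) (\big[setU/set0]_(p <- finmap.enum_fset F) (bdry D `&` ball p (er p))).
  rewrite big_seq; elim/big_ind : _ => [|A B|p pF].
  - exact: negligible_set0.
  - exact: negligibleU.
  - apply/negligibleP; first by apply: measurableI => //; exact: measurable_rV_ball.
    by have /set_mem/Her[] := FD _ pF.
apply: negligibleS => x xD; have [p pF px] := FC _ xD.
by rewrite -bigcup_fset; exists p.
Qed.

End lipschitz_boundary.

(** * Completeness of L^2 *)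

Section L2_complete.
Context d (T : measurableType d) (R : realType) (mu : {measure set T -> \bar R}).
Implicit Types f g h : T -> R.

Lemma Lfun2P f : f \in Lfun mu 2%:E <->
  measurable_fun setT f /\ mu.-integrable setT (EFin \o (fun x => f x ^+ 2)).
Proof.
split=> [f2|[mf /integrableP[_ fi]]].
  split; last exact: Lfun2_integrable_sqr.
  by have := sub_Lfun_mfun f2; rewrite inE.
rewrite inE; apply/andP; split; rewrite inE//= /finite_norm.
rewrite unlock /Lnorm poweR_lty//.
apply: le_lt_trans fi; apply: ge0_le_integral => //.
- by move=> x _; rewrite lee_fin powR_ge0.
- apply/measurable_EFinP.
  apply/(@measurableT_comp _ _ _ _ _ _ (fun x : R => x `^ 2)%R) => //.
  exact/measurableT_comp.
- apply: measurableT_comp => //; apply/measurable_EFinP.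
  exact: measurable_realfun.measurable_funX.
- by move=> x _ /=; rewrite lee_fin powR_mulrn// -normrX.
Qed.

Lemma Lfun2_integrableM f g : f \in Lfun mu 2%:E -> g \in Lfun mu 2%:E ->
  mu.-integrable setT (EFin \o (fun x => f x * g x)).
Proof. by move=> lf lg; apply/Lfun1_integrable; exact: Lfun2_mul_Lfun1. Qed.

Lemma Lfun2_lin (c : R) f g : f \in Lfun mu 2%:E -> g \in Lfun mu 2%:E ->
  c *: f + g \in Lfun mu 2%:E.
Proof.
move=> lf lg; have p1 : (1 <= 2%:E :> \bar R)%E by rewrite lee_fin ler1n.
by have [_ H] := Lfun_submod_closed mu p1; exact: H.
Qed.

Lemma Lfun2_0 : cst 0 \in Lfun mu 2%:E.
Proof.
have p1 : (1 <= 2%:E :> \bar R)%E by rewrite lee_fin ler1n.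
by have [] := Lfun_submod_closed mu p1.
Qed.

Lemma Lfun2_Rintegral_sqr f : f \in Lfun mu 2%:E ->
  (\int[mu]_x (f x * f x))%:E = (\int[mu]_x (f x ^+ 2)%:E)%E.
Proof.
move=> lf; rewrite fineK; last first.
  exact: (integrable_fin_num measurableT (Lfun2_integrableM lf lf)).
by apply: eq_integral => x _; rewrite expr2.
Qed.

Lemma limn_einf_le (u : (\bar R)^nat) (e : \bar R) (N : nat) :
  (forall n, (N <= n)%N -> (u n <= e)%E) -> (limn_einf u <= e)%E.
Proof.
move=> ue; rewrite limn_einf_lim; apply: lime_le; first exact: is_cvg_einfs.
exists N => // n /= Nn; apply: le_trans (ue _ Nn).
by apply: ereal_inf_lbound; exists n => /=.
Qed.

(** The weight [4 ^+ k] bounds the k-th increment by [Num.sqrt S * 2^-1 ^+ k], which is summable. *)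
Lemma cvgn_sqr_increments (h : nat -> R) (S : R) :
  (forall k, 4 ^+ k * (h k.+1 - h k) ^+ 2 <= S) -> cvgn h.
Proof.
move=> hS.
have S0 : 0 <= S by apply: le_trans (hS 0%N); rewrite mul1r sqr_ge0.
have c2 : cvgn (series (telescope h)).
  apply: normed_cvg.
  apply: (@series_le_cvg _ _ (geometric (Num.sqrt S) 2^-1)).
  - by move=> n; exact: normr_ge0.
  - by move=> n; rewrite /geometric/= mulr_ge0// ?sqrtr_ge0// exprn_ge0// invr_ge0.
  - move=> n; rewrite /geometric /telescope/= -sqrtr_sqr.
    have <- : Num.sqrt ((2^-1 ^+ n) ^+ 2) = 2^-1 ^+ n :> R.
      by rewrite sqrtr_sqr ger0_norm// exprn_ge0// invr_ge0.
    rewrite -sqrtrM//; apply: ler_wsqrtr.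
    have -> : (2^-1 ^+ n) ^+ 2 = (4 ^+ n)^-1 :> R.
      by rewrite -exprM mulnC exprM -exprVn; congr (_ ^+ _); field.
    by rewrite ler_pdivlMr ?exprn_gt0// mulrC; exact: hS.
  - apply: is_cvg_geometric_series.
    by rewrite ger0_norm ?invr_ge0// invf_lt1// ltr1n.
rewrite (_ : h = cst (h 0%N) \+ series (telescope h)); last first.
  by apply/funext => n /=; rewrite {1}eq_sum_telescope.
by apply: is_cvgD => //; exact: is_cvg_cst.
Qed.

(** Riesz-Fischer: a subsequence with rapidly decreasing increments converges almost everywhere, and
    Fatou's lemma shows that its pointwise limit is also the limit in the norm. *)
Lemma Lfun2_complete (f : nat -> T -> R) :
  (forall n, f n \in Lfun mu 2%:E) ->
  (forall e, 0 < e -> exists N : nat, forall m n, (N <= m)%N -> (N <= n)%N ->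
     \int[mu]_x ((f m x - f n x) * (f m x - f n x)) < e) ->
  exists2 g, g \in Lfun mu 2%:E & forall e, 0 < e -> exists N : nat,
    forall n, (N <= n)%N -> \int[mu]_x ((f n x - g x) * (f n x - g x)) < e.
Proof.
move=> lf cf.
have lfB m n : (fun x => f m x - f n x) \in Lfun mu 2%:E.
  have -> : (fun x => f m x - f n x) = (-1) *: f n + f m.
    by apply/funext => x; rewrite fctE/= scaleN1r addrC.
  exact: Lfun2_lin.
have mf n : measurable_fun setT (f n) by have /Lfun2P[] := lf n.
(* Squared distances below [8 ^- k] survive the weight [4 ^+ k] of the pointwise criterion with a
   summable [2 ^- k]. *)
have /choice[N HN] : forall k : nat, exists N : nat, forall m n,
    (N <= m)%N -> (N <= n)%N ->
    \int[mu]_x ((f m x - f n x) * (f m x - f n x)) < (8 ^+ k)^-1.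
  by move=> k; apply: cf; rewrite invr_gt0 exprn_gt0.
(* Partial sums make the index nondecreasing and at least [N k] from the k-th term on. *)
pose phi k := (\sum_(i < k.+1) N i)%N.
have Nphi k m : (k <= m)%N -> (N k <= phi m)%N.
  move=> km; rewrite /phi.
  have km' : (k < m.+1)%N by [].
  by rewrite (bigD1 (Ordinal km'))//= leq_addr.
pose h k := f (phi k).
have mh k : measurable_fun setT (h k) by exact: mf.
pose t k x : \bar R := (4 ^+ k * (h k.+1 x - h k x) ^+ 2)%:E.
have t0 k x : (0 <= t k x)%E by rewrite lee_fin mulr_ge0 ?sqr_ge0// exprn_ge0.
have mt k : measurable_fun setT (t k).
  apply/measurable_EFinP; apply: measurable_funM => //.
  by apply: measurable_funX; exact: measurable_funB.
have int_t k : (\int[mu]_x t k x <= (2 / (2 ^ (k + 1))%:R)%:E)%E.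
  rewrite /t; under eq_integral do rewrite EFinM.
  have m2 : measurable_fun setT (EFin \o (fun x => (h k.+1 x - h k x) ^+ 2)).
    by apply/measurable_EFinP; apply: measurable_funX; exact: measurable_funB.
  have c0 : (0 <= (4 ^+ k)%:E :> \bar R)%E by rewrite lee_fin exprn_ge0.
  have p2 x : setT x -> (0 <= ((h k.+1 x - h k x) ^+ 2)%:E)%E by rewrite lee_fin sqr_ge0.
  rewrite (ge0_integralZl mu measurableT m2 p2 c0) -(Lfun2_Rintegral_sqr (lfB (phi k.+1) (phi k))).
  rewrite -EFinM lee_fin.
  have := HN k (phi k.+1) (phi k) (Nphi _ _ (leqnSn _)) (Nphi _ _ (leqnn _)).
  move=> /ltW; rewrite -/(h _) -/(h _) => H.
  apply: le_trans (ler_wpM2l (exprn_ge0 k (ler0n R 4)) H) _.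
  rewrite addn1 natrX exprS invfM mulrA divff// mul1r -!exprVn -exprMn.
  by rewrite (_ : 4 * 8^-1 = 2^-1 :> R)//; field.
pose S x := (\sum_(0 <= k <oo) t k x)%E.
have mS : measurable_fun setT S by exact: ge0_emeasurable_sum.
have iS : (\int[mu]_x S x < +oo)%E.
  rewrite integral_nneseries//.
  apply: (@le_lt_trans _ _ (\sum_(0 <= k <oo) (2 / (2 ^ (k + 1))%:R)%:E)%E).
    apply: lee_nneseries => [k0 _ _|k0 _]; first exact: integral_ge0.
    exact: int_t.
  by rewrite (cvg_lim _ (@cvg_geometric_eseries_half R 2 0))// ltry.
pose A := [set x | (S x < +oo)%E].
have mA : measurable A.
  by rewrite -[A]setTI; exact: emeasurable_fun_infty_o.
have S0 x : (0 <= S x)%E by exact: nneseries_ge0.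
have A1 : \forall x \ae mu, A x.
  have : mu.-integrable setT S.
    apply/integrableP; split => //.
    by under eq_integral do rewrite gee0_abs//.
  move=> /(integrable_ae measurableT); apply: filterS => x /(_ I).
  by rewrite ge0_fin_numE.
(* Setting the subsequence to 0 off [A] makes it converge everywhere, so that the limit is
   measurable. *)
pose h' k x := h k x * \1_A x.
have mh' k : measurable_fun setT (h' k).
  by apply: measurable_funM => //; exact: measurable_indic.
have ch x : cvgn (h'^~ x).
  have [Ax|nAx] := pselect (A x).
    apply: (@cvgn_sqr_increments _ (fine (S x))) => k.
    rewrite /h' indicE mem_set// !mulr1 -lee_fin fineK ?ge0_fin_numE//.
    rewrite -/(t k x); apply: le_trans (@nneseries_lim_ge _ (t^~ x) xpredT 0%N k.+1 _); last by [].
    by rewrite big_mkord big_ord_recr/= leeDr// sume_ge0.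
  rewrite (_ : h'^~ x = cst 0); first exact: is_cvg_cst.
  by apply/funext => k; rewrite /h' indicE memNset// mulr0.
pose g x := limn (h'^~ x).
have mg : measurable_fun setT g.
  by apply: (measurable_fun_cvg mh') => x _; exact: ch.
(* Fatou along the subsequence with [f m] fixed. *)
have fg k m : (N k <= m)%N ->
    (\int[mu]_x ((f m x - g x) ^+ 2)%:E <= ((8 ^+ k)^-1)%:E)%E.
  move=> km; pose u j x : \bar R := ((f m x - h' j x) ^+ 2)%:E.
  have mu_ j : measurable_fun setT (u j).
    apply/measurable_EFinP; apply: measurable_funX; exact: measurable_funB.
  have u0 j x : (0 <= u j x)%E by rewrite lee_fin sqr_ge0.
  have := @fatou _ _ _ mu setT measurableT u mu_ (fun j x _ => u0 j x).
  rewrite (eq_integral (fun x => ((f m x - g x) ^+ 2)%:E)); last first.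
    move=> x _.
    suff H : u^~ x @ \oo --> ((f m x - g x) ^+ 2)%:E.
      exact: (cvg_limn_einf_sup H).1.
    have H : (fun j => f m x - h' j x) @ \oo --> f m x - g x.
      by apply: cvgB; [exact: cvg_cst|exact: ch].
    rewrite /u expr2 (_ : (fun j => _) =
      (fun j => ((f m x - h' j x) * (f m x - h' j x))%:E)); last first.
      by apply/funext => j; rewrite expr2.
    by apply: cvg_EFin; [exact: nearW|exact: cvgM].
  move=> /le_trans; apply; apply: (@limn_einf_le _ _ k) => j kj.
  have -> : (\int[mu]_x u j x = \int[mu]_x ((f m x - h j x) ^+ 2)%:E)%E.
    apply: ge0_ae_eq_integral => //.
    - apply/measurable_EFinP; apply: measurable_funX; exact: measurable_funB.
    - by move=> x _; rewrite lee_fin sqr_ge0.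
    - apply: filterS A1 => x Ax _.
      by rewrite /u /h' indicE mem_set// mulr1.
  rewrite -(Lfun2_Rintegral_sqr (lfB m (phi j))) lee_fin ltW//.
  by apply: HN => //; exact: Nphi.
have lfg m : (N 0 <= m)%N -> (fun x => f m x - g x) \in Lfun mu 2%:E.
  move=> Nm; apply/Lfun2P; split; first exact: measurable_funB.
  apply/integrableP; split.
    apply/measurable_EFinP; apply: measurable_funX; exact: measurable_funB.
  under eq_integral do rewrite gee0_abs ?lee_fin ?sqr_ge0//.
  exact: le_lt_trans (fg _ _ Nm) (ltry _).
exists g.
  rewrite (_ : g = (-1) *: (fun x => f (N 0) x - g x) + f (N 0)).
    by apply: Lfun2_lin => //; exact: lfg.
  by apply/funext => x; rewrite fctE/= scaleN1r opprB subrK.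
move=> e e0.
have [k ke] : exists k : nat, (8 ^+ k)^-1 < e.
  have /ltr_add_invr[k] := e0; rewrite add0r => ke; exists k.
  apply: le_lt_trans ke; rewrite lef_pV2 ?posrE ?exprn_gt0//.
  by rewrite -natrX ler_nat; exact: ltn_expl.
exists (maxn (N 0) (N k)) => n; rewrite geq_max => /andP[n0 nk].
rewrite -lte_fin Lfun2_Rintegral_sqr; last exact: lfg.
exact: le_lt_trans (fg _ _ nk) _.
Qed.

End L2_complete.

Section L2_space.
Context {R : realType} {d : nat}.
Local Notation E := 'rV[R]_d.
Local Notation leb := (@lebesgue_rV R d).
Implicit Types (D : set E) (u v w : E -> R).

Definition zext D u : E -> R := patch (fun=> 0) D u.

Lemma zext_lin D (c : R) u v : zext D (c *: u + v) = c *: zext D u + zext D v.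
Proof.
apply/funext => x; rewrite !fctE /zext /patch /=.
by case: ifP => _; rewrite ?scaler0 ?addr0.
Qed.

Lemma ipE D u v : ip D u v = \int[leb]_x (zext D u x * zext D v x).
Proof.
rewrite /ip Rintegral_mkcond; apply: eq_Rintegral => x _.
by rewrite /zext /patch; case: ifP => _; rewrite ?mulr0.
Qed.

Lemma L2_integrableM D u v : L2 D u -> L2 D v ->
  leb.-integrable setT (EFin \o (fun x => zext D u x * zext D v x)).
Proof. exact: Lfun2_integrableM. Qed.

Lemma L2_semi_inner D : semi_inner (L2 D) (ip D).
Proof.
split.
- rewrite /L2/= (_ : patch _ _ _ = cst 0); first exact: Lfun2_0.
  by apply/funext => x; rewrite /patch; case: ifP.
- by move=> c u v Lu Lv; rewrite /L2/= -/(zext _ _) zext_lin; exact: Lfun2_lin.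
- by move=> u v _ _; rewrite !ipE; apply: eq_Rintegral => x _; rewrite mulrC.
- move=> c u v w Lu Lv Lw; rewrite !ipE zext_lin.
  rewrite -RintegralZl//; last exact: L2_integrableM.
  rewrite -RintegralD//.
  + by apply: eq_Rintegral => x _; rewrite !fctE /= mulrDl mulrA.
  + have := integrableZl measurableT c (L2_integrableM Lu Lw).
    by apply: eq_integrable => // x _ /=; rewrite EFinM.
  + exact: L2_integrableM.
- move=> u Lu; rewrite ipE; apply: Rintegral_ge0 => x _.
  by rewrite -expr2 sqr_ge0.
Qed.

Lemma L2_eq_on D u v : (forall x, D x -> u x = v x) -> L2 D u -> L2 D v.
Proof.
move=> uv; rewrite /L2/= (_ : patch _ D v = patch (fun=> 0) D u)//.
by apply/funext => x; rewrite /patch; case: ifPn => // /set_mem/uv.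
Qed.

Lemma ip_eq_on D u u' v v' : (forall x, D x -> u x = u' x) ->
  (forall x, D x -> v x = v' x) -> ip D u v = ip D u' v'.
Proof.
move=> uu vv; apply: eq_Rintegral => x /set_mem Dx.
by rewrite uu// vv.
Qed.

Lemma L2_sub D D' u : measurable D' -> D' `<=` D -> L2 D u -> L2 D' u.
Proof.
move=> mD' DD /Lfun2P[mu iu]; apply/Lfun2P.
have E : patch (fun=> 0) D' u = patch (fun=> 0) D' (patch (fun=> 0) D u).
  apply/funext => x; rewrite /patch; case: ifP => // /set_mem D'x.
  by rewrite mem_set//; exact: DD.
have mu' : measurable_fun setT (patch (fun=> 0) D' u).
  rewrite E; apply/(measurable_restrictT _ mD'); exact: measurable_funTS.
split => //; apply: le_integrable iu => //.
  by apply/measurable_EFinP; exact: measurable_funX.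
move=> x _ /=; rewrite lee_fin !ger0_norm ?sqr_ge0// /patch.
case: ifPn => [/set_mem D'x|_]; last by rewrite expr0n sqr_ge0.
by rewrite mem_set//; exact: DD.
Qed.

Lemma ip0_ae D u : L2 D u -> ip D u u = 0 -> u = (fun=> 0) %[ae leb in D].
Proof.
move=> Lu; rewrite ipE => H.
have H2 : (\int[leb]_x `|(zext D u x * zext D u x)%:E| = 0)%E.
  under eq_integral do rewrite gee0_abs ?lee_fin -?expr2 ?sqr_ge0//.
  rewrite -(Lfun2_Rintegral_sqr Lu); congr (_%:E); exact: H.
have /(ae_eq_integral_abs _ measurableT) : measurable_fun setT (EFin \o (fun x => zext D u x * zext D u x)).
  by have /integrableP[] := L2_integrableM Lu Lu.
move=> /(_ leb)[/(_ H2) h _]; apply: filterS h => x /(_ I)/= [] /eqP.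
by rewrite mulf_eq0 orbb /zext /patch => /eqP + Dx; rewrite mem_set.
Qed.

Lemma ae_ip D u u' v : L2 D u -> L2 D u' -> L2 D v ->
  u = u' %[ae leb in D] -> ip D u v = ip D u' v.
Proof.
move=> Lu Lu' Lv uu; rewrite !ipE; congr fine.
apply: ae_eq_integral => //.
- by have /integrableP[] := L2_integrableM Lu Lv.
- by have /integrableP[] := L2_integrableM Lu' Lv.
apply: filterS uu => x uu _; rewrite /zext /patch.
by case: ifPn => // /set_mem/uu ->.
Qed.

Lemma ae_ip_sqr0 D u u' : L2 D u -> L2 D u' ->
  u = u' %[ae leb in D] -> ip D (u - u') (u - u') = 0.
Proof.
move=> Lu Lu' uu; have SB := L2_semi_inner D.
have Ld : L2 D (u - u') by exact: (semi_innerB _ _ SB).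
have L0 := semi_inner_nonempty _ _ SB.
rewrite (ae_ip Ld L0 Ld).
  exact: (linear_on0 _ _ SB _ (semi_inner_linear_onl _ _ SB _ Ld)).
by apply: filterS uu => x /[swap] Dx /(_ Dx) e; rewrite !fctE e subrr.
Qed.

Lemma L2_complete D : measurable D -> scomplete (L2 D) (ip D).
Proof.
move=> mD f Lf cf.
have zB m n : zext D (f m - f n) = fun x => zext D (f m) x - zext D (f n) x.
  apply/funext => x; rewrite /zext /patch !fctE.
  by case: ifP => // _; rewrite subr0.
have [e e0|g Lg Hg] := @Lfun2_complete _ _ _ leb (fun n => zext D (f n)) Lf.
  have [N HN] := cf e e0; exists N => m n Nm Nn.
  by have := HN m n Nm Nn; rewrite ipE zB.
have Lg' : L2 D g.
  apply: (@L2_sub setT) => //; rewrite /L2/= (_ : patch _ _ _ = g)//.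
  by apply/funext => x; rewrite /patch in_setT.
exists g => // e e0; have [N HN] := Hg e e0; exists N => n Nn.
apply: le_lt_trans (HN n Nn); rewrite ipE.
have Lfg : (fun x => zext D (f n) x - g x) \in Lfun leb 2%:E.
  rewrite (_ : (fun x => _) = (-1) *: g + zext D (f n)); first exact: (Lfun2_lin _ Lg (Lf n)).
  by apply/funext => x; rewrite /= [RHS]addrC [X in _ = _ + X]scaleN1r.
have Ld : L2 D (f n - g) by apply: (semi_innerB _ _ (L2_semi_inner D)).
apply: le_Rintegral => //.
- exact: L2_integrableM.
- exact: Lfun2_integrableM.
move=> x _; rewrite /zext /patch !fctE; case: ifP => // _.
by rewrite mul0r -expr2 sqr_ge0.
Qed.

End L2_space.

(** * Test functions and the fundamental lemma *)

Section integral_partial.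
Context {R : realType} {d : nat}.
Local Notation E := 'rV[R]_d.
Local Notation leb := (@lebesgue_rV R d).
Implicit Types (h g : E -> R).

Lemma Rintegral_shift h (a : E) : measurable_fun setT h ->
  leb.-integrable setT (EFin \o h) ->
  leb.-integrable setT (EFin \o (fun x => h (x + a))) /\
  \int[leb]_x h (x + a) = \int[leb]_x h x.
Proof.
move=> mh ih; have ms := measurable_rV_shift a.
pose nu := measure_function_pushforward__canonical__measure_function_Measure leb ms.
have nuI (f : E -> \bar R) : (\int[nu]_x f x = \int[leb]_x f x)%E.
  by apply: eq_measure_integral => A mA _; exact: lebesgue_rV_shift.
have mEh : measurable_fun setT (EFin \o h) by apply/measurable_EFinP.
have ish : leb.-integrable setT (EFin \o (fun x => h (x + a))).
  apply/integrableP; split.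
    by apply/measurable_EFinP; exact: (measurableT_comp mh ms).
  have <- : (\int[nu]_y `|(h y)%:E| = \int[leb]_x `|(h (x + a))%:E|)%E.
    apply: (ge0_integral_pushforward ms leb measurableT) => //.
    exact: measurableT_comp.
  by rewrite nuI; have /integrableP[_] := ih.
split=> //; congr fine.
have <- : (\int[nu]_y (h y)%:E = \int[leb]_x (h (x + a))%:E)%E.
  exact: (integral_pushforward ms mEh ish measurableT).
exact: nuI.
Qed.

(** Restriction to a line, to make the one-dimensional mean value theorem available for difference
    quotients. *)
Lemma is_derive_line h (x v : E) (s : R) : derivable h (x + s *: v) v ->
  is_derive s 1 (fun s => h (x + s *: v)) ('D_v h (x + s *: v)).
Proof.
move=> dh.
have E1 : (fun t : R => t^-1 *: (((fun s => h (x + s *: v)) \o shift s) (t *: 1) - h (x + s *: v)))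
   = (fun t : R => t^-1 *: ((h \o shift (x + s *: v)) (t *: v) - h (x + s *: v))).
  apply/funext => t /=; congr (_ *: (h _ - _)).
  by rewrite [t *: 1]mulr1 scalerDl addrCA.
by split; rewrite /derivable /derive E1.
Qed.

Lemma compact_support_bounded h (A : set E) : continuous h -> compact A ->
  (forall x, ~ A x -> h x = 0) -> exists2 K, 0 <= K & forall x, `|h x| <= K.
Proof.
move=> ch cA hA.
have /compact_bounded[M [Mr HM]] : compact (h @` A).
  by apply: continuous_compact => //; exact: continuous_subspaceT.
exists (`|M| + 1) => [|x]; first by rewrite addr_ge0.
have [Ax|nAx] := pselect (A x); last by rewrite hA// normr0 addr_ge0.
by apply: HM; [rewrite (le_lt_trans (ler_norm M))// ltrDl|exists x].
Qed.

Lemma compact_cube (A : set E) : compact A -> exists M : R, A `<=` cube d M.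
Proof. by move=> /compact_bounded/bounded_setP[M [_ H]]; exists M. Qed.

Lemma integrable_cube_indic (K M : R) :
  leb.-integrable setT (fun x => (K * \1_(cube d M) x)%:E).
Proof.
rewrite (_ : (fun x => _) = (fun x => (K%:E * (\1_(cube d M) x)%:E)%E)).
  apply: integrableZl => //; apply/integrableP; split.
    by apply/measurable_EFinP; apply: measurable_indic; exact: measurable_cube.
  under eq_integral do rewrite gee0_abs ?lee_fin//.
  rewrite integral_indic ?setIT//; [exact: lebesgue_rV_cube|exact: measurable_cube].
by apply/funext => x; rewrite EFinM.
Qed.

Lemma bounded_support_integrable h (M K : R) : measurable_fun setT h ->
  (forall x, `|h x| <= K) -> (forall x, ~ cube d M x -> h x = 0) ->
  leb.-integrable setT (EFin \o h).
Proof.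
move=> mh hK hM.
apply: (@le_integrable _ _ _ leb setT measurableT _ (fun x => (K * \1_(cube d M) x)%:E)) => //.
- exact/measurable_EFinP.
- move=> x _ /=; rewrite lee_fin; apply: le_trans (ler_norm _).
  rewrite indicE; case: (boolP (x \in _)) => [_|/negP xM]; first by rewrite mulr1.
  by rewrite hM ?normr0 ?mulr0// => /mem_set.
- exact: integrable_cube_indic.
Qed.

(** Difference quotients have integral zero because Lebesgue measure is translation invariant; they
    converge to the partial derivative and are dominated, by the mean value theorem, by a multiple
    of the indicator of a cube. No iterated integral is involved. *)
Lemma integral_partial0 h (i : 'I_d) (A : set E) : continuous h ->
  (forall x, derivable h x (delta_mx ord0 i)) -> continuous (partial i h) ->
  compact A -> (forall x, ~ A x -> h x = 0) ->
  (forall x, ~ A x -> partial i h x = 0) ->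
  \int[leb]_x partial i h x = 0.
Proof.
move=> ch dh cdh cA hA dhA; pose v : E := delta_mx ord0 i.
have [K K0 HK] := compact_support_bounded cdh cA dhA.
have [L L0 HL] := compact_support_bounded ch cA hA.
have [M AM] := compact_cube cA.
pose t n : R := n.+1%:R^-1.
have t0 n : 0 < t n by rewrite invr_gt0.
have t1 n : t n <= 1 by rewrite invf_le1// ler1n.
pose q n (x : E) := (t n)^-1 * (h (x + t n *: v) - h x).
have mh : measurable_fun setT h by exact: continuous_measurable_rV.
have ih : leb.-integrable setT (EFin \o h).
  by apply: bounded_support_integrable HL _ => // x /(contra_not (@AM _))/hA.
have mq n : measurable_fun setT (q n).
  apply: measurable_funM => //; apply: measurable_funB => //.
  exact: (measurableT_comp mh (measurable_rV_shift _)).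
have qK n x : `|q n x| <= K.
  pose phi (s : R) : R := h (x + s *: v).
  have dphi (s : R) : is_derive s 1 phi (partial i h (x + s *: v)).
    exact: is_derive_line.
  have [|c _] := @MVT R phi (fun s => partial i h (x + s *: v)) 0 (t n) (t0 n).
    apply: continuous_subspaceT => s.
    by apply: differentiable_continuous; apply/derivable1_diffP; have [] := dphi s.
  rewrite /phi scale0r addr0 subr0 => E1.
  by rewrite /q E1 mulrCA mulVf ?gt_eqF// mulr1.
(* The steps [t n] are at most 1, so enlarging the cube by 1 contains the supports of all
   quotients. *)
have qM n x : ~ cube d (M + 1) x -> q n x = 0.
  move=> nx; rewrite /q.
  have MM : M <= M + 1 by rewrite lerDl.
  rewrite hA; last first.
    move=> /AM H; apply: nx => j; have := H j; rewrite !in_itv/= !mxE /= => H1.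
    have : `|t n * (j == i)%:R| <= 1.
      rewrite normrM ger0_norm ?(ltW (t0 n))// -[leRHS]mulr1.
      by apply: ler_pM => //; rewrite ?(ltW (t0 n))//; case: (j == i); rewrite ?normr1 ?normr0.
    move: (t n * _) H1 => z; rewrite ler_norml; lra.
  rewrite hA ?subr0 ?mulr0//.
  by move=> /AM H; apply: nx => j; have := H j; rewrite !in_itv/=; lra.
have qcvg x : q ^~ x @ \oo --> partial i h x.
  have cv := dh x.
  rewrite (_ : q^~ x = (fun s : R => s^-1 *: ((h \o shift x) (s *: v) - h x)) \o t).
    have /cvgr_dnbhsP := cv; apply; split; first by move=> n; rewrite gt_eqF.
    exact: cvg_harmonic.
  by apply/funext => n; rewrite /q /= [x + _]addrC.
have iq n : leb.-integrable setT (EFin \o q n).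
  exact: bounded_support_integrable (qK n) (qM n).
have q0 n : \int[leb]_x q n x = 0.
  rewrite /q; have [ish sE] := Rintegral_shift (t n *: v) mh ih.
  rewrite RintegralZl//; last first.
    have := integrableB measurableT ish ih.
    by apply: eq_integrable => // x _; rewrite /= EFinB.
  by rewrite RintegralB// sE subrr mulr0.
have [] := @dominated_convergence _ _ _ leb setT measurableT (fun n => EFin \o q n)
  (EFin \o partial i h) (fun x => (K * \1_(cube d (M + 1)) x)%:E).
- by move=> n; apply/measurable_EFinP.
- by apply/measurable_EFinP; exact: continuous_measurable_rV.
- apply: aeW => x _; apply: cvg_EFin; [exact: nearW|exact: qcvg].
- exact: integrable_cube_indic.
- apply: aeW => x n _ /=; rewrite lee_fin indicE.
  case: (boolP (x \in _)) => [_|/negP xM]; first by rewrite mulr1.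
  by rewrite qM ?normr0 ?mulr0// => /mem_set.
move=> _ _; rewrite (_ : [sequence _]_n = cst 0%E); last first.
  apply/funext => n /=; have := q0 n; rewrite /Rintegral => e.
  by rewrite -[LHS](fineK (integrable_fin_num measurableT (iq n))) [fine _]e.
by move=> /(cvg_unique _ (cvg_cst _)) H; rewrite /Rintegral -H.
Qed.

End integral_partial.

Section test_functions.
Context {R : realType} {d : nat}.
Local Notation E := 'rV[R]_d.
Local Notation leb := (@lebesgue_rV R d).
Implicit Types (D : set E) (u v phi psi : E -> R).

Definition tsupp u : set E := closure [set x | u x != 0].

Lemma smooth_differentiable u x : smooth u -> differentiable u x.
Proof. by move=> su; exact: (su [::] x). Qed.

Lemma smooth_derivable u x (v : E) : smooth u -> derivable u x v.
Proof. by move=> su; apply: diff_derivable; exact: smooth_differentiable. Qed.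

Lemma smooth_continuous u : smooth u -> continuous u.
Proof.
by move=> su x; apply: differentiable_continuous; exact: smooth_differentiable.
Qed.

Lemma smooth_partial i u : smooth u -> smooth (partial i u).
Proof. by move=> su s x; rewrite -foldr_rcons; exact: su. Qed.

Lemma partial_lin i (c : R) u v : smooth u -> smooth v ->
  partial i (c *: u + v) = c *: partial i u + partial i v.
Proof.
move=> su sv; apply/funext => x; rewrite /partial deriveD ?deriveZ//.
- exact: smooth_derivable.
- by apply: derivableZ; exact: smooth_derivable.
- exact: smooth_derivable.
Qed.

Lemma smooth_lin (c : R) u v : smooth u -> smooth v -> smooth (c *: u + v).
Proof.
move=> su sv s.
have [E1 _] : foldr partial (c *: u + v) s = c *: foldr partial u s + foldr partial v s
    /\ (smooth (foldr partial u s) /\ smooth (foldr partial v s)).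
  elim: s => [|i s [IH [su' sv']]] //=; split.
    by rewrite IH partial_lin.
  by split; exact: smooth_partial.
rewrite E1 => x; apply: differentiableD; last exact: sv.
by apply: differentiableZ; exact: su.
Qed.

Lemma smooth0 : smooth (0 : E -> R).
Proof.
move=> s; have -> : foldr partial (0 : E -> R) s = 0; last first.
  by move=> x; exact: differentiable_cst.
elim: s => //= i s ->; apply/funext => x; rewrite /partial.
exact: derive_cst.
Qed.

Lemma notin_tsupp u x : ~ tsupp u x -> u x = 0.
Proof.
move=> nx; apply/eqP; apply: contrapT => /negP ux; apply: nx.
exact: subset_closure.
Qed.

Lemma notin_tsupp_partial u i x : ~ tsupp u x -> partial i u x = 0.
Proof.
move=> nx; rewrite /partial.
have : nbhs x (~` tsupp u).
  by apply: open_nbhs_nbhs; split => //; apply: closed_openC; exact: closed_closure.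
move=> H.
rewrite (_ : 0 = 'D_(delta_mx ord0 i) (cst 0 : E -> R) x); last by rewrite derive_cst.
apply: near_eq_derive.
by apply: filterS H => y /notin_tsupp.
Qed.

Lemma tsupp_partial u i : tsupp (partial i u) `<=` tsupp u.
Proof.
move=> x Hx; apply: (@closed_closure _ [set x | u x != 0]).
apply: closureS Hx => y /= uy; apply: contrapT => /(notin_tsupp_partial i)/eqP H.
by rewrite H in uy.
Qed.

Lemma testfun_partial D i phi : testfun D phi -> testfun D (partial i phi).
Proof.
move=> [sphi cphi phiD]; split.
- exact: smooth_partial.
- exact: subclosed_compact (@closed_closure _ _) cphi (@tsupp_partial phi i).
- exact: subset_trans (@tsupp_partial phi i) phiD.
Qed.

Lemma testfun_sub D D' phi : D `<=` D' -> testfun D phi -> testfun D' phi.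
Proof. by move=> DD [sphi cphi phiD]; split => //; exact: subset_trans DD. Qed.

Lemma testfun_lin D (c : R) phi psi : testfun D phi -> testfun D psi ->
  testfun D (c *: phi + psi).
Proof.
move=> [s1 c1 D1] [s2 c2 D2].
have S : tsupp (c *: phi + psi) `<=` tsupp phi `|` tsupp psi.
  rewrite /tsupp -closureU; apply: closureS => x /=.
  rewrite !fctE; have [->|] := eqVneq (phi x) 0; last by left.
  by rewrite scaler0 add0r; right.
split.
- exact: smooth_lin.
- apply: subclosed_compact S; first exact: closed_closure.
  exact: compactU.
- by apply: subset_trans S _ => x [/D1|/D2].
Qed.

Lemma testfun0 D : testfun D 0.
Proof.
have E0 : [set x | (0 : E -> R) x != 0] = set0.
  by apply/seteqP; split => // x /=; rewrite eqxx.
split; rewrite ?E0 ?closure0//; [exact: smooth0|exact: compact0].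
Qed.

Lemma testfun_out D phi x : testfun D phi -> ~ D x -> phi x = 0.
Proof. by move=> [_ _ phiD] nDx; apply: notin_tsupp => /phiD. Qed.

Lemma testfun_Lfun2 D phi : testfun D phi -> phi \in Lfun leb 2%:E.
Proof.
move=> [sphi cphi phiD]; have ctsphi := smooth_continuous sphi.
have [K K0 HK] := compact_support_bounded ctsphi cphi (@notin_tsupp phi).
have [M HM] := compact_cube cphi.
have mphi : measurable_fun setT phi by exact: continuous_measurable_rV.
apply/Lfun2P; split => //.
apply: (@bounded_support_integrable _ _ _ M (K ^+ 2)).
- exact: measurable_funX.
- by move=> x; rewrite normrX lerXn2r ?nnegrE.
- move=> x nx; rewrite notin_tsupp ?expr0n//.
  by move=> /HM.
Qed.

Lemma testfun_L2 D D' phi : measurable D' -> testfun D phi -> L2 D' phi.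
Proof.
move=> mD' tphi; apply: (@L2_sub _ _ setT) => //.
rewrite /L2/= (_ : patch _ _ _ = phi); first exact: testfun_Lfun2 tphi.
by apply/funext => x; rewrite /patch in_setT.
Qed.

(** The derivative of the product [phi \* psi] has integral zero. Test functions vanish off [D], so
    integrals over [D] are integrals over the whole space. *)
Lemma testfun_parts D i phi psi : testfun D phi -> testfun D psi ->
  ip D phi (partial i psi) = - ip D (partial i phi) psi.
Proof.
move=> tphi tpsi; have [sphi cphi phiD] := tphi; have [spsi cpsi psiD] := tpsi.
have c1 := smooth_continuous sphi; have c2 := smooth_continuous spsi.
have dphi x : derivable phi x (delta_mx ord0 i) by exact: smooth_derivable.
have dpsi x : derivable psi x (delta_mx ord0 i) by exact: smooth_derivable.
have pE : partial i (phi \* psi) = fun x => phi x * partial i psi x + psi x * partial i phi x.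
  by apply/funext => x; rewrite /partial deriveM.
have zE u : (forall x, ~ D x -> u x = 0) -> zext D u = u.
  move=> H; apply/funext => x; rewrite /zext /patch; case: ifPn => // /negP xD.
  by rewrite H// => /mem_set.
have out u : testfun D u -> zext D u = u.
  by move=> tu; apply: zE => x; exact: testfun_out.
have := @integral_partial0 _ _ (phi \* psi) i (tsupp phi) _ _ _ cphi _ _.
rewrite pE => H.
have {}H : \int[leb]_x (phi x * partial i psi x + psi x * partial i phi x) = 0.
  apply: H.
  - by move=> x; apply: continuousM; [exact: c1|exact: c2].
  - by move=> x; apply: derivableM.
  - have cM (u w : E -> R) : continuous u -> continuous w -> continuous (fun x => u x * w x).
      by move=> cu cw x; apply: (@cvgM _ _ (nbhs x)); [exact: cu|exact: cw].
    have cA := cM _ _ c1 (smooth_continuous (@smooth_partial i _ spsi)).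
    have cB := cM _ _ c2 (smooth_continuous (@smooth_partial i _ sphi)).
    by move=> x; apply: (@cvgD _ R^o _ (nbhs x)); [exact: cA|exact: cB].
  - by move=> x nx /=; rewrite notin_tsupp// mul0r.
  - by move=> x nx /=; rewrite (notin_tsupp nx) (notin_tsupp_partial i nx) mul0r mulr0 addr0.
rewrite RintegralD// in H; last 2 first.
- exact: Lfun2_integrableM (testfun_Lfun2 tphi) (testfun_Lfun2 (testfun_partial i tpsi)).
- exact: Lfun2_integrableM (testfun_Lfun2 tpsi) (testfun_Lfun2 (testfun_partial i tphi)).
have Hi : ip D (partial i phi) psi = \int[leb]_x (psi x * partial i phi x).
  rewrite ipE !out//; last exact: testfun_partial.
  by apply: eq_Rintegral => x _; rewrite mulrC.
rewrite Hi ipE !out//; last exact: testfun_partial.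
by apply/eqP; rewrite -addr_eq0 H.
Qed.

End test_functions.

(** * Smooth bump functions built from exp(-1/t) *)

Section flat_function.
Context {R : realType}.

(** The powers of [1 / t] are included because differentiating exp(-1/t) produces them: the family
    over all [k] is closed under derivatives up to linear combinations. *)
Definition flat (k : nat) (t : R) : R :=
  if 0 < t then t^-1 ^+ k * expR (- t^-1) else 0.

Lemma flat_ge0 k t : 0 <= flat k t.
Proof.
rewrite /flat; case: ifP => // t0.
by rewrite mulr_ge0 ?expR_ge0// exprn_ge0// invr_ge0 ltW.
Qed.

Lemma flat0_le1 t : flat 0 t <= 1.
Proof.
rewrite /flat; case: ifP => // t0.
by rewrite expr0 mul1r -expR0 ler_expR oppr_le0 invr_ge0 ltW.
Qed.

Lemma flat_le k t : 0 < t -> flat k t <= k.+1`!%:R * t.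
Proof.
move=> t0; rewrite /flat t0 expRN ler_pdivrMr ?expR_gt0//.
have ti0 : 0 <= t^-1 by rewrite invr_ge0 ltW.
have := expR_ge1Dxn k ti0.
have f0 : 0 < k.+1`!%:R :> R by rewrite ltr0n fact_gt0.
move=> /(le_trans _) H; have {}H : t^-1 ^+ k.+1 / k.+1`!%:R <= expR t^-1.
  by apply: H; rewrite lerDr.
rewrite ler_pdivrMr// exprS mulrC in H.
rewrite -(ler_pM2r (ltac:(by rewrite invr_gt0) : 0 < t^-1)).
rewrite mulrAC -(mulrA _ t) mulfV ?gt_eqF// mulr1.
by apply: le_trans H _; rewrite mulrC.
Qed.

Lemma flat_divr k t : 0 < t -> t^-1 * flat k t = flat k.+1 t.
Proof. by move=> t0; rewrite /flat t0 mulrA exprS. Qed.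

(** Away from 0 this is the product and chain rule. At 0 the difference quotient at [h > 0] is
    [flat k.+1 h], which [flat_le] forces to 0, and all terms of the claimed value vanish there. *)
Lemma is_derive_flat k (t : R) :
  is_derive t 1 (flat k) (- k%:R * flat k.+1 t + flat k.+2 t).
Proof.
have [t0|t0|->] := ltgtP t 0.
- have nt : ~~ (0 < t) by rewrite -leNgt ltW.
  rewrite {2 3}/flat (negbTE nt) mulr0 addr0.
  apply: (@near_eq_is_derive _ _ _ (cst 0)).
  near=> s; rewrite /flat ifF//; apply/negbTE; rewrite -leNgt ltW//.
  by near: s; exact: lt_nbhsl.
- apply: (@near_eq_is_derive R R^o R^o (fun s : R => s^-1 ^+ k * expR (- s^-1))).
    near=> s; rewrite /flat ifT//; near: s; exact: lt_nbhsr.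
  have tN0 : t != 0 by rewrite gt_eqF.
  pose y := t^-1.
  have D1 : is_derive t 1 (fun s : R => s^-1) (- y ^+ 2).
    apply: is_derive_eq; first exact: (is_deriveV tN0 (is_derive_id t 1)).
    by rewrite [LHS]mulr1 /y exprVn.
  have DP : is_derive y 1 (fun x : R => x ^+ k) (k%:R * y ^+ k.-1).
    split; first exact: exprn_derivable.
    by rewrite exp_derive [LHS]mulr1.
  have DX := is_derive1_comp DP D1.
  have D2 : is_derive t 1 (expR \o (fun s : R => - s^-1)) (expR (- y) * y ^+ 2).
    apply: is_derive1_comp.
    by rewrite -[y ^+ 2]opprK; exact: is_deriveN.
  refine (is_derive_eq (is_deriveM DX D2) _).
  rewrite /flat t0 /= -[t^-1]/y /GRing.scale/=.
  case: k {DP DX} => [|k] /=; rewrite !exprS; ring.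
- rewrite {2 3}/flat ltxx mulr0 addr0.
  (* The constant of [flat_le] for index [k.+1]. *)
  pose C : R := k.+2`!%:R.
  have C0 : 0 < C by rewrite ltr0n fact_gt0.
  have H : (fun h => h^-1 *: ((flat k \o shift 0) (h *: 1) - flat k 0)) @ (0 : R)^' --> (0 : R).
    apply/cvgrPdist_lt => e e0; near=> h.
    have h0 : h != 0 by near: h; exact: nbhs_dnbhs_neq.
    have -> : h^-1 *: ((flat k \o shift 0) (h *: 1) - flat k 0) = h^-1 * flat k h.
      by rewrite /= addr0 [h *: 1]mulr1 {2}/flat ltxx subr0.
    rewrite sub0r normrN.
    have heC : h < e / C.
      by near: h; apply: nbhs_dnbhs; apply: lt_nbhsl; exact: divr_gt0.
    have [hp|hn] := ltP 0 h; last first.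
      have hn' : (0 < h) = false by apply/negbTE; rewrite -leNgt.
      by rewrite /flat hn' mulr0 normr0.
    rewrite flat_divr// ger0_norm ?flat_ge0//.
    apply: le_lt_trans (flat_le _ hp) _; by rewrite mulrC -ltr_pdivlMr.
  split; last exact: cvg_lim H.
  by apply/cvg_ex; exists 0.
Unshelve. all: by end_near. Qed.

End flat_function.

Section elementary.
Context {R : realType} {d : nat}.
Local Notation E := 'rV[R]_d.

(* Stability under partial derivatives is what makes its members smooth. *)
Inductive flat_alg : (E -> R) -> Prop :=
| flat_alg_cst c : flat_alg (cst c)
| flat_alg_flat k j (a c : R) : flat_alg (fun x => flat k (a * x ord0 j + c))
| flat_algD f g : flat_alg f -> flat_alg g -> flat_alg (f + g)
| flat_algM f g : flat_alg f -> flat_alg g -> flat_alg (f * g).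

Lemma derive_coord (x v : E) (j : 'I_d) :
  'D_v (fun y : E => y ord0 j) x = v ord0 j.
Proof.
apply: cvg_lim => //; apply: cvg_near_cst; near=> h.
have h0 : h != 0 by near: h; exact: nbhs_dnbhs_neq.
by rewrite /= !mxE addrK /GRing.scale/= mulrA mulVf// mul1r.
Unshelve. all: by end_near. Qed.

Lemma is_derive_affine (x v : E) (j : 'I_d) (a c : R) :
  is_derive x v (fun y : E => a * y ord0 j + c) (a * v ord0 j).
Proof.
have D1 : is_derive x v (fun y : E => y ord0 j) (v ord0 j).
  split; last exact: derive_coord.
  by apply: diff_derivable; exact: differentiable_coord.
have := is_deriveD (is_deriveZ a D1) (is_derive_cst c x v).
by rewrite addr0.
Qed.

Lemma flat_alg_differentiable f x : flat_alg f -> differentiable f x.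
Proof.
move=> F; elim: F => [c|k j a c|g h _ dg _ dh|g h _ dg _ dh].
- exact: differentiable_cst.
- have da : differentiable (fun y : E => a * y ord0 j + c) x.
    apply: differentiableD; last exact: differentiable_cst.
    by apply: differentiableM; [exact: differentiable_cst|exact: differentiable_coord].
  apply: (@differentiable_comp _ _ R^o R^o (fun y : E => a * y ord0 j + c) (flat k)) => //.
  by apply/derivable1_diffP; have [] := is_derive_flat k (a * x ord0 j + c).
- exact: differentiableD.
- exact: differentiableM.
Qed.

Lemma flat_alg_derivable f x (v : E) : flat_alg f -> derivable f x v.
Proof. by move=> F; apply: diff_derivable; exact: flat_alg_differentiable. Qed.

Lemma flat_alg_partial i f : flat_alg f -> flat_alg (partial i f).
Proof.
elim=> [c|k j a c|g h Fg Pg Fh Ph|g h Fg Pg Fh Ph].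
- rewrite (_ : partial _ _ = cst 0); first exact: flat_alg_cst.
  by apply/funext => x; rewrite /partial derive_cst.
- pose l (x : E) := a * x ord0 j + c.
  rewrite (_ : partial _ _ = cst (a * (delta_mx ord0 i : E) ord0 j) *
    (cst (- k%:R) * (fun x => flat k.+1 (l x)) + (fun x => flat k.+2 (l x)))).
    apply: flat_algM; first exact: flat_alg_cst.
    apply: flat_algD; last exact: flat_alg_flat.
    by apply: flat_algM; [exact: flat_alg_cst|exact: flat_alg_flat].
  apply/funext => x; rewrite /partial.
  have dl : is_derive x (delta_mx ord0 i) l (a * (delta_mx ord0 i : E) ord0 j).
    exact: is_derive_affine.
  have df := is_derive_flat k (l x).
  have ddf : differentiable (flat k : R^o -> R^o) (l x).
    by apply/derivable1_diffP; have [] := df.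
  have ddl : differentiable l x.
    apply: differentiableD; last exact: differentiable_cst.
    by apply: differentiableM; [exact: differentiable_cst|exact: differentiable_coord].
  have dc : differentiable ((flat k : R^o -> R^o) \o l) x by exact: differentiable_comp.
  have -> : (fun x0 : E => flat k (a * x0 ord0 j + c)) = flat k \o l by [].
  have E1 : 'd l x (delta_mx ord0 i) = a * (delta_mx ord0 i : E) ord0 j.
    by rewrite -deriveE//; have [] := dl.
  rewrite deriveE// (@diff_comp _ _ R^o R^o l (flat k))//= E1.
  rewrite deriv1E; last by have [] := df.
  by rewrite derive1E; have [_ ->] := df.
- rewrite (_ : partial _ _ = partial i g + partial i h); first exact: flat_algD.
  by apply/funext => x; rewrite /partial deriveD//; exact: flat_alg_derivable.
- rewrite (_ : partial _ _ = g * partial i h + h * partial i g).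
    by apply: flat_algD; exact: flat_algM.
  by apply/funext => x; rewrite /partial deriveM//; exact: flat_alg_derivable.
Qed.

Lemma flat_alg_smooth f : flat_alg f -> smooth f.
Proof.
move=> F s x; apply: flat_alg_differentiable.
by elim: s => //= i s; exact: flat_alg_partial.
Qed.

End elementary.

(** * The fundamental lemma of the calculus of variations *)

Section fundamental_lemma.
Context {R : realType} {d : nat}.
Local Notation E := 'rV[R]_d.
Local Notation leb := (@lebesgue_rV R d).
Implicit Types (a b : 'I_d -> R) (D : set E).

Definition obox a b : set E := [set x | forall j, a j < x ord0 j < b j].
Definition cbox a b : set E := [set x | forall j, x ord0 j \in `[a j, b j]].

(** Written with affine arguments to match the generator [flat_alg_flat]. The scale [n.+1] steepens
    the profile, so that the product over [j] increases to the indicator of the open box. *)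
Definition bump_coord n a b j (x : E) : R :=
  flat 0 (n.+1%:R * x ord0 j + - (n.+1%:R * a j)) *
  flat 0 (- n.+1%:R * x ord0 j + n.+1%:R * b j).

Lemma bump_coordE n a b j x : bump_coord n a b j x =
  flat 0 (n.+1%:R * (x ord0 j - a j)) * flat 0 (n.+1%:R * (b j - x ord0 j)).
Proof. by rewrite /bump_coord; congr (flat 0 _ * flat 0 _); ring. Qed.

Definition bump n a b (x : E) : R := \prod_j bump_coord n a b j x.

Lemma bump_smooth n a b : smooth (bump n a b).
Proof.
apply: flat_alg_smooth; rewrite /bump; elim: (index_enum _) => [|j s IH].
  rewrite (_ : (fun x => _) = cst 1); first exact: flat_alg_cst.
  by apply/funext => x; rewrite big_nil.
rewrite (_ : (fun x => _) = bump_coord n a b j * (fun x => \prod_(j <- s) bump_coord n a b j x)).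
  by do 2 apply: flat_algM => //; exact: flat_alg_flat.
by apply/funext => x; rewrite big_cons.
Qed.

Lemma bump_coord_out n a b j (x : E) : ~~ (a j < x ord0 j < b j) ->
  bump_coord n a b j x = 0.
Proof.
have n0 : 0 < n.+1%:R :> R by rewrite ltr0n.
rewrite negb_and bump_coordE /flat !pmulr_rgt0// !subr_gt0.
by move=> /orP[/negbTE->|/negbTE->]; rewrite ?mul0r ?mulr0.
Qed.

Lemma bump_coord_le1 n a b j x : 0 <= bump_coord n a b j x <= 1.
Proof.
rewrite /bump_coord mulr_ge0 ?flat_ge0//= -[leRHS]mulr1.
by apply: ler_pM; rewrite ?flat_ge0 ?flat0_le1.
Qed.

Lemma bump_le1 n a b x : 0 <= bump n a b x <= 1.
Proof.
rewrite /bump; elim/big_ind : _ => [|y z /andP[y0 y1] /andP[z0 z1]|j _].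
- by rewrite ler01 lexx.
- by rewrite mulr_ge0//= -[leRHS]mulr1; apply: ler_pM.
- exact: bump_coord_le1.
Qed.

Lemma bump_out n a b x : ~ obox a b x -> bump n a b x = 0.
Proof.
move=> /existsNP[j /negP xj]; apply/eqP/prodf_eq0; exists j => //.
by apply/eqP/bump_coord_out.
Qed.

Lemma cvg_flat (t : R) : 0 < t -> (fun n => flat 0 (n.+1%:R * t)) @ \oo --> (1 : R).
Proof.
move=> t0; rewrite (_ : (fun n => _) = expR \o (fun n => - t^-1 * harmonic n)).
  apply: (@cvg_comp _ _ _ _ _ _ (nbhs (0 : R))).
    rewrite -(mulr0 (- t^-1)); apply: cvgM; [exact: cvg_cst|exact: cvg_harmonic].
  by rewrite -expR0; exact: continuous_expR.
apply/funext => n; rewrite /flat pmulr_rgt0 ?ltr0n// t0 expr0 mul1r/=.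
by rewrite invfM mulrC mulNr.
Qed.

Lemma cvg_bump a b x : (fun n => bump n a b x) @ \oo --> (\1_(obox a b) x : R).
Proof.
rewrite indicE; have [xab|nx] := pselect (obox a b x); last first.
  rewrite memNset//= (_ : (fun n => _) = cst 0); first exact: cvg_cst.
  by apply/funext => n; rewrite bump_out.
rewrite mem_set//= (_ : true%:R = \prod_(j < d) (1 : R)); last by rewrite big1.
rewrite /bump.
apply: (@cvg_big R 'I_d *%R 1 xpredT (@mul_continuous R) nat \oo
  (index_enum 'I_d) (fun j n => bump_coord n a b j x) (fun=> 1)) => j _.
have /andP[aj bj] := xab j.
rewrite -[X in _ --> X]mulr1 (_ : (fun n => _) = (fun n =>
  flat 0 (n.+1%:R * (x ord0 j - a j)) * flat 0 (n.+1%:R * (b j - x ord0 j)))).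
  by apply: cvgM; apply: cvg_flat; rewrite subr_gt0.
by apply/funext => n; rewrite bump_coordE.
Qed.

Lemma closed_cbox a b : closed (cbox a b).
Proof.
move=> x clx j.
apply: (@preimage_closed _ R^o (fun x : E => x ord0 j) `[a j, b j]%classic).
- by move=> y _; exact: coord_continuous.
- exact: interval_closed.
- by apply: closureS clx => y /(_ j).
Qed.

Lemma compact_cbox a b : compact (cbox a b).
Proof. by apply: (@rV_compact R d (fun j => `[a j, b j]%classic)) => j; exact: segment_compact. Qed.

Lemma bump_testfun n a b D : cbox a b `<=` D -> testfun D (bump n a b).
Proof.
move=> abD; split; first exact: bump_smooth.
  apply: (subclosed_compact (@closed_closure _ _) (@compact_cbox a b)).
  move=> x clx; apply: closed_cbox; apply: closureS clx => y /eqP h j.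
  have : obox a b y by apply: contrapT => /(bump_out n).
  by rewrite in_itv/= => /(_ j)/andP[/ltW-> /ltW->].
move=> x clx; apply: abD; apply: closed_cbox; apply: closureS clx => y /eqP h j.
have : obox a b y by apply: contrapT => /(bump_out n).
by rewrite in_itv/= => /(_ j)/andP[/ltW-> /ltW->].
Qed.

Lemma measurable_obox a b : measurable (obox a b).
Proof.
rewrite (_ : obox a b = [set x | forall j, `]a j, b j[%classic (x ord0 j)]).
  by apply: (@measurable_rV_forall R d (fun j => `]a j, b j[%classic)) => j; exact: measurable_itv.
by apply/seteqP; split => x H j; have := H j; rewrite /= in_itv.
Qed.

Lemma indic_obox_Lfun2 a b : (\1_(obox a b) : E -> R) \in Lfun leb 2%:E.
Proof.
have [M HM] := compact_cube (@compact_cbox a b).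
have mI : measurable_fun setT (\1_(obox a b) : E -> R).
  by apply: measurable_indic; exact: measurable_obox.
apply/Lfun2P; split => //; apply: (@bounded_support_integrable _ _ _ M 1).
- exact: measurable_funX.
- move=> x; rewrite indicE; case: (_ \in _); first by rewrite expr1n normr1.
  by rewrite expr0n normr0.
- move=> x nx; rewrite indicE memNset ?expr0n// => xab; apply: nx; apply: HM => j.
  by have := xab j; rewrite in_itv/= => /andP[/ltW-> /ltW->].
Qed.

Section vanishing.
Context D (oD : open D) (u : E -> R) (Lu : L2 D u)
  (u0 : forall phi, testfun D phi -> ip D u phi = 0).

Let integrable_box a b :
  leb.-integrable setT (EFin \o (fun x => zext D u x * \1_(obox a b) x)).
Proof. apply: Lfun2_integrableM => //; exact: indic_obox_Lfun2. Qed.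

(** The bumps are test functions and converge boundedly to the indicator of the box; dominated
    convergence transfers the vanishing pairing. *)
Let integral_obox0 a b : cbox a b `<=` D ->
  \int[leb]_x (zext D u x * \1_(obox a b) x) = 0.
Proof.
move=> abD.
have tb n := bump_testfun n abD.
have ob : obox a b `<=` D.
  by move=> x xab; apply: abD => j; have := xab j; rewrite in_itv/= => /andP[/ltW-> /ltW->].
have zb n x : zext D (bump n a b) x = bump n a b x.
  by rewrite /zext /patch; case: ifPn => // /negP xD; rewrite bump_out// => /ob/mem_set.
have ib n : leb.-integrable setT (EFin \o (fun x => zext D u x * bump n a b x)).
  by apply: Lfun2_integrableM => //; exact: testfun_Lfun2 (tb n).
have [] := @dominated_convergence _ _ _ leb setT measurableT
  (fun n => EFin \o (fun x => zext D u x * bump n a b x))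
  (EFin \o (fun x => zext D u x * \1_(obox a b) x))
  (fun x => `|(zext D u x * \1_(obox a b) x)%:E|%E).
- by move=> n; have /integrableP[m _] := ib n; exact: m.
- by have /integrableP[] := integrable_box a b.
- apply: aeW => x _; apply: cvg_EFin; first exact: nearW.
  by apply: cvgM; [exact: cvg_cst|exact: cvg_bump].
- exact: integrable_abse (integrable_box a b).
- apply: aeW => x n _ /=; rewrite lee_fin !normrM; apply: ler_wpM2l => //.
  have /andP[b0 b1] := bump_le1 n a b x.
  rewrite indicE; have [xab|nx] := pselect (obox a b x).
    by rewrite mem_set// normr1 ger0_norm.
  by rewrite bump_out// normr0.
move=> _ _; rewrite (_ : [sequence _]_n = cst 0%E); last first.
  apply/funext => n /=; rewrite -[LHS](fineK (integrable_fin_num measurableT (ib n))).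
  have e : \int[leb]_x (zext D u x * bump n a b x) = 0.
    by rewrite -(u0 (tb n)) ipE; apply: eq_Rintegral => x _; rewrite zb.
  by rewrite [fine _]e.
by move=> /(cvg_unique _ (cvg_cst _)) H; rewrite /Rintegral -H.
Qed.

(* Open orthants, possibly unbounded below: a pi-system generating the Borel sets. *)
Let box_system : set (set E) :=
  [set A | exists a : 'I_d -> \bar R, A = [set x : E | forall j, (a j < (x ord0 j)%:E)%E]].

Let setI_closed_box_system : setI_closed box_system.
Proof.
move=> _ _ [a ->] [b ->]; exists (fun j => maxe (a j) (b j)).
apply/seteqP; split => x /=.
  by move=> [xa xb] j; rewrite gt_max xa xb.
by move=> H; split => j; have := H j; rewrite gt_max => /andP[].
Qed.

Let box_system_measurable : @measurable _ E = <<s box_system >>.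
Proof.
apply/seteqP; split; last first.
  apply: smallest_sub; first exact: sigma_algebra_measurable.
  move=> _ [a ->].
  apply: (@measurable_rV_forall R d (fun j => [set t : R | (a j < t%:E)%E])) => j.
  case: (a j) => [r| |].
  - rewrite (_ : [set t : R | _] = `]r, +oo[%classic); first exact: measurable_itv.
    by apply/seteqP; split => t /=; rewrite in_itv/= andbT lte_fin.
  - rewrite (_ : [set t : R | _] = set0); first exact: measurable0.
    by apply/seteqP; split => t.
  - rewrite (_ : [set t : R | _] = setT); first exact: measurableT.
    by apply/seteqP; split => t //= _; exact: ltNyr.
have mc (i : 'I_d) : measurable_fun [set: g_sigma_algebraType box_system]
    (fun x : g_sigma_algebraType box_system => (x : E) ord0 i).
  apply: (measurability _ (measurable_realfun.RGenOInfty.measurableE R)).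
  move=> _ [_ [c ->] <-]; rewrite setTI; apply: sub_sigma_algebra.
  exists (fun j => if j == i then c%:E else -oo%E).
  apply/seteqP; split => x /=; rewrite in_itv/= andbT.
    by move=> xc j; case: eqP => [->|_]; rewrite ?lte_fin ?ltNyr.
  by move=> /(_ i); rewrite eqxx lte_fin.
apply: smallest_sub; first exact: smallest_sigma_algebra.
move=> A; rewrite -bigcup_seq => -[i _ [B mB <-]].
exact: mc.
Qed.

(** Dynkin's argument: the sets over which [w] has integral zero contain the orthants, whose
    intersection with the box is again a box, and hence all Borel sets. An integrable function with
    this property vanishes almost everywhere. *)
Lemma ae_eq0_box a b : cbox a b `<=` D ->
  {ae leb, forall x, obox a b x -> u x = 0}.
Proof.
move=> abD.
pose w x := zext D u x * \1_(obox a b) x.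
have iw : leb.-integrable setT (EFin \o w) by exact: integrable_box.
have wA0 A : measurable A -> \int[leb]_(x in A) w x = 0.
  rewrite box_system_measurable; move: A.
  have PT : \int[leb]_(x in setT) w x = 0 by exact: integral_obox0.
  apply: (dynkin_induction (P := fun A => \int[leb]_(x in A) w x = 0) box_system_measurable setI_closed_box_system) => //.
  - move=> _ [c ->].
    (* Lower corner of the orthant intersected with the box; for an infinite bound the maximum with
       [b j] makes the box empty. *)
    pose a' j := match c j with
      | r%:E => Num.max (a j) r | +oo%E => Num.max (a j) (b j) | -oo%E => a j end.
    rewrite Rintegral_mkcond -(@integral_obox0 a' b); last first.
      move=> x xab; apply: abD => j; have := xab j; rewrite !in_itv/= /a'.
      by case: (c j) => [r| |]// /andP[]; rewrite ge_max => /andP[-> _] ->.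
    apply: eq_Rintegral => x _; rewrite /w /patch.
    have aE : obox a' b x <-> ((forall j, (c j < (x ord0 j)%:E)%E) /\ obox a b x).
      have aEj j : (a' j < x ord0 j < b j) =
          ((c j < (x ord0 j)%:E)%E && (a j < x ord0 j < b j)).
        rewrite /a'; case: (c j) => [r| |].
        - by rewrite lte_fin gt_max; case: (a j < _); case: (r < _).
        - rewrite gt_max; apply/negbTE/negP => /andP[/andP[_ h1] h2].
          by have := lt_trans h1 h2; rewrite ltxx.
        - by rewrite ltNyr.
      split; first by move=> H; split => j; have := H j; rewrite aEj => /andP[].
      by move=> [h1 h2] j; rewrite aEj h1 h2.
    rewrite !indicE; case: ifPn => [/set_mem/= xc|/negP xc].
      congr (_ * (nat_of_bool _)%:R); apply/idP/idP => /set_mem H; apply/mem_set.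
        by apply/aE.
      by have /aE[] := H.
    by rewrite memNset ?mulr0// => /aE[h _]; apply: xc; exact/mem_set.
  - move=> S mS S0.
    have := @Rintegral_setU _ _ _ leb S (~` S) w mS (measurableC mS).
    rewrite setUv S0 PT add0r => <- //.
    by rewrite disj_set2E setICr.
  - move=> F mF tF F0; rewrite /Rintegral integral_bigcup//; last first.
      by apply: integrableS iw => //; exact: bigcupT_measurable.
    rewrite eseries0// => k _ _.
    rewrite -[LHS]fineK; first by have := F0 k; rewrite /Rintegral => ->.
    by apply: integrable_fin_num => //; apply: integrableS iw.
have : ae_eq leb setT (EFin \o w) (cst 0%E).
  apply: integral_ae_eq => //.
  move=> A _ mA; rewrite integral0.
  rewrite -[LHS]fineK; first by have := wA0 _ mA; rewrite /Rintegral => ->.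
  by apply: integrable_fin_num => //; apply: integrableS iw.
apply: filterS => x /(_ I) /= [] /eqP + xab.
rewrite /w indicE mem_set// mulr1 /zext /patch mem_set.
  by move=> /eqP.
by apply: abD => j; have := xab j; rewrite in_itv/= => /andP[/ltW-> /ltW->].
Qed.

(** An open set is covered by the countably many rational boxes whose closed versions it contains.
    They are enumerated by [unpickle] to combine the exceptional sets. *)
Lemma ae_eq0_testfun : u = (fun=> 0) %[ae leb in D].
Proof.
pose ra (q : 'rV[rat]_d) : 'I_d -> R := fun j => ratr (q ord0 j).
have H (n : nat) : {ae leb, forall x, forall p : 'rV[rat]_d * 'rV[rat]_d,
    unpickle n = Some p -> cbox (ra p.1) (ra p.2) `<=` D -> obox (ra p.1) (ra p.2) x -> u x = 0}.
  case: (unpickle n) => [p|]; last exact: aeW.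
  have [pD|npD] := pselect (cbox (ra p.1) (ra p.2) `<=` D).
    by have := ae_eq0_box pD; apply: filterS => x Hx q [<-].
  by apply: aeW => x q [<-].
have := ae_foralln H; apply: filterS => x Hx Dx.
have [e /= e0 eD] := (nbhs_ballP _ _).1 (open_nbhs_nbhs (conj oD Dx)).
have Hq j : exists q : rat * rat, [/\ x ord0 j - e < ratr q.1, ratr q.1 < x ord0 j,
    x ord0 j < ratr q.2 & ratr q.2 < x ord0 j + e].
  have [|q] := @rat_in_itvoo R (x ord0 j - e) (x ord0 j); first by rewrite ltrBlDr ltrDl.
  have [|r] := @rat_in_itvoo R (x ord0 j) (x ord0 j + e); first by rewrite ltrDl.
  by rewrite !in_itv/= => /andP[r1 r2] /andP[q1 q2]; exists (q, r).
have [q qE] := choice Hq.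
pose p : 'rV[rat]_d * 'rV[rat]_d := (\row_j (q j).1, \row_j (q j).2).
apply: (Hx (pickle p) p); first exact: pickleK.
- move=> y Hy; apply: eD; apply/rV_ballE => // j.
  have := Hy j; have [] := qE j; rewrite in_itv /ra !mxE /=.
  by rewrite ltr_norml; lra.
- by move=> j; have [_ h1 h2 _] := qE j; rewrite /ra !mxE h1 h2.
Qed.

End vanishing.

End fundamental_lemma.

(** * Weak derivatives and traces *)

Section sobolev_spaces.
Context {R : realType} {d : nat}.
Local Notation E := 'rV[R]_d.
Local Notation leb := (@lebesgue_rV R d).
Implicit Types (D : set E) (u v w phi : E -> R) (p q r : E -> E).

Definition cmp p i : E -> R := fun x => p x ord0 i.

Lemma cmp_lin (c : R) p q i : cmp (c *: p + q) i = c *: cmp p i + cmp q i.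
Proof. by apply/funext => x; rewrite /cmp !fctE !mxE. Qed.

Lemma ipvE D p q : L2v D p -> L2v D q ->
  ipv D p q = \sum_i ip D (cmp p i) (cmp q i).
Proof.
move=> Lp Lq; rewrite /ipv Rintegral_mkcond.
have key (s : seq 'I_d) :
    leb.-integrable setT (EFin \o (fun x => \sum_(i <- s) zext D (cmp p i) x * zext D (cmp q i) x)) /\
    \int[leb]_x (\sum_(i <- s) zext D (cmp p i) x * zext D (cmp q i) x) =
    \sum_(i <- s) ip D (cmp p i) (cmp q i).
  elim: s => [|i s [IHi IHe]].
    rewrite big_nil; split.
      rewrite (_ : EFin \o _ = cst 0%E); first exact: integrable0.
      by apply/funext => x; rewrite /= big_nil.
    rewrite (eq_Rintegral _ (g := cst 0)); last by move=> x _; rewrite big_nil.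
    by rewrite /Rintegral integral0.
  have I1 := L2_integrableM (Lp i) (Lq i); split.
    have := integrableD measurableT I1 IHi.
    by apply: eq_integrable => // x _; rewrite /= big_cons EFinD.
  rewrite big_cons -IHe ipE -RintegralD//.
  by apply: eq_Rintegral => x _; rewrite big_cons.
have [_ <-] := key (index_enum 'I_d).
apply: eq_Rintegral => x _; rewrite /patch /zext /patch /dot; case: ifP => _ //.
by rewrite big1// => i _; rewrite mul0r.
Qed.

Lemma L2v_lin D (c : R) p q : L2v D p -> L2v D q -> L2v D (c *: p + q).
Proof.
move=> Lp Lq i; have := semi_inner_lin _ _ (L2_semi_inner D) c _ _ (Lp i) (Lq i).
by rewrite -cmp_lin.
Qed.

Lemma L2v_semi_inner D : semi_inner (L2v D) (ipv D).
Proof.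
have SB := L2_semi_inner D; split.
- move=> i; have := semi_inner_nonempty _ _ SB.
  by rewrite (_ : (fun x => _) = 0)//; apply/funext => x; exact: mxE.
- by move=> c p q Lp Lq; exact: L2v_lin.
- move=> p q Lp Lq; rewrite !ipvE//; apply: eq_bigr => i _.
  exact: (semi_innerC _ _ SB _ _ (Lp i) (Lq i)).
- move=> c p q r Lp Lq Lr; rewrite !ipvE//; last exact: L2v_lin.
  rewrite mulr_sumr -big_split/=; apply: eq_bigr => i _.
  by rewrite cmp_lin (semi_inner_linl _ _ SB _ _ _ _ (Lp i) (Lq i) (Lr i)).
- move=> p Lp; rewrite ipvE//; apply: sumr_ge0 => i _.
  exact: (semi_inner_ge0 _ _ SB _ (Lp i)).
Qed.

Lemma ip_cmp_le D p i : L2v D p -> ip D (cmp p i) (cmp p i) <= ipv D p p.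
Proof.
move=> Lp; rewrite ipvE// (bigD1 i)//= lerDl; apply: sumr_ge0 => j _.
by apply: (semi_inner_ge0 _ _ (L2_semi_inner D)); exact: Lp.
Qed.

Lemma L2v_complete D : measurable D -> scomplete (L2v D) (ipv D).
Proof.
move=> mD f Lf cf; have SB := L2_semi_inner D; have SV := L2v_semi_inner D.
have cB m n i : cmp (f m - f n) i = cmp (f m) i - cmp (f n) i.
  by apply/funext => x; rewrite /cmp !fctE !mxE.
have /choice[g Hg] : forall i, exists g : E -> R, L2 D g /\
    sconv (ip D) (fun n => cmp (f n) i) g.
  move=> i; have [||g Lg Hg] := @L2_complete _ _ D mD (fun n => cmp (f n) i).
  - by move=> n; exact: Lf.
  - move=> e e0; have [N HN] := cf e e0; exists N => m n Nm Nn.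
    apply: le_lt_trans (HN m n Nm Nn); rewrite -cB; apply: ip_cmp_le.
    exact: (semi_innerB _ _ SV).
  - by exists g.
pose p : E -> E := fun x => \row_i g i x.
have pE i : cmp p i = g i by apply/funext => x; rewrite /cmp mxE.
have Lp : L2v D p by move=> i; rewrite (_ : (fun x => _) = g i) -?pE//; rewrite pE; have [] := Hg i.
exists p => // e e0.
have d0 : 0 < e / d.+1%:R by rewrite divr_gt0.
have /choice[N HN] : forall i, exists N : nat, forall n, (N <= n)%N ->
    ip D (cmp (f n) i - g i) (cmp (f n) i - g i) < e / d.+1%:R.
  by move=> i; have [_ H] := Hg i; exact: H.
exists (\max_i N i) => n Nn.
rewrite ipvE//; [|exact: (semi_innerB _ _ SV)|exact: (semi_innerB _ _ SV)].
apply: (@le_lt_trans _ _ (\sum_(i < d) e / d.+1%:R)).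
  apply: ler_sum => i _; rewrite (_ : cmp (f n - p) i = cmp (f n) i - g i).
    by apply/ltW/HN; apply: leq_trans Nn; exact: leq_bigmax.
  by rewrite -pE; apply/funext => x; rewrite /cmp !fctE !mxE.
rewrite sumr_const card_ord.
have -> : e / d.+1%:R *+ d = e * (d%:R / d.+1%:R) by rewrite -[LHS]mulr_natl mulrCA.
by rewrite gtr_pMr// ltr_pdivrMr ?ltr0n// mul1r ltr_nat.
Qed.

Lemma ip_sub D D' u v : D' `<=` D -> (forall x, ~ D' x -> v x = 0) ->
  ip D' u v = ip D u v.
Proof.
move=> DD v0; rewrite /ip Rintegral_mkcond [RHS]Rintegral_mkcond.
apply: eq_Rintegral => x _; rewrite /patch.
case: ifPn => [/set_mem D'x|/negP D'x]; first by rewrite mem_set//; exact: DD.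
by case: ifP => // _; rewrite v0 ?mulr0// => /mem_set.
Qed.

Lemma ipv_sub D D' p q : D' `<=` D -> (forall x, ~ D' x -> q x = 0) ->
  ipv D' p q = ipv D p q.
Proof.
move=> DD v0; rewrite /ipv Rintegral_mkcond [RHS]Rintegral_mkcond.
apply: eq_Rintegral => x _; rewrite /patch.
case: ifPn => [/set_mem D'x|/negP D'x]; first by rewrite mem_set//; exact: DD.
case: ifP => // _; rewrite v0; last by move=> /mem_set.
by rewrite /dot big1// => i _; rewrite mxE mulr0.
Qed.

Lemma L2v_sub D D' p : measurable D' -> D' `<=` D -> L2v D p -> L2v D' p.
Proof. by move=> mD' DD Lp i; exact: (L2_sub mD' DD (Lp i)). Qed.

(** By the fundamental lemma [u - v] vanishes almost everywhere. The conclusion is a pairing because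
    that is the form in which almost everywhere equality gets rewritten. *)
Lemma testfun_determines D u v w : open D -> L2 D u -> L2 D v -> L2 D w ->
  (forall phi, testfun D phi -> ip D u phi = ip D v phi) -> ip D u w = ip D v w.
Proof.
move=> oD Lu Lv Lw uv; have SB := L2_semi_inner D.
have Ld : L2 D (u - v) by exact: (semi_innerB _ _ SB).
have L0 := semi_inner_nonempty _ _ SB.
have H : u - v = (fun=> 0) %[ae leb in D].
  apply: ae_eq0_testfun => // phi tphi.
  have Lphi := testfun_L2 (open_measurable_rV oD) tphi.
  rewrite (linear_onB _ _ SB _ _ _ (semi_inner_linear_onl _ _ SB _ Lphi))//.
  by rewrite uv// subrr.
apply/eqP; rewrite -subr_eq0.
rewrite -(linear_onB _ _ SB _ _ _ (semi_inner_linear_onl _ _ SB _ Lw))//.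
rewrite (ae_ip Ld L0 Lw H); apply/eqP.
exact: (linear_on0 _ _ SB _ (semi_inner_linear_onl _ _ SB _ Lw)).
Qed.

Section fixed_domain.
Context D (oD : open D).

Let mD : measurable D := open_measurable_rV oD.
Let SB := L2_semi_inner D.
Let SV := L2v_semi_inner D.

Lemma testfun_cgrad_L2v phi : testfun D phi -> L2v D (cgrad phi).
Proof.
move=> tphi i; rewrite (_ : (fun x => _) = partial i phi).
  by apply: testfun_L2 => //; exact: testfun_partial tphi.
by apply/funext => x; rewrite mxE.
Qed.

Lemma cmp_cgrad phi i : cmp (cgrad phi) i = partial i phi.
Proof. by apply/funext => x; rewrite /cmp mxE. Qed.

Lemma testfun_is_wgrad phi : testfun D phi -> is_wgrad D phi (cgrad phi).
Proof.
move=> tphi; split; first exact: testfun_cgrad_L2v.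
move=> psi tpsi i; rewrite (testfun_parts i tphi tpsi); congr (- ip D _ _).
by rewrite -cmp_cgrad.
Qed.

Lemma testfun_H1 phi : testfun D phi -> H1 D phi.
Proof.
move=> tphi; split; first exact: testfun_L2 tphi.
by exists (cgrad phi); exact: testfun_is_wgrad.
Qed.

Lemma is_wgrad_lin (c : R) u v p q : L2 D u -> L2 D v ->
  is_wgrad D u p -> is_wgrad D v q -> is_wgrad D (c *: u + v) (c *: p + q).
Proof.
move=> Lu Lv [Lp up] [Lq vq]; split; first exact: L2v_lin.
move=> phi tphi i; have Lphi := testfun_L2 mD tphi.
have Ldphi := testfun_L2 mD (testfun_partial i tphi).
rewrite (semi_inner_linl _ _ SB)// -/(cmp _ i) cmp_lin.
rewrite (semi_inner_linl _ _ SB _ _ _ _ (Lp i) (Lq i) Lphi) up// vq//.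
by move: (ip _ _ _) (ip _ _ _) => *; ring.
Qed.

Lemma is_wdiv_lin (c : R) u v p q : L2v D p -> L2v D q ->
  is_wdiv D p u -> is_wdiv D q v -> is_wdiv D (c *: p + q) (c *: u + v).
Proof.
move=> Lp Lq [Lu up] [Lv vq]; split; first exact: (semi_inner_lin _ _ SB).
move=> phi tphi; have Lphi := testfun_L2 mD tphi.
have Lg := testfun_cgrad_L2v tphi.
rewrite (semi_inner_linl _ _ SV)// (semi_inner_linl _ _ SB)// up// vq//.
by move: (ip _ _ _) (ip _ _ _) => *; ring.
Qed.

Lemma gradP u : H1 D u -> is_wgrad D u (grad D u).
Proof. by move=> [_ [p up]]; apply: (@xgetPex _ 0 [set p | is_wgrad D u p]); exists p. Qed.

Lemma wdivP q : Hdiv D q -> is_wdiv D q (wdiv D q).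
Proof. by move=> [_ [u qu]]; apply: (@xgetPex _ 0 [set u | is_wdiv D q u]); exists u. Qed.

Lemma is_wgrad_H1 u p : L2 D u -> is_wgrad D u p -> H1 D u.
Proof. by move=> Lu up; split => //; exists p. Qed.

Lemma is_wdiv_Hdiv q u : L2v D q -> is_wdiv D q u -> Hdiv D q.
Proof. by move=> Lq qu; split => //; exists u. Qed.

Lemma is_wgrad_ipv u p q r : is_wgrad D u p -> is_wgrad D u q -> L2v D r ->
  ipv D p r = ipv D q r.
Proof.
move=> [Lp up] [Lq uq] Lr; rewrite !ipvE//; apply: eq_bigr => i _.
apply: testfun_determines => //; [exact: Lp|exact: Lq|exact: Lr|].
move=> phi tphi; apply: oppr_inj.
by rewrite -[LHS]up// -[RHS]uq.
Qed.

Lemma is_wdiv_ip q u v w : is_wdiv D q u -> is_wdiv D q v -> L2 D w ->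
  ip D u w = ip D v w.
Proof.
move=> [Lu qu] [Lv qv] Lw; apply: testfun_determines => // phi tphi.
by apply: oppr_inj; rewrite -qu// -qv.
Qed.

Lemma grad_L2v u : H1 D u -> L2v D (grad D u).
Proof. by move=> /gradP[]. Qed.

Lemma wdiv_L2 q : Hdiv D q -> L2 D (wdiv D q).
Proof. by move=> /wdivP[]. Qed.

(** [grad] is some choice of [xget], equal to a known weak gradient only almost everywhere; inside a
    pairing the two can be exchanged. [wdivE] does the same for divergences. *)
Lemma gradE u p r : L2 D u -> is_wgrad D u p -> L2v D r ->
  ipv D (grad D u) r = ipv D p r.
Proof. by move=> Lu up; apply: (is_wgrad_ipv _ up) => //; apply: gradP; exact: is_wgrad_H1 up. Qed.

Lemma wdivE q u w : L2v D q -> is_wdiv D q u -> L2 D w ->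
  ip D (wdiv D q) w = ip D u w.
Proof. by move=> Lq qu; apply: (is_wdiv_ip _ qu) => //; apply: wdivP; exact: is_wdiv_Hdiv qu. Qed.

Definition ipH1 D u v := ip D u v + ipv D (grad D u) (grad D v).

Definition ipHdiv D p q := ipv D p q + ip D (wdiv D p) (wdiv D q).

Lemma normH1E u : normH1 D u = snorm (ipH1 D) u. Proof. by []. Qed.

Lemma normHdivE q : normHdiv D q = snorm (ipHdiv D) q. Proof. by []. Qed.

Lemma grad_lin (c : R) u v r : H1 D u -> H1 D v -> L2v D r ->
  ipv D (grad D (c *: u + v)) r = c * ipv D (grad D u) r + ipv D (grad D v) r.
Proof.
move=> Hu Hv Lr; have [Lu _] := Hu; have [Lv _] := Hv.
rewrite (gradE _ (is_wgrad_lin c Lu Lv (gradP Hu) (gradP Hv)))//.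
  by rewrite (semi_inner_linl _ _ SV)//; exact: grad_L2v.
exact: (semi_inner_lin _ _ SB).
Qed.

Lemma wdiv_lin (c : R) p q w : Hdiv D p -> Hdiv D q -> L2 D w ->
  ip D (wdiv D (c *: p + q)) w = c * ip D (wdiv D p) w + ip D (wdiv D q) w.
Proof.
move=> Hp Hq Lw; have [Lp _] := Hp; have [Lq _] := Hq.
rewrite (wdivE _ (is_wdiv_lin c Lp Lq (wdivP Hp) (wdivP Hq)))//.
  by rewrite (semi_inner_linl _ _ SB)//; exact: wdiv_L2.
exact: L2v_lin.
Qed.

Lemma H1_lin (c : R) u v : H1 D u -> H1 D v -> H1 D (c *: u + v).
Proof.
move=> Hu Hv; have [Lu _] := Hu; have [Lv _] := Hv.
apply: is_wgrad_H1 (is_wgrad_lin c Lu Lv (gradP Hu) (gradP Hv)).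
exact: (semi_inner_lin _ _ SB).
Qed.

Lemma Hdiv_lin (c : R) p q : Hdiv D p -> Hdiv D q -> Hdiv D (c *: p + q).
Proof.
move=> Hp Hq; have [Lp _] := Hp; have [Lq _] := Hq.
apply: is_wdiv_Hdiv (is_wdiv_lin c Lp Lq (wdivP Hp) (wdivP Hq)).
exact: L2v_lin.
Qed.

Lemma H1_semi_inner : semi_inner (H1 D) (ipH1 D).
Proof.
split.
- by apply: testfun_H1; exact: testfun0.
- by move=> c u v; exact: H1_lin.
- move=> u v Hu Hv; rewrite /ipH1 (semi_innerC _ _ SB _ _ Hu.1 Hv.1).
  by rewrite (semi_innerC _ _ SV _ _ (grad_L2v Hu) (grad_L2v Hv)).
- move=> c u v w Hu Hv Hw; rewrite /ipH1 grad_lin//; last exact: grad_L2v.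
  rewrite (semi_inner_linl _ _ SB _ _ _ _ Hu.1 Hv.1 Hw.1).
  by move: (ip D u w) (ip D v w) (ipv _ _ _) (ipv _ _ _) => *; ring.
- move=> u Hu; rewrite /ipH1 addr_ge0//.
    by apply: (semi_inner_ge0 _ _ SB); have [] := Hu.
  by apply: (semi_inner_ge0 _ _ SV); exact: grad_L2v.
Qed.

Lemma Hdiv_semi_inner : semi_inner (Hdiv D) (ipHdiv D).
Proof.
split.
- apply: (is_wdiv_Hdiv (semi_inner_nonempty _ _ SV) (u := 0)).
  split; first exact: (semi_inner_nonempty _ _ SB).
  move=> phi tphi.
  rewrite (linear_on0 _ _ SV _ (semi_inner_linear_onl _ _ SV _ _)).
    rewrite (linear_on0 _ _ SB _ (semi_inner_linear_onl _ _ SB _ _)) ?oppr0//.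
    exact: testfun_L2 tphi.
  exact: testfun_cgrad_L2v.
- by move=> c p q; exact: Hdiv_lin.
- move=> p q Hp Hq; rewrite /ipHdiv (semi_innerC _ _ SV _ _ Hp.1 Hq.1).
  by rewrite (semi_innerC _ _ SB _ _ (wdiv_L2 Hp) (wdiv_L2 Hq)).
- move=> c p q r Hp Hq Hr; rewrite /ipHdiv wdiv_lin//; last exact: wdiv_L2.
  rewrite (semi_inner_linl _ _ SV _ _ _ _ Hp.1 Hq.1 Hr.1).
  by move: (ipv D p r) (ipv D q r) (ip _ _ _) (ip _ _ _) => *; ring.
- move=> p Hp; rewrite /ipHdiv addr_ge0//.
    by apply: (semi_inner_ge0 _ _ SV); have [] := Hp.
  by apply: (semi_inner_ge0 _ _ SB); exact: wdiv_L2.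
Qed.

End fixed_domain.

End sobolev_spaces.

(** * Completeness of the Sobolev spaces, zero traces and normal traces *)

Section sobolev_complete.
Context {R : realType} {d : nat}.
Local Notation E := 'rV[R]_d.
Local Notation leb := (@lebesgue_rV R d).
Implicit Types (u v w phi : E -> R) (p q r : E -> E).

Lemma ler0_small (x K : R) : 0 <= K -> (forall e, 0 < e -> `|x| <= e * K) -> x = 0.
Proof.
move=> K0 H; apply/eqP; rewrite -normr_eq0 eq_le normr_ge0 andbT.
apply/ler_addgt0Pr => e e0; rewrite add0r.
have K1 : 0 < K + 1 by rewrite ltr_wpDl.
apply: le_trans (H _ (divr_gt0 e0 K1)) _.
by rewrite -mulrA ger_pMr// mulrC ler_pdivrMr// mul1r lerDl.
Qed.

Section fixed_domain.
Context (D : set E) (oD : open D).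

Let mD : measurable D := open_measurable_rV oD.
Let SB := L2_semi_inner D.
Let SV := L2v_semi_inner D.
Let SH := H1_semi_inner oD.
Let SD := Hdiv_semi_inner oD.

Lemma ip_H1_le u : H1 D u -> ip D u u <= ipH1 D u u.
Proof. by move=> Hu; rewrite lerDl; apply: (semi_inner_ge0 _ _ SV); exact: grad_L2v. Qed.

Lemma ipv_grad_le u : H1 D u -> ipv D (grad D u) (grad D u) <= ipH1 D u u.
Proof. by move=> Hu; rewrite lerDr; apply: (semi_inner_ge0 _ _ SB); have [] := Hu. Qed.

Lemma ipv_Hdiv_le q : Hdiv D q -> ipv D q q <= ipHdiv D q q.
Proof. by move=> Hq; rewrite lerDl; apply: (semi_inner_ge0 _ _ SB); exact: wdiv_L2. Qed.

Lemma ip_wdiv_le q : Hdiv D q -> ip D (wdiv D q) (wdiv D q) <= ipHdiv D q q.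
Proof. by move=> Hq; rewrite lerDr; apply: (semi_inner_ge0 _ _ SV); have [] := Hq. Qed.

Lemma gradB u v r : H1 D u -> H1 D v -> L2v D r ->
  ipv D (grad D (u - v)) r = ipv D (grad D u - grad D v) r.
Proof.
move=> Hu Hv Lr; rewrite -[in LHS](scaleN1r v) addrC grad_lin//.
rewrite (linear_onB _ _ SV _ _ _ (semi_inner_linear_onl _ _ SV _ Lr)); first by rewrite mulN1r addrC.
  exact: grad_L2v.
exact: grad_L2v.
Qed.

Lemma wdivB p q w : Hdiv D p -> Hdiv D q -> L2 D w ->
  ip D (wdiv D (p - q)) w = ip D (wdiv D p - wdiv D q) w.
Proof.
move=> Hp Hq Lw; rewrite -[in LHS](scaleN1r q) addrC wdiv_lin//.
rewrite (linear_onB _ _ SB _ _ _ (semi_inner_linear_onl _ _ SB _ Lw)); first by rewrite mulN1r addrC.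
  exact: wdiv_L2.
exact: wdiv_L2.
Qed.

Lemma gradBB u v : H1 D u -> H1 D v ->
  ipv D (grad D (u - v)) (grad D (u - v)) =
  ipv D (grad D u - grad D v) (grad D u - grad D v).
Proof.
move=> Hu Hv; have Huv : H1 D (u - v) by exact: (semi_innerB _ _ SH).
have L1 : L2v D (grad D (u - v)) by exact: grad_L2v.
have L2 : L2v D (grad D u - grad D v) by apply: (semi_innerB _ _ SV); exact: grad_L2v.
by rewrite gradB// (semi_innerC _ _ SV)// gradB.
Qed.

Lemma wdivBB p q : Hdiv D p -> Hdiv D q ->
  ip D (wdiv D (p - q)) (wdiv D (p - q)) =
  ip D (wdiv D p - wdiv D q) (wdiv D p - wdiv D q).
Proof.
move=> Hp Hq; have Hpq : Hdiv D (p - q) by exact: (semi_innerB _ _ SD).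
have L1 : L2 D (wdiv D (p - q)) by exact: wdiv_L2.
have L2 : L2 D (wdiv D p - wdiv D q) by apply: (semi_innerB _ _ SB); exact: wdiv_L2.
by rewrite wdivB// (semi_innerC _ _ SB)// wdivB.
Qed.

(** Weak derivatives are closed: their defining identity passes to L2 limits. A scalar plus a vector
    pairing covers both the gradient, tested with [single i phi], and the divergence. *)
Lemma ip_lim0 (x : nat -> E -> R) y (z : nat -> E -> E) p phi q :
  (forall n, L2 D (x n)) -> L2 D y -> (forall n, L2v D (z n)) -> L2v D p ->
  L2 D phi -> L2v D q -> sconv (ip D) x y -> sconv (ipv D) z p ->
  (forall n, ip D (x n) phi + ipv D (z n) q = 0) -> ip D y phi + ipv D p q = 0.
Proof.
move=> Lx Ly Lz Lp Lphi Lq xy zp H.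
have s1 := snorm_ge0 (ip D) phi; have s2 := snorm_ge0 (ipv D) q.
apply: (@ler0_small _ (snorm (ip D) phi + snorm (ipv D) q)) => [|e e0].
  exact: addr_ge0.
have [N1 h1] := sconv_snorm _ _ SB _ _ Lx Ly xy _ e0.
have [N2 h2] := sconv_snorm _ _ SV _ _ Lz Lp zp _ e0.
pose n := maxn N1 N2.
have {}h1 := h1 n (leq_maxl _ _); have {}h2 := h2 n (leq_maxr _ _).
have Lxy : L2 D (x n - y) by exact: (semi_innerB _ _ SB).
have Lzp : L2v D (z n - p) by exact: (semi_innerB _ _ SV).
have -> : ip D y phi + ipv D p q = - (ip D (x n - y) phi + ipv D (z n - p) q).
  rewrite (linear_onB _ _ SB _ _ _ (semi_inner_linear_onl _ _ SB _ Lphi))//.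
  rewrite (linear_onB _ _ SV _ _ _ (semi_inner_linear_onl _ _ SV _ Lq))//.
  have := H n; move: (ip D y _) (ip D (x n) _) (ipv D p _) (ipv D (z n) _) => *; lra.
rewrite normrN mulrDr; apply: le_trans (ler_normD _ _) _; apply: lerD.
  apply: le_trans (semi_inner_CS _ _ SB _ _ Lxy Lphi) _.
  by apply: ler_wpM2r => //; exact: ltW.
apply: le_trans (semi_inner_CS _ _ SV _ _ Lzp Lq) _.
by apply: ler_wpM2r => //; exact: ltW.
Qed.

(** The vector test field along one axis, which turns componentwise identities into identities for
    [ipv]. *)
Definition single (i : 'I_d) phi : E -> E := fun x => phi x *: delta_mx ord0 i.

Lemma cmp_single i j phi : cmp (single i phi) j = (j == i)%:R *: phi.
Proof. by apply/funext => x; rewrite /cmp !mxE /= mulrC. Qed.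

Lemma single_L2v i phi : L2 D phi -> L2v D (single i phi).
Proof.
move=> Lphi j; have := semi_innerZ _ _ SB (j == i)%:R _ Lphi.
by rewrite -cmp_single.
Qed.

Lemma ipv_single i p phi : L2v D p -> L2 D phi ->
  ipv D p (single i phi) = ip D (cmp p i) phi.
Proof.
move=> Lp Lphi; rewrite ipvE//; last exact: single_L2v.
rewrite (bigD1 i)//= big1 ?addr0 => [|j ji].
  by rewrite cmp_single eqxx scale1r.
rewrite cmp_single (negbTE ji) scale0r.
exact: (linear_on0 _ _ SB _ (semi_inner_linear_onr _ _ SB _ (Lp j))).
Qed.

(** Functions and gradients converge separately in L2, and by [ip_lim0] the second limit is a weak
    gradient of the first. *)
Lemma H1_complete : scomplete (H1 D) (ipH1 D).
Proof.
move=> f Hf cf.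
have Lf n : L2 D (f n) by have [] := Hf n.
have Lg n : L2v D (grad D (f n)) by exact: grad_L2v.
have HB m n : H1 D (f m - f n) by exact: (semi_innerB _ _ SH).
have [||u Lu fu] := L2_complete mD (x := f) => //.
  move=> e e0; have [N HN] := cf e e0; exists N => m n Nm Nn.
  by apply: le_lt_trans (HN m n Nm Nn); exact: ip_H1_le.
have [||p Lp gp] := L2v_complete mD (x := fun n => grad D (f n)) => //.
  move=> e e0; have [N HN] := cf e e0; exists N => m n Nm Nn.
  by apply: le_lt_trans (HN m n Nm Nn); rewrite -gradBB//; exact: ipv_grad_le.
have up : is_wgrad D u p.
  split => // phi tphi i.
  have Lphi := testfun_L2 mD tphi.
  have Ldphi := testfun_L2 mD (testfun_partial i tphi).
  apply/eqP; rewrite -addr_eq0 -/(cmp p i) -ipv_single//; apply/eqP.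
  apply: (ip_lim0 Lf Lu Lg Lp Ldphi (single_L2v i Lphi) fu gp) => n.
  have [_ H] := gradP (Hf n); rewrite H// ipv_single//.
  by rewrite addrC subrr.
have Hu : H1 D u by exact: is_wgrad_H1 up.
exists u => // e e0; have e2 : 0 < e / 2 by rewrite divr_gt0.
have [N1 h1] := fu _ e2; have [N2 h2] := gp _ e2.
exists (maxn N1 N2) => n; rewrite geq_max => /andP[n1 n2].
have {}h1 := h1 _ n1; have {}h2 := h2 _ n2.
rewrite /ipH1 gradBB//.
have E1 r : L2v D r -> ipv D (grad D (f n) - grad D u) r = ipv D (grad D (f n) - p) r.
  move=> Lr; rewrite !(linear_onB _ _ SV _ _ _ (semi_inner_linear_onl _ _ SV _ Lr))//.
    by rewrite (gradE oD Lu up).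
  exact: grad_L2v.
have L1 : L2v D (grad D (f n) - grad D u) by apply: (semi_innerB _ _ SV) => //; exact: grad_L2v.
have L2 : L2v D (grad D (f n) - p) by exact: (semi_innerB _ _ SV).
rewrite E1// (semi_innerC _ _ SV)// E1//.
by move: h1 h2; move: (ip _ _ _) (ipv _ _ _) => *; lra.
Qed.

Lemma Hdiv_complete : scomplete (Hdiv D) (ipHdiv D).
Proof.
move=> f Hf cf.
have Lf n : L2v D (f n) by have [] := Hf n.
have Lg n : L2 D (wdiv D (f n)) by exact: wdiv_L2.
have HB m n : Hdiv D (f m - f n) by exact: (semi_innerB _ _ SD).
have [||q Lq fq] := L2v_complete mD (x := f) => //.
  move=> e e0; have [N HN] := cf e e0; exists N => m n Nm Nn.
  by apply: le_lt_trans (HN m n Nm Nn); exact: ipv_Hdiv_le.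
have [||u Lu gu] := L2_complete mD (x := fun n => wdiv D (f n)) => //.
  move=> e e0; have [N HN] := cf e e0; exists N => m n Nm Nn.
  by apply: le_lt_trans (HN m n Nm Nn); rewrite -wdivBB//; exact: ip_wdiv_le.
have qu : is_wdiv D q u.
  split => // phi tphi.
  have Lphi := testfun_L2 mD tphi; have Lgphi := testfun_cgrad_L2v oD tphi.
  apply/eqP; rewrite -addr_eq0 addrC; apply/eqP.
  apply: (ip_lim0 Lg Lu Lf Lq Lphi Lgphi gu fq) => n.
  by have [_ H] := wdivP (Hf n); rewrite H// subrr.
have Hq : Hdiv D q by exact: is_wdiv_Hdiv qu.
exists q => // e e0; have e2 : 0 < e / 2 by rewrite divr_gt0.
have [N1 h1] := fq _ e2; have [N2 h2] := gu _ e2.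
exists (maxn N1 N2) => n; rewrite geq_max => /andP[n1 n2].
have {}h1 := h1 _ n1; have {}h2 := h2 _ n2.
rewrite /ipHdiv wdivBB//.
have E1 w : L2 D w -> ip D (wdiv D (f n) - wdiv D q) w = ip D (wdiv D (f n) - u) w.
  move=> Lw; rewrite !(linear_onB _ _ SB _ _ _ (semi_inner_linear_onl _ _ SB _ Lw))//.
    by rewrite (wdivE oD Lq qu).
  exact: wdiv_L2.
have L1 : L2 D (wdiv D (f n) - wdiv D q) by apply: (semi_innerB _ _ SB) => //; exact: wdiv_L2.
have L2' : L2 D (wdiv D (f n) - u) by exact: (semi_innerB _ _ SB).
rewrite E1// (semi_innerC _ _ SB)// E1//.
by move: h1 h2; move: (ip _ _ _) (ipv _ _ _) => *; lra.
Qed.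

(** Replaces the approximating sequence by approximation within [e] in the squared norm, the shape
    required by [sclosed]. *)
Lemma H10P u : H10 D u <-> H1 D u /\
  forall e, 0 < e -> exists2 phi, testfun D phi & ipH1 D (u - phi) (u - phi) < e.
Proof.
split=> [[Hu [phi [tphi lim]]]|[Hu H]].
  split=> // e e0; have se0 : 0 < Num.sqrt e by rewrite sqrtr_gt0.
  have /cvgrPdist_lt/(_ _ se0)[N _ HN] := lim.
  exists (phi N) => //; have := HN N (leqnn N).
  have Hd : H1 D (u - phi N).
    by apply: (semi_innerB _ _ SH) => //; exact: testfun_H1.
  rewrite /= sub0r normrN normH1E ger0_norm ?snorm_ge0//.
  by rewrite (snorm_lt _ _ SH)// sqr_sqrtr// ltW.
split=> //.
have /choice[phi Hphi] : forall n, exists phi, testfun D phi /\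
    ipH1 D (u - phi) (u - phi) < n.+1%:R^-1 ^+ 2.
  by move=> n; have [|phi t h] := H (n.+1%:R^-1 ^+ 2); [by rewrite exprn_gt0// invr_gt0|exists phi].
exists phi; split => [n|]; first by have [] := Hphi n.
apply/cvgrPdist_lt => e /ltr_add_invr[N]; rewrite add0r => Ne.
exists N => // n /= Nn; rewrite sub0r normrN normH1E ger0_norm ?snorm_ge0//.
have [t h] := Hphi n.
have Hd : H1 D (u - phi n).
  by apply: (semi_innerB _ _ SH) => //; exact: testfun_H1.
apply: lt_le_trans (ltW Ne); rewrite (snorm_lt _ _ SH)//.
apply: lt_le_trans h _; rewrite lerXn2r ?nnegrE ?invr_ge0//.
by rewrite lef_pV2 ?posrE ?ltr0n// ler_nat.
Qed.

Lemma testfun_H10 phi : testfun D phi -> H10 D phi.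
Proof.
move=> tphi; apply/H10P; split; first exact: testfun_H1.
move=> e e0; exists phi => //; rewrite subrr.
have H0 := semi_inner_nonempty _ _ SH.
by rewrite (linear_on0 _ _ SH _ (semi_inner_linear_onl _ _ SH _ H0)).
Qed.

Lemma H10_lin (c : R) u v : H10 D u -> H10 D v -> H10 D (c *: u + v).
Proof.
move=> /H10P[Hu au] /H10P[Hv av]; apply/H10P; split; first exact: (semi_inner_lin _ _ SH).
move=> e e0; pose se := Num.sqrt e.
have se0 : 0 < se by rewrite sqrtr_gt0.
pose k := `|c| + 1; have k0 : 0 < k by rewrite /k ltr_wpDl.
have [phi tphi hphi] := au ((se / 2 / k) ^+ 2) ltac:(by rewrite exprn_gt0// !divr_gt0).
have [psi tpsi hpsi] := av ((se / 2) ^+ 2) ltac:(by rewrite exprn_gt0// !divr_gt0).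
exists (c *: phi + psi); first exact: testfun_lin.
have Hphi : H1 D (u - phi) by apply: (semi_innerB _ _ SH) => //; exact: testfun_H1.
have Hpsi : H1 D (v - psi) by apply: (semi_innerB _ _ SH) => //; exact: testfun_H1.
have -> : c *: u + v - (c *: phi + psi) = c *: (u - phi) + (v - psi).
  by rewrite scalerBr opprD addrACA.
have -> : e = se ^+ 2 by rewrite sqr_sqrtr// ltW.
have Hcphi : H1 D (c *: (u - phi)) by exact: (semi_innerZ _ _ SH).
rewrite -(snorm_lt _ _ SH)//; last exact: (semi_innerD _ _ SH).
apply: le_lt_trans (ler_snormD _ _ SH _ _ _ _) _ => //.
rewrite (snormZ _ _ SH)//.
move: hphi; rewrite -(snorm_lt _ _ SH) ?divr_gt0// ltr_pdivlMr// => hphi.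
move: hpsi; rewrite -(snorm_lt _ _ SH) ?divr_gt0// => hpsi.
have := snorm_ge0 (ipH1 D) (u - phi); move: hphi hpsi; rewrite /k.
by move: se0; move: se (snorm _ _) (snorm _ _) `|c| => *; nra.
Qed.

Lemma H10_closed : sclosed (H1 D) (ipH1 D) (H10 D).
Proof.
move=> u Hu H; apply/H10P; split=> // e e0.
have e4 : 0 < e / 4 by rewrite divr_gt0.
have [v /H10P[Hv av] uv] := H _ e4.
have [phi tphi vphi] := av _ e4; exists phi => //.
have Huv : H1 D (u - v) by exact: (semi_innerB _ _ SH).
have Hvp : H1 D (v - phi) by apply: (semi_innerB _ _ SH) => //; exact: testfun_H1.
have -> : u - phi = u - v + 1 *: (v - phi) by rewrite scale1r addrA subrK.
rewrite (semi_innerDD _ _ SH)//.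
(* The difference of the two errors has nonnegative square, which bounds the cross term: the square
   of a sum is at most twice the sum of the squares, here below [e]. *)
have := semi_innerDD _ _ SH (-1) _ _ Huv Hvp.
have : 0 <= ipH1 D (u - v + -1 *: (v - phi)) (u - v + -1 *: (v - phi)).
  by apply: (semi_inner_ge0 _ _ SH); apply: (semi_innerD _ _ SH) => //; exact: (semi_innerZ _ _ SH).
rewrite expr1n sqrrN expr1n; move: vphi uv.
move: (ipH1 D (u - v + _) _) (ipH1 D (u - v) _) (ipH1 D (u - v) _) (ipH1 D (v - phi) _).
by move=> *; lra.
Qed.

Lemma H10_0 : H10 D 0.
Proof. exact/testfun_H10/testfun0. Qed.

Lemma ntrace_testfun q phi : Hdiv D q -> testfun D phi -> ntrace D q phi = 0.
Proof.
move=> Hq tphi; have [Lq _] := Hq; rewrite /ntrace.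
have Lg := testfun_cgrad_L2v oD tphi.
rewrite (semi_innerC _ _ SV)//; last by apply: grad_L2v; exact: testfun_H1.
rewrite (gradE oD (testfun_L2 mD tphi) (testfun_is_wgrad oD tphi) Lq).
rewrite (semi_innerC _ _ SV)//.
by have [_ ->] := wdivP Hq; rewrite // addNr.
Qed.

Lemma ntrace_lin q : Hdiv D q -> linear_on (H1 D) (ntrace D q).
Proof.
move=> Hq c u v Hu Hv; have [Lq _] := Hq; rewrite /ntrace.
have [Lu _] := Hu; have [Lv _] := Hv.
have Lgu := grad_L2v Hu; have Lgv := grad_L2v Hv.
rewrite (semi_innerC _ _ SV _ _ Lq (grad_L2v (H1_lin oD c Hu Hv))).
rewrite grad_lin// (semi_inner_linear_onr _ _ SB _ (wdiv_L2 Hq))//.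
rewrite (semi_innerC _ _ SV _ q)// (semi_innerC _ _ SV _ q)//.
by move: (ipv _ _ _) (ipv _ _ _) (ip _ _ _) (ip _ _ _) => *; ring.
Qed.

(** Cauchy-Schwarz in L2 for each of the two terms, then in R^2 for the sum of the products. The
    constant 1 is what later gives the summand 1 in the continuity bound of the forms. *)
Lemma ntrace_le q u : Hdiv D q -> H1 D u ->
  `|ntrace D q u| <= normHdiv D q * normH1 D u.
Proof.
move=> Hq Hu; have [Lq _] := Hq; have [Lu _] := Hu.
have Lg := grad_L2v Hu; have Lw := wdiv_L2 Hq.
have c1 := semi_inner_CS _ _ SV _ _ Lq Lg.
have c2 := semi_inner_CS _ _ SB _ _ Lw Lu.
rewrite normHdivE normH1E /snorm -sqrtrM; last exact: (semi_inner_ge0 _ _ SD).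
rewrite -sqrtr_sqr ler_wsqrtr//.
have a0 := snorm_ge0 (ipv D) q; have b0 := snorm_ge0 (ipv D) (grad D u).
have c0 := snorm_ge0 (ip D) (wdiv D q); have d0 := snorm_ge0 (ip D) u.
rewrite /ipHdiv /ipH1 -!(sqr_snorm _ _ SV)// -!(sqr_snorm _ _ SB)//.
move: a0 b0 c0 d0 c1 c2; rewrite /ntrace.
move: (snorm _ _) (snorm _ _) (snorm _ _) (snorm _ _) (ipv D q _) (ip D _ u).
move=> e c b a x y a0 b0 c0 e0 xab yce.
have H : `|x + y| <= a * b + c * e by apply: le_trans (ler_normD _ _) _; exact: lerD.
have -> : (x + y) ^+ 2 = `|x + y| ^+ 2 by rewrite real_normK ?num_real.
have h0 : 0 <= a * b + c * e by apply: addr_ge0; exact: mulr_ge0.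
apply: le_trans (_ : (a * b + c * e) ^+ 2 <= _); first by rewrite lerXn2r ?nnegrE.
have := sqr_ge0 (a * e - b * c); nra.
Qed.

(** On test functions this is the definition of the weak divergence; density and [ntrace_le] extend
    it. *)
Lemma ntrace_H10 q u : Hdiv D q -> H10 D u -> ntrace D q u = 0.
Proof.
move=> Hq /H10P[Hu au].
apply: (@ler0_small _ (normHdiv D q)) => [|e e0]; first exact: sqrtr_ge0.
have [phi tphi h] := au (e ^+ 2) ltac:(by rewrite exprn_gt0).
have Hphi := testfun_H1 oD tphi.
have Hd : H1 D (u - phi) by exact: (semi_innerB _ _ SH).
have -> : ntrace D q u = ntrace D q (u - phi).
  by rewrite (linear_onB _ _ SH _ _ _ (ntrace_lin Hq))// (ntrace_testfun Hq tphi) subr0.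
apply: le_trans (ntrace_le Hq Hd) _; rewrite mulrC; apply: ler_wpM2r.
  exact: sqrtr_ge0.
by rewrite normH1E ltW// (snorm_lt _ _ SH).
Qed.

Lemma ntrace_Hm12 q : Hdiv D q -> Hm12 D (ntrace D q).
Proof.
move=> Hq; split.
- exact: ntrace_lin.
- by move=> u; exact: ntrace_H10.
- by exists (normHdiv D q) => u Hu; exact: ntrace_le.
Qed.

End fixed_domain.

Section subdomain.
Context (D D' : set E) (oD : open D) (oD' : open D') (DD : D' `<=` D).

Let mD' : measurable D' := open_measurable_rV oD'.

Lemma is_wgrad_sub u p : is_wgrad D u p -> is_wgrad D' u p.
Proof.
move=> [Lp H]; split; first exact: L2v_sub Lp.
move=> phi tphi i.
rewrite (ip_sub _ DD); last by move=> x; exact: testfun_out (testfun_partial i tphi).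
rewrite (ip_sub _ DD); last by move=> x; exact: testfun_out tphi.
by apply: H; exact: testfun_sub tphi.
Qed.

Lemma is_wdiv_sub q u : is_wdiv D q u -> is_wdiv D' q u.
Proof.
move=> [Lu H]; split; first exact: L2_sub Lu.
move=> phi tphi.
rewrite (ipv_sub _ DD); last first.
  by move=> x nx; apply/rowP => i; rewrite !mxE; exact: testfun_out (testfun_partial i tphi) nx.
rewrite (ip_sub _ DD); last by move=> x; exact: testfun_out tphi.
by apply: H; exact: testfun_sub tphi.
Qed.

Lemma H1_sub u : H1 D u -> H1 D' u.
Proof.
move=> Hu; apply: is_wgrad_H1 (is_wgrad_sub (gradP Hu)).
by have [Lu _] := Hu; exact: L2_sub Lu.
Qed.

Lemma Hdiv_sub q : Hdiv D q -> Hdiv D' q.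
Proof.
move=> Hq; apply: is_wdiv_Hdiv (is_wdiv_sub (wdivP Hq)).
by have [Lq _] := Hq; exact: L2v_sub Lq.
Qed.

Lemma grad_sub u r : H1 D u -> L2v D' r -> ipv D' (grad D' u) r = ipv D' (grad D u) r.
Proof.
move=> Hu Lr; apply: gradE => //; last exact: is_wgrad_sub (gradP Hu).
by have [Lu _] := Hu; exact: L2_sub Lu.
Qed.

Lemma wdiv_sub q w : Hdiv D q -> L2 D' w -> ip D' (wdiv D' q) w = ip D' (wdiv D q) w.
Proof.
move=> Hq Lw; apply: wdivE => //; last exact: is_wdiv_sub (wdivP Hq).
by have [Lq _] := Hq; exact: L2v_sub Lq.
Qed.

End subdomain.

End sobolev_complete.

(** * Broken spaces on a mesh *)

Section local_spaces.
Context {R : realType} {d : nat}.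
Local Notation E := 'rV[R]_d.
Local Notation leb := (@lebesgue_rV R d).
Implicit Types (D : set E) (u v w phi : E -> R) (p q r : E -> E).

Lemma ae_eq_on D (W : Type) (f g : E -> W) : (forall x, D x -> f x = g x) ->
  f = g %[ae leb in D].
Proof. by move=> fg; apply: aeW => x Dx; exact: fg. Qed.

Lemma is_wgrad_ae D u u' p : open D -> L2 D u -> L2 D u' ->
  u = u' %[ae leb in D] -> is_wgrad D u p -> is_wgrad D u' p.
Proof.
move=> oD Lu Lu' uu [Lp H]; split=> // phi tphi i; rewrite -H//.
apply: ae_ip => //; last by apply: filterS uu => x h Dx; rewrite h.
exact: testfun_L2 (open_measurable_rV oD) (testfun_partial i tphi).
Qed.

(** Both functions have the same set of weak gradients, and [xget] depends on that set alone. The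
    equality is therefore literal, not merely almost everywhere. *)
Lemma grad_ae D u u' : open D -> L2 D u -> L2 D u' ->
  u = u' %[ae leb in D] -> grad D u = grad D u'.
Proof.
move=> oD Lu Lu' uu; rewrite /grad; congr (xget 0 _); apply/seteqP; split => p /=.
  exact: is_wgrad_ae.
by apply: is_wgrad_ae => //; apply: filterS uu => x h Dx; rewrite h.
Qed.

Lemma H1_ae D u u' : open D -> L2 D u' -> u = u' %[ae leb in D] -> H1 D u -> H1 D u'.
Proof.
move=> oD Lu' uu Hu; apply: is_wgrad_H1 (is_wgrad_ae oD _ Lu' uu (gradP Hu)) => //.
by have [] := Hu.
Qed.

Lemma H1_eq_on D u u' : open D -> (forall x, D x -> u x = u' x) -> H1 D u -> H1 D u'.
Proof.
move=> oD uu Hu; have [Lu _] := Hu.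
by apply: H1_ae Hu => //; [exact: L2_eq_on Lu|exact: ae_eq_on].
Qed.

Lemma grad_eq_on D u u' : open D -> L2 D u -> (forall x, D x -> u x = u' x) ->
  grad D u = grad D u'.
Proof.
by move=> oD Lu uu; apply: grad_ae => //; [exact: L2_eq_on Lu|exact: ae_eq_on].
Qed.

Lemma ipH1_eq_on D u u' : open D -> H1 D u -> (forall x, D x -> u x = u' x) ->
  ipH1 D u u = ipH1 D u' u'.
Proof.
move=> oD [Lu _] uu; rewrite /ipH1 (grad_eq_on oD Lu uu); congr (_ + _).
exact: ip_eq_on.
Qed.

Lemma ipv_eq_on D p p' q q' : (forall x, D x -> p x = p' x) ->
  (forall x, D x -> q x = q' x) -> ipv D p q = ipv D p' q'.
Proof.
move=> pp qq; apply: eq_Rintegral => x /set_mem Dx.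
by rewrite pp// qq.
Qed.

Lemma L2v_eq_on D p p' : (forall x, D x -> p x = p' x) -> L2v D p -> L2v D p'.
Proof. by move=> pp Lp i; apply: L2_eq_on (Lp i) => x Dx; rewrite pp. Qed.

Lemma is_wdiv_eq_on D q q' u : (forall x, D x -> q x = q' x) ->
  is_wdiv D q u -> is_wdiv D q' u.
Proof.
move=> qq [Lu H]; split => // phi tphi; rewrite -H//.
by apply: ipv_eq_on => // x Dx; rewrite qq.
Qed.

Lemma wdiv_eq_on D q q' : (forall x, D x -> q x = q' x) -> wdiv D q = wdiv D q'.
Proof.
move=> qq; rewrite /wdiv; congr (xget 0 _); apply/seteqP; split => u /=.
  exact: is_wdiv_eq_on.
by apply: is_wdiv_eq_on => x Dx; rewrite qq.
Qed.

Lemma Hdiv_eq_on D q q' : (forall x, D x -> q x = q' x) -> Hdiv D q -> Hdiv D q'.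
Proof.
move=> qq Hq; have [Lq _] := Hq.
by apply: is_wdiv_Hdiv (is_wdiv_eq_on qq (wdivP Hq)); exact: L2v_eq_on Lq.
Qed.

Lemma ipHdiv_eq_on D q q' : (forall x, D x -> q x = q' x) ->
  ipHdiv D q q = ipHdiv D q' q'.
Proof. by move=> qq; rewrite /ipHdiv (wdiv_eq_on qq) (ipv_eq_on qq qq). Qed.

Lemma H10_eq_on D u u' : open D -> (forall x, D x -> u x = u' x) ->
  H10 D u -> H10 D u'.
Proof.
move=> oD uu /(H10P oD)[Hu H]; apply/(H10P oD); split; first exact: H1_eq_on Hu.
move=> e /H[phi tphi h]; exists phi; first exact: tphi.
have Hd : H1 D (u - phi).
  exact: (semi_innerB _ _ (H1_semi_inner oD) _ _ Hu (testfun_H1 oD tphi)).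
have uup x : D x -> (u - phi) x = (u' - phi) x by move=> Dx; rewrite !fctE uu.
by rewrite -(ipH1_eq_on oD Hd uup); exact: h.
Qed.

End local_spaces.

Section mesh.
Context {R : realType} {d : nat} (Om : set 'rV[R]_d) (oOm : open Om).
Context (N : nat) (T : 'I_N -> set 'rV[R]_d) (hT : is_mesh Om T).
Local Notation E := 'rV[R]_d.
Local Notation leb := (@lebesgue_rV R d).
Implicit Types (u v w phi : E -> R) (p q r : E -> E).

Lemma mesh_open i : open (T i).
Proof. by have [/(_ i)[_ _ []]] := hT. Qed.

Lemma mesh_sub i : T i `<=` Om.
Proof. by have [/(_ i)[]] := hT. Qed.

Let oT := mesh_open.
Let TOm := mesh_sub.
Let mT i : measurable (T i) := open_measurable_rV (@mesh_open i).
Let mOm : measurable Om := open_measurable_rV oOm.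

Lemma mesh_disjoint i j x : T i x -> T j x -> i = j.
Proof.
move=> Tix Tjx; have [_ tT _] := hT.
by apply: tT => //; exists x.
Qed.

(** A point of [Om] lies in the closure of some element; if it is not in that open element, it is on
    its boundary, which is a null set. *)
Lemma mesh_ae : {ae leb, forall x, Om x -> exists i, T i x}.
Proof.
have [HT _ cT] := hT.
have H i : {ae leb, forall x, ~ bdry (T i) x}.
  have [_ _ [oTi bTi lTi]] := HT i.
  have mb : measurable (bdry (T i)).
    apply: closed_measurable_rV; rewrite /bdry setDE; apply: closedI.
      exact: closed_closure.
    exact/open_closedC/open_interior.
  exists (bdry (T i)); split => //; first exact: lebesgue_rV_bdry0.
  by move=> x /= /contrapT.
have : {ae leb, forall x, forall n (i : 'I_N), i = n :> nat -> ~ bdry (T i) x}.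
  apply: ae_foralln => n.
  have [h|h] := ltnP n N; last first.
    by apply: aeW => x i iN; have := ltn_ord i; rewrite iN ltnNge h.
  by apply: filterS (H (Ordinal h)) => x Hx i /= iN; rewrite (_ : i = Ordinal h)//; exact/val_inj.
apply: filterS => x Hx Omx.
have : (\bigcup_i closure (T i)) x by rewrite cT; exact: subset_closure.
move=> [i _ cl]; exists i; apply: contrapT => nT; apply: (Hx i i erefl).
split => // int; apply: nT; exact: interior_subset int.
Qed.

Lemma integral_sum_mesh (f : 'I_N -> E -> R) :
  (forall i, leb.-integrable setT (EFin \o f i)) ->
  leb.-integrable setT (EFin \o (fun x => \sum_i f i x)) /\
  \int[leb]_x (\sum_i f i x) = \sum_i \int[leb]_x f i x.
Proof.
move=> fi; elim: (index_enum _) => [|i s [IHi IHe]].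
  rewrite big_nil; split.
    rewrite (_ : EFin \o _ = cst 0%E); first exact: integrable0.
    by apply/funext => x; rewrite /= big_nil.
  rewrite (eq_Rintegral _ (g := cst 0)); last by move=> x _; rewrite big_nil.
  by rewrite /Rintegral integral0.
split.
  have := integrableD measurableT (fi i) IHi.
  by apply: eq_integrable => // x _; rewrite /= big_cons EFinD.
rewrite big_cons -IHe -RintegralD//.
by apply: eq_Rintegral => x _; rewrite big_cons.
Qed.

Lemma ip_mesh u v : L2 Om u -> L2 Om v -> ip Om u v = \sum_i ip (T i) u v.
Proof.
move=> Lu Lv.
have LT w i : L2 Om w -> L2 (T i) w by move=> Lw; exact: L2_sub Lw.
have [I1 E1] := integral_sum_mesh (fun i => L2_integrableM (LT _ i Lu) (LT _ i Lv)).
under eq_bigr do rewrite ipE.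
rewrite -E1 ipE; congr fine; apply: ae_eq_integral => //.
- by have /integrableP[] := L2_integrableM Lu Lv.
- by have /integrableP[] := I1.
have A := mesh_ae; apply: filterS A => x Hx _; congr (_%:E).
rewrite /zext /patch; have [Omx|nOmx] := pselect (Om x); last first.
  rewrite memNset// mul0r big1// => i _; rewrite memNset ?mul0r// => /TOm.
  exact: nOmx.
have [i Tix] := Hx Omx; rewrite mem_set// (bigD1 i)//= mem_set// big1 ?addr0//.
move=> j ji; rewrite memNset ?mul0r// => Tjx.
by rewrite (mesh_disjoint Tix Tjx) eqxx in ji.
Qed.

Lemma ipv_mesh p q : L2v Om p -> L2v Om q -> ipv Om p q = \sum_i ipv (T i) p q.
Proof.
move=> Lp Lq; rewrite ipvE//.
transitivity (\sum_i \sum_j ip (T i) (cmp p j) (cmp q j)); last first.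
  apply: eq_bigr => i _; apply/esym/ipvE.
    exact: (L2v_sub (mT i) (@TOm i) Lp).
  exact: (L2v_sub (mT i) (@TOm i) Lq).
rewrite exchange_big/=; apply: eq_bigr => j _.
exact: ip_mesh (Lp j) (Lq j).
Qed.

Lemma piecewise_on (W : nmodType) (g : 'I_N -> E -> W) i x : T i x ->
  piecewise T g x = g i x.
Proof.
move=> Tix; rewrite /piecewise (bigD1 i)//= {1}/patch mem_set// big1 ?addr0//.
move=> j ji; rewrite /patch memNset// => Tjx.
by rewrite (mesh_disjoint Tix Tjx) eqxx in ji.
Qed.

Lemma piecewise_L2 (g : 'I_N -> E -> R) : (forall i, L2 (T i) (g i)) ->
  L2 Om (piecewise T g).
Proof.
move=> Lg; rewrite /L2/=.
have -> : patch (fun=> 0) Om (piecewise T g) = \sum_i zext (T i) (g i).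
  apply/funext => x; rewrite fct_sumE /patch.
  have [Omx|nOmx] := pselect (Om x); first by rewrite mem_set.
  rewrite memNset// big1// => i _; rewrite /zext /patch memNset// => /TOm.
  exact: nOmx.
elim/big_ind : _ => [|f h Lf Lh|i _]; last exact: Lg.
- exact: Lfun2_0.
- by rewrite -[f]scale1r; exact: Lfun2_lin.
Qed.

Lemma piecewise_L2v (g : 'I_N -> E -> E) : (forall i, L2v (T i) (g i)) ->
  L2v Om (piecewise T g).
Proof.
move=> Lg j; have := @piecewise_L2 (fun i => cmp (g i) j) (fun i => Lg i j).
rewrite (_ : piecewise _ _ = fun x => piecewise T g x ord0 j)//.
apply/funext => x; rewrite /piecewise summxE; apply: eq_bigr => i _.
by rewrite /patch /cmp; case: ifP => // _; rewrite mxE.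
Qed.

Lemma gradT_L2v v : (forall i, H1 (T i) v) -> L2v Om (gradT T v).
Proof. by move=> Hv; apply: piecewise_L2v => i; exact: grad_L2v. Qed.

Lemma divT_L2 q : (forall i, Hdiv (T i) q) -> L2 Om (divT T q).
Proof. by move=> Hq; apply: piecewise_L2 => i; exact: wdiv_L2. Qed.

Lemma ipv_gradT r v : L2v Om r -> (forall i, H1 (T i) v) ->
  ipv Om r (gradT T v) = \sum_i ipv (T i) r (grad (T i) v).
Proof.
move=> Lr Hv; rewrite ipv_mesh//; last exact: gradT_L2v.
by apply: eq_bigr => i _; apply: ipv_eq_on => // x Tix; rewrite /gradT (piecewise_on _ Tix).
Qed.

Lemma ip_divT w q : L2 Om w -> (forall i, Hdiv (T i) q) ->
  ip Om w (divT T q) = \sum_i ip (T i) w (wdiv (T i) q).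
Proof.
move=> Lw Hq; rewrite ip_mesh//; last exact: divT_L2.
by apply: eq_bigr => i _; apply: ip_eq_on => // x Tix; rewrite /divT (piecewise_on _ Tix).
Qed.

Lemma ipV_mesh (v w : Vspace) : inV Om T v -> inV Om T w ->
  ipV Om T v w = \sum_i (ipH1 (T i) v.1 w.1 + ipHdiv (T i) v.2 w.2).
Proof.
move=> [Lv1 Hv1 Lv2 Hv2] [Lw1 Hw1 Lw2 Hw2].
rewrite /ipV ip_mesh// ipv_gradT//; last exact: gradT_L2v.
rewrite [ipv Om v.2 _]ipv_mesh// ip_divT//; last exact: divT_L2.
rewrite -!big_split/=; apply: eq_bigr => i _.
rewrite /ipH1 /ipHdiv -addrA; congr (_ + _ + (_ + _)).
  by apply: ipv_eq_on => // x Tix; rewrite /gradT (piecewise_on _ Tix).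
by apply: ip_eq_on => // x Tix; rewrite /divT (piecewise_on _ Tix).
Qed.

Lemma H1_mesh u i : H1 Om u -> H1 (T i) u.
Proof. exact: H1_sub. Qed.

Lemma Hdiv_mesh q i : Hdiv Om q -> Hdiv (T i) q.
Proof. exact: Hdiv_sub. Qed.

Lemma ipv_gradT_conf r u : L2v Om r -> H1 Om u ->
  ipv Om r (gradT T u) = ipv Om r (grad Om u).
Proof.
move=> Lr Hu; rewrite ipv_gradT//; last by move=> i; exact: H1_mesh.
rewrite ipv_mesh//; last exact: grad_L2v; apply: eq_bigr => i _.
have SV := L2v_semi_inner (T i).
have LrT : L2v (T i) r by exact: L2v_sub Lr.
have Hi := H1_mesh i Hu.
rewrite (semi_innerC _ _ SV _ _ LrT (grad_L2v Hi)).
have Lg : L2v (T i) (grad Om u) := L2v_sub (mT i) (@TOm i) (grad_L2v Hu).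
by rewrite (grad_sub (@mesh_open i) (@mesh_sub i) Hu LrT) (semi_innerC _ _ SV _ _ Lg LrT).
Qed.

Lemma ip_divT_conf w q : L2 Om w -> Hdiv Om q ->
  ip Om w (divT T q) = ip Om w (wdiv Om q).
Proof.
move=> Lw Hq; rewrite ip_divT//; last by move=> i; exact: Hdiv_mesh.
rewrite ip_mesh//; last exact: wdiv_L2; apply: eq_bigr => i _.
have SB := L2_semi_inner (T i).
have LwT : L2 (T i) w by exact: L2_sub Lw.
have Hi := Hdiv_mesh i Hq.
rewrite (semi_innerC _ _ SB _ _ LwT (wdiv_L2 Hi)).
have Lg : L2 (T i) (wdiv Om q) := L2_sub (mT i) (@TOm i) (wdiv_L2 Hq).
by rewrite (wdiv_sub (@mesh_open i) (@mesh_sub i) Hq LwT) (semi_innerC _ _ SB _ _ Lg LwT).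
Qed.

End mesh.

Arguments mesh_open {R d Om N T} hT i : rename.
Arguments mesh_sub {R d Om N T} hT i : rename.

Section mesh_spaces.
Context {R : realType} {d : nat} (Om : set 'rV[R]_d) (oOm : open Om).
Context (N : nat) (T : 'I_N -> set 'rV[R]_d) (hT : is_mesh Om T).
Local Notation E := 'rV[R]_d.
Local Notation leb := (@lebesgue_rV R d).
Implicit Types (u v w phi : E -> R) (p q r : E -> E).

Let mT i : measurable (T i) := open_measurable_rV (mesh_open hT i).
Let mOm : measurable Om := open_measurable_rV oOm.
Let SB D := @L2_semi_inner R d D.
Let SV D := @L2v_semi_inner R d D.
Let SH i := H1_semi_inner (mesh_open hT i).
Let SD i := Hdiv_semi_inner (mesh_open hT i).

Lemma inV_lin (c : R) (v w : Vspace) : inV Om T v -> inV Om T w ->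
  inV Om T (c *: v + w).
Proof.
move=> [Lv1 Hv1 Lv2 Hv2] [Lw1 Hw1 Lw2 Hw2]; split.
- exact: (semi_inner_lin _ _ (SB Om)).
- by move=> i; exact: (H1_lin (mesh_open hT i)).
- exact: L2v_lin.
- by move=> i; exact: (Hdiv_lin (mesh_open hT i)).
Qed.

Lemma V_semi_inner : semi_inner (inV Om T) (ipV Om T).
Proof.
split.
- split.
  + exact: (semi_inner_nonempty _ _ (SB Om)).
  + by move=> i; exact: (semi_inner_nonempty _ _ (SH i)).
  + exact: (semi_inner_nonempty _ _ (SV Om)).
  + by move=> i; exact: (semi_inner_nonempty _ _ (SD i)).
- exact: inV_lin.
- move=> v w Vv Vw; rewrite (ipV_mesh hT Vv Vw) (ipV_mesh hT Vw Vv).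
  apply: eq_bigr => i _.
  have [_ Hv1 _ Hv2] := Vv; have [_ Hw1 _ Hw2] := Vw.
  by rewrite (semi_innerC _ _ (SH i) _ _ (Hv1 i) (Hw1 i)) (semi_innerC _ _ (SD i) _ _ (Hv2 i) (Hw2 i)).
- move=> c u v w Vu Vv Vw; rewrite (ipV_mesh hT (@inV_lin c u v Vu Vv) Vw).
  rewrite (ipV_mesh hT Vu Vw) (ipV_mesh hT Vv Vw).
  have [_ Hu1 _ Hu2] := Vu; have [_ Hv1 _ Hv2] := Vv; have [_ Hw1 _ Hw2] := Vw.
  rewrite big_distrr -big_split; apply: eq_bigr => i _ /=.
  rewrite (semi_inner_linl _ _ (SH i) _ _ _ _ (Hu1 i) (Hv1 i) (Hw1 i)).
  rewrite (semi_inner_linl _ _ (SD i) _ _ _ _ (Hu2 i) (Hv2 i) (Hw2 i)).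
  by rewrite addrACA -mulrDr.
- move=> v Vv; rewrite (ipV_mesh hT Vv Vv); apply: sumr_ge0 => i _.
  have [_ Hv1 _ Hv2] := Vv.
  by rewrite addr_ge0// ?(semi_inner_ge0 _ _ (SH i))// (semi_inner_ge0 _ _ (SD i)).
Qed.

Lemma ipH1_le_ipV (v : Vspace) i : inV Om T v ->
  ipH1 (T i) v.1 v.1 <= ipV Om T v v /\ ipHdiv (T i) v.2 v.2 <= ipV Om T v v.
Proof.
move=> Vv; rewrite (ipV_mesh hT Vv Vv) (bigD1 i)//=.
have [_ Hv1 _ Hv2] := Vv.
have h j : 0 <= ipH1 (T j) v.1 v.1 by exact: (semi_inner_ge0 _ _ (SH j)).
have k j : 0 <= ipHdiv (T j) v.2 v.2 by exact: (semi_inner_ge0 _ _ (SD j)).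
have : 0 <= \sum_(j < N | j != i) (ipH1 (T j) v.1 v.1 + ipHdiv (T j) v.2 v.2).
  by apply: sumr_ge0 => j _; rewrite addr_ge0.
move: (h i) (k i); move: (ipH1 _ _ _) (ipHdiv _ _ _) (\sum_(j < N | _) _).
by move=> *; split; lra.
Qed.

(** A Cauchy sequence converges on each element in [H1] and [Hdiv]; as the elements are disjoint,
    the limits can be glued by [piecewise] without any compatibility condition. *)
Lemma V_complete : scomplete (inV Om T) (ipV Om T).
Proof.
move=> f Vf cf; have SVV := V_semi_inner.
have Vfm m n : inV Om T (f m - f n) by exact: (semi_innerB _ _ SVV).
have /choice[g Hg] : forall i, exists g, H1 (T i) g /\
    sconv (ipH1 (T i)) (fun n => (f n).1) g.
  move=> i; have cfi : scauchy (ipH1 (T i)) (fun n => (f n).1).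
    move=> e /cf[K HK]; exists K => m n Km Kn.
    exact: le_lt_trans (ipH1_le_ipV i (Vfm m n)).1 (HK _ _ Km Kn).
  have [|g Hg fg] := H1_complete (mesh_open hT i) _ cfi.
    by move=> n; have [_ ? _ _] := Vf n.
  by exists g.
have /choice[h Hh] : forall i, exists h, Hdiv (T i) h /\
    sconv (ipHdiv (T i)) (fun n => (f n).2) h.
  move=> i; have cfi : scauchy (ipHdiv (T i)) (fun n => (f n).2).
    move=> e /cf[K HK]; exists K => m n Km Kn.
    exact: le_lt_trans (ipH1_le_ipV i (Vfm m n)).2 (HK _ _ Km Kn).
  have [|h Hh fh] := Hdiv_complete (mesh_open hT i) _ cfi.
    by move=> n; have [_ _ _ ?] := Vf n.
  by exists h.
have gE i x : T i x -> g i x = piecewise T g x by move=> Tx; rewrite (piecewise_on hT _ Tx).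
have hE i x : T i x -> h i x = piecewise T h x by move=> Tx; rewrite (piecewise_on hT _ Tx).
have Vy : inV Om T (piecewise T g, piecewise T h).
  split => /=.
  - by apply: (piecewise_L2 hT) => i; have [[]] := Hg i.
  - by move=> i; apply: (H1_eq_on (mesh_open hT i) (gE i)); have [] := Hg i.
  - by apply: (piecewise_L2v hT) => i; have [[]] := Hh i.
  - by move=> i; apply: (Hdiv_eq_on (hE i)); have [] := Hh i.
exists (piecewise T g, piecewise T h) => // e e0.
(* Two contributions per element; [N + 1] in place of [N] keeps the sum strictly below [e], also for
   an empty mesh. *)
have e1 : 0 < e / (2 * (N%:R + 1)).
  by apply: divr_gt0 => //; rewrite mulr_gt0// ltr_wpDl.
have /choice[K HK] : forall i, exists K : nat, forall n, (K <= n)%N ->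
    ipH1 (T i) ((f n).1 - g i) ((f n).1 - g i) < e / (2 * (N%:R + 1)) /\
    ipHdiv (T i) ((f n).2 - h i) ((f n).2 - h i) < e / (2 * (N%:R + 1)).
  move=> i; have [_ /(_ _ e1)[K1 HK1]] := Hg i.
  have [_ /(_ _ e1)[K2 HK2]] := Hh i.
  exists (maxn K1 K2) => n; rewrite geq_max => /andP[/HK1 ? /HK2 ?].
  by split.
exists (\max_i K i)%N => n Kn; have Vd := semi_innerB _ _ SVV _ _ (Vf n) Vy.
rewrite (ipV_mesh hT Vd Vd).
apply: (@le_lt_trans _ _ (\sum_(i < N) (e / (N%:R + 1)))).
  apply: ler_sum => i _.
  have [] := HK i n (leq_trans (leq_bigmax i) Kn).
  have Hgi : H1 (T i) ((f n).1 - g i).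
    by apply: (semi_innerB _ _ (SH i)); [have [_ ? _ _] := Vf n|have [] := Hg i].
  have -> : ipH1 (T i) ((f n).1 - g i) ((f n).1 - g i) = ipH1 (T i)
      (f n - (piecewise T g, piecewise T h)).1 (f n - (piecewise T g, piecewise T h)).1.
    apply: (ipH1_eq_on (mesh_open hT i) Hgi).
    by move=> x Tx; rewrite !fctE (gE _ _ Tx).
  have -> : ipHdiv (T i) ((f n).2 - h i) ((f n).2 - h i) = ipHdiv (T i)
      (f n - (piecewise T g, piecewise T h)).2 (f n - (piecewise T g, piecewise T h)).2.
    by apply: ipHdiv_eq_on => // x Tx; rewrite !fctE (hE _ _ Tx).
  have -> : e / (N%:R + 1) = e / (2 * (N%:R + 1)) + e / (2 * (N%:R + 1)).
    by field; rewrite gt_eqF// ltr_wpDl.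
  by move: (ipH1 _ _ _) (ipHdiv _ _ _) => *; lra.
rewrite sumr_const card_ord -[_ *+ N]mulr_natl mulrCA gtr_pMr//.
by rewrite ltr_pdivrMr ?mul1r ?ltrDl// ltr_wpDl.
Qed.

Lemma ipH1_mesh u v : H1 Om u -> H1 Om v -> ipH1 Om u v = \sum_i ipH1 (T i) u v.
Proof.
move=> Hu Hv; rewrite /ipH1 big_split; congr (_ + _); first exact: (ip_mesh hT Hu.1 Hv.1).
have Lu := grad_L2v Hu; rewrite -(ipv_gradT_conf hT Lu Hv).
rewrite (ipv_gradT hT Lu); last by move=> i; exact: (H1_mesh hT).
apply: eq_bigr => i _.
by rewrite -(grad_sub (mesh_open hT i) (mesh_sub hT i) Hu)//; apply/grad_L2v/(H1_mesh hT).
Qed.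

Lemma ipHdiv_mesh p q : Hdiv Om p -> Hdiv Om q ->
  ipHdiv Om p q = \sum_i ipHdiv (T i) p q.
Proof.
move=> Hp Hq; rewrite /ipHdiv big_split; congr (_ + _); first exact: (ipv_mesh hT Hp.1 Hq.1).
have Lp := wdiv_L2 Hp; rewrite -(ip_divT_conf hT Lp Hq).
rewrite (ip_divT hT Lp); last by move=> i; exact: (Hdiv_mesh hT).
apply: eq_bigr => i _.
by rewrite -(wdiv_sub (mesh_open hT i) (mesh_sub hT i) Hp)//; apply/wdiv_L2/(Hdiv_mesh hT).
Qed.

Lemma conf_inV u p : H1 Om u -> Hdiv Om p -> inV Om T (u, p).
Proof.
move=> Hu Hp; split => /=; [exact: Hu.1| |exact: Hp.1|] => i.
  exact: (H1_mesh hT).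
exact: (Hdiv_mesh hT).
Qed.

Lemma conf_ipV u p v q : H1 Om u -> Hdiv Om p -> H1 Om v -> Hdiv Om q ->
  ipV Om T (u, p) (v, q) = ipH1 Om u v + ipHdiv Om p q.
Proof.
move=> Hu Hp Hv Hq; rewrite (ipV_mesh hT (conf_inV Hu Hp) (conf_inV Hv Hq)).
by rewrite big_split ipH1_mesh// ipHdiv_mesh.
Qed.

Lemma ipH1_mesh_le u i : H1 Om u -> ipH1 (T i) u u <= ipH1 Om u u.
Proof.
move=> Hu; rewrite ipH1_mesh// (bigD1 i)//= lerDl; apply: sumr_ge0 => j _.
by apply: (semi_inner_ge0 _ _ (SH j)); exact: (H1_mesh hT).
Qed.

Lemma ipHdiv_mesh_le q i : Hdiv Om q -> ipHdiv (T i) q q <= ipHdiv Om q q.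
Proof.
move=> Hq; rewrite ipHdiv_mesh// (bigD1 i)//= lerDl; apply: sumr_ge0 => j _.
by apply: (semi_inner_ge0 _ _ (SD j)); exact: (Hdiv_mesh hT).
Qed.

End mesh_spaces.

(** * Traces on the skeleton *)

Section mesh_traces.
Context {R : realType} {d : nat} (Om : set 'rV[R]_d) (oOm : open Om).
Context (N : nat) (T : 'I_N -> set 'rV[R]_d) (hT : is_mesh Om T).
Local Notation E := 'rV[R]_d.
Local Notation leb := (@lebesgue_rV R d).
Implicit Types (u v w phi : E -> R) (p q r : E -> E).

Let mT i : measurable (T i) := open_measurable_rV (mesh_open hT i).
Let mOm : measurable Om := open_measurable_rV oOm.
Let SB D := @L2_semi_inner R d D.
Let SV D := @L2v_semi_inner R d D.
Let SHO := H1_semi_inner oOm.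
Let SDO := Hdiv_semi_inner oOm.
Let SH i := H1_semi_inner (mesh_open hT i).
Let SD i := Hdiv_semi_inner (mesh_open hT i).

Lemma testfun_mesh phi i : testfun (T i) phi -> testfun Om phi.
Proof. exact: testfun_sub (mesh_sub hT i). Qed.

(** Test functions of different elements have disjoint supports, so the sum of the local
    approximants is a test function on [Om] that coincides with the i-th one on [T i]. *)
Lemma H10_mesh u : H1 Om u -> (forall i, H10 (T i) u) -> H10 Om u.
Proof.
move=> Hu Hi; apply/(H10P oOm); split=> // e e0.
have e1 : 0 < e / (N%:R + 1) by apply: divr_gt0 => //; rewrite ltr_wpDl.
have /choice[phi Hphi] : forall i, exists phi, testfun (T i) phi /\
    ipH1 (T i) (u - phi) (u - phi) < e / (N%:R + 1).
  move=> i; have /(H10P (mesh_open hT i))[_ /(_ _ e1)[phi tphi h]] := Hi i.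
  by exists phi.
have tsum (s : seq 'I_N) : testfun Om (\sum_(i <- s) phi i).
  elim: s => [|i s IH]; first by rewrite big_nil; exact: testfun0.
  rewrite big_cons -[phi i]scale1r; apply: testfun_lin => //.
  exact: testfun_mesh (Hphi i).1.
exists (\sum_i phi i); first exact: tsum.
have Hd : H1 Om (u - \sum_i phi i).
  apply: (semi_innerB _ _ SHO) => //.
  exact: (testfun_H1 oOm (tsum _)).
rewrite (ipH1_mesh hT Hd Hd).
apply: (@le_lt_trans _ _ (\sum_(i < N) (e / (N%:R + 1)))).
  apply: ler_sum => i _; apply: ltW.
  have Hdi : H1 (T i) (u - phi i).
    apply: (semi_innerB _ _ (SH i)); first exact: (H1_mesh hT i).
    exact: (testfun_H1 (mesh_open hT i) (Hphi i).1).
  rewrite -(ipH1_eq_on (mesh_open hT i) Hdi); first exact: (Hphi i).2.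
  move=> x Tx; rewrite !fctE fct_sumE (bigD1 i)//= big1 ?addr0// => j ji.
  apply: (testfun_out (Hphi j).1) => Tjx.
  by rewrite (mesh_disjoint hT Tjx Tx) eqxx in ji.
rewrite sumr_const card_ord -[_ *+ N]mulr_natl mulrCA gtr_pMr//.
by rewrite ltr_pdivrMr ?mul1r ?ltrDl// ltr_wpDl.
Qed.

Lemma sum_ntrace_Hdiv q v : Hdiv Om q -> L2 Om v -> (forall i, H1 (T i) v) ->
  \sum_i ntrace (T i) q v = ipv Om q (gradT T v) + ip Om (wdiv Om q) v.
Proof.
move=> Hq Lv Hv; have Lw := wdiv_L2 Hq.
rewrite (ipv_gradT hT Hq.1 Hv) (ip_mesh hT Lw Lv) -big_split.
apply: eq_bigr => i _; rewrite /ntrace; congr (_ + _).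
apply: (wdiv_sub (mesh_open hT i) (mesh_sub hT i) Hq).
by have [] := Hv i.
Qed.

Lemma sum_ntrace_H1 q w : H1 Om w -> L2v Om q -> (forall i, Hdiv (T i) q) ->
  \sum_i ntrace (T i) q w = ipv Om (grad Om w) q + ip Om w (divT T q).
Proof.
move=> Hw Lq Hq; have Lg := grad_L2v Hw.
rewrite (ip_divT hT Hw.1 Hq) (ipv_mesh hT Lg Lq) -big_split.
apply: eq_bigr => i _; rewrite /ntrace.
have [Lqi _] := Hq i; have Hwi := H1_mesh hT i Hw; have Lwq := wdiv_L2 (Hq i).
rewrite (semi_innerC _ _ (SV _) _ _ Lqi (grad_L2v Hwi)).
rewrite (grad_sub (mesh_open hT i) (mesh_sub hT i) Hw Lqi).
by rewrite (semi_innerC _ _ (SB _) _ _ Lwq Hwi.1).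
Qed.

(** Contributions from the two sides of an interface cancel for conforming [q] and [w]. With normal
    traces given by Green's formula this is additivity of the integral over the mesh. *)
Lemma ntrace_mesh q w : Hdiv Om q -> H1 Om w ->
  ntrace Om q w = \sum_i ntrace (T i) q w.
Proof.
move=> Hq Hw; rewrite (sum_ntrace_Hdiv Hq Hw.1); last by move=> i; exact: (H1_mesh hT).
by rewrite (ipv_gradT_conf hT Hq.1 Hw).
Qed.

Lemma ntrace_linl D (c : R) p q w : open D -> Hdiv D p -> Hdiv D q -> H1 D w ->
  ntrace D (c *: p + q) w = c * ntrace D p w + ntrace D q w.
Proof.
move=> oD Hp Hq Hw; rewrite /ntrace.
rewrite (semi_inner_linl _ _ (SV D) _ _ _ _ Hp.1 Hq.1 (grad_L2v Hw)).
by rewrite (wdiv_lin oD c Hp Hq Hw.1) mulrDr addrACA.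
Qed.

Lemma ntraceB D q u v : open D -> Hdiv D q -> H1 D u -> H1 D v ->
  ntrace D q (u - v) = ntrace D q u - ntrace D q v.
Proof.
move=> oD Hq Hu Hv.
exact: (linear_onB _ _ (H1_semi_inner oD) _ _ _ (ntrace_lin oD Hq) Hu Hv).
Qed.

Lemma ntrace_same_trace D q u v : open D -> Hdiv D q -> H1 D u -> H1 D v ->
  same_trace D u v -> ntrace D q u = ntrace D q v.
Proof.
move=> oD Hq Hu Hv uv; apply/eqP; rewrite -subr_eq0 -ntraceB//.
by rewrite (ntrace_H10 oD Hq uv).
Qed.

Lemma ext12_lin (c : R) uh vh w z : ext12 Om T uh w -> ext12 Om T vh z ->
  ext12 Om T (c *: uh + vh) (c *: w + z).
Proof.
move=> [Hw uw] [Hz vz]; split; first exact: (semi_inner_lin _ _ SHO).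
move=> i; rewrite /same_trace.
have -> : (c *: uh + vh) i - (c *: w + z) = c *: (uh i - w) + (vh i - z).
  by apply/funext => x; rewrite !fctE /= ; ring.
exact: (H10_lin (mesh_open hT i) c (uw i) (vz i)).
Qed.

Lemma extm12_lin (c : R) sh th p q : extm12 Om T sh p -> extm12 Om T th q ->
  extm12 Om T (c *: sh + th) (c *: p + q).
Proof.
move=> [Hp sp] [Hq tq]; split; first exact: (Hdiv_lin oOm c Hp Hq).
move=> i v Hv; rewrite (ntrace_linl c (mesh_open hT i) (Hdiv_mesh hT i Hp) (Hdiv_mesh hT i Hq) Hv).
by rewrite -sp// -tq.
Qed.

Lemma inU_lin (c : R) (u v : Uspace) : inU Om T u -> inU Om T v ->
  inU Om T (c *: u + v).
Proof.
move=> [Lu Ls [Hh [w ew]] [Hm [q eq]]] [Lu' Ls' [Hh' [w' ew']] [Hm' [q' eq']]].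
split.
- exact: (semi_inner_lin _ _ (SB Om) c _ _ Lu Lu').
- exact: (semi_inner_lin _ _ (SV Om) c _ _ Ls Ls').
- split; last by exists (c *: w + w'); exact: (ext12_lin c ew ew').
  by move=> i; exact: (semi_inner_lin _ _ (SH i) c _ _ (Hh i) (Hh' i)).
- have eqq := extm12_lin c eq eq'.
  split; last by exists (c *: q + q'); exact: eqq.
  move=> i; have [Hq Hs0] := eqq.
  have Hs x : H1 (T i) x -> U_sigmahat (c *: u + v) i x = ntrace (T i) (c *: q + q') x.
    exact: Hs0.
  have [l1 l2 [C l3]] := ntrace_Hm12 (mesh_open hT i) (Hdiv_mesh hT i Hq).
  split.
  + move=> a x y Hx Hy.
    have Hxy := semi_inner_lin _ _ (SH i) a _ _ Hx Hy.
    by rewrite (Hs _ Hxy) (Hs _ Hx) (Hs _ Hy); exact: l1.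
  + by move=> x Hx; have [Hx1 _] := Hx; rewrite (Hs _ Hx1); exact: l2.
  + by exists C => x Hx; rewrite (Hs _ Hx); exact: l3.
Qed.

Lemma inU_B (u v : Uspace) : inU Om T u -> inU Om T v -> inU Om T (u - v).
Proof.
move=> Uu Uv; have -> : u - v = -1 *: v + u by rewrite scaleN1r addrC.
exact: inU_lin.
Qed.

End mesh_traces.

Section infimum.
Context {R : realType}.

(** Carries a bound that holds for every extension over to the trace norm. The affine shape allows
    two infima to be taken one after the other. *)
Lemma ler_inf_affine (A : set R) (x c k : R) : A !=set0 -> 0 <= k ->
  (forall a, A a -> x <= c + k * a) -> x <= c + k * inf A.
Proof.
move=> [a0 Aa0]; rewrite le_eqVlt => /orP[/eqP<- H|k0 H].
  by have := H _ Aa0; rewrite !mul0r.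
have : (x - c) / k <= inf A.
  apply: lb_le_inf; first by exists a0.
  by move=> a /H h; rewrite ler_pdivrMr//; lra.
by rewrite ler_pdivrMr//; lra.
Qed.

Lemma ge0_inf (A : set R) : A !=set0 -> (forall a, A a -> 0 <= a) -> 0 <= inf A.
Proof. by move=> A0 H; apply: lb_le_inf. Qed.

Lemma inf_le_ge0 (A : set R) a : (forall b, A b -> 0 <= b) -> A a -> inf A <= a.
Proof. by move=> H Aa; apply: ge_inf => //; exists 0. Qed.

End infimum.

(** * The ultraweak form and its coercivity *)

Section ultraweak_form.
Context {R : realType} {d : nat} (Om : set 'rV[R]_d) (oOm : open Om).
Context (N : nat) (T : 'I_N -> set 'rV[R]_d) (hT : is_mesh Om T).
Local Notation E := 'rV[R]_d.
Local Notation leb := (@lebesgue_rV R d).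
Implicit Types (w phi : E -> R) (p q r : E -> E).

Let mT i : measurable (T i) := open_measurable_rV (mesh_open hT i).
Let mOm : measurable Om := open_measurable_rV oOm.
Let SB D := @L2_semi_inner R d D.
Let SV D := @L2v_semi_inner R d D.
Let SHO := H1_semi_inner oOm.
Let SDO := Hdiv_semi_inner oOm.
Let SH i := H1_semi_inner (mesh_open hT i).
Let SD i := Hdiv_semi_inner (mesh_open hT i).
Let SW := V_semi_inner hT.

Lemma sum_sigmahat (u : Uspace) q v : extm12 Om T (U_sigmahat u) q ->
  L2 Om v -> (forall i, H1 (T i) v) ->
  \sum_i U_sigmahat u i v = ipv Om q (gradT T v) + ip Om (wdiv Om q) v.
Proof.
move=> [Hq Hs] Lv Hv; rewrite -(sum_ntrace_Hdiv hT Hq Lv Hv).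
by apply: eq_bigr => i _; rewrite Hs.
Qed.

Lemma sum_uhat (u : Uspace) w p : inU Om T u -> ext12 Om T (U_uhat u) w ->
  L2v Om p -> (forall i, Hdiv (T i) p) ->
  \sum_i ntrace (T i) p (U_uhat u i) = ipv Om (grad Om w) p + ip Om w (divT T p).
Proof.
move=> [_ _ [Hu _] _] [Hw uw] Lp Hp; rewrite -(sum_ntrace_H1 hT Hw Lp Hp).
apply: eq_bigr => i _.
exact: (ntrace_same_trace (mesh_open hT i) (Hp i) (Hu i) (H1_mesh hT i Hw) (uw i)).
Qed.

(** [w] and [q] are arbitrary extensions rather than those picked by [xget]; this freedom lets the
    coercivity estimates insert minimal extensions. *)
Lemma bformE (u : Uspace) w q (v : Vspace) : inU Om T u ->
  ext12 Om T (U_uhat u) w -> extm12 Om T (U_sigmahat u) q -> inV Om T v ->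
  bform Om T u v =
    ipv Om (U_sigma u) (gradT T v.1) + ip Om (U_u u) v.1
    - (ipv Om q (gradT T v.1) + ip Om (wdiv Om q) v.1)
    + ipv Om (U_sigma u) v.2 + ip Om (U_u u) (divT T v.2)
    - (ipv Om (grad Om w) v.2 + ip Om w (divT T v.2)).
Proof.
move=> Uu ew eq [Lv1 Hv1 Lv2 Hv2].
by rewrite /bform (sum_sigmahat eq Lv1 Hv1) (sum_uhat Uu ew Lv2 Hv2).
Qed.

Lemma ipv_gradT_lin (c : R) r v v' : L2v Om r -> (forall i, H1 (T i) v) ->
  (forall i, H1 (T i) v') ->
  ipv Om r (gradT T (c *: v + v')) =
  c * ipv Om r (gradT T v) + ipv Om r (gradT T v').
Proof.
move=> Lr Hv Hv'; rewrite (ipv_gradT hT Lr Hv) (ipv_gradT hT Lr Hv').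
have Hvv i := H1_lin (mesh_open hT i) c (Hv i) (Hv' i).
rewrite (ipv_gradT hT Lr Hvv) big_distrr -big_split.
apply: eq_bigr => i _ /=.
have Lri : L2v (T i) r := L2v_sub (mT i) (mesh_sub hT i) Lr.
rewrite (semi_innerC _ _ (SV _) _ _ Lri (grad_L2v (Hvv i))).
rewrite (grad_lin (mesh_open hT i) c (Hv i) (Hv' i) Lri).
by rewrite (semi_innerC _ _ (SV _) _ _ Lri (grad_L2v (Hv i)))
  (semi_innerC _ _ (SV _) _ _ Lri (grad_L2v (Hv' i))).
Qed.

Lemma ip_divT_lin (c : R) (r : E -> R) q q' : L2 Om r -> (forall i, Hdiv (T i) q) ->
  (forall i, Hdiv (T i) q') ->
  ip Om r (divT T (c *: q + q')) =
  c * ip Om r (divT T q) + ip Om r (divT T q').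
Proof.
move=> Lr Hv Hv'; rewrite (ip_divT hT Lr Hv) (ip_divT hT Lr Hv').
have Hvv i := Hdiv_lin (mesh_open hT i) c (Hv i) (Hv' i).
rewrite (ip_divT hT Lr Hvv) big_distrr -big_split.
apply: eq_bigr => i _ /=.
have Lri : L2 (T i) r := L2_sub (mT i) (mesh_sub hT i) Lr.
rewrite (semi_innerC _ _ (SB _) _ _ Lri (wdiv_L2 (Hvv i))).
rewrite (wdiv_lin (mesh_open hT i) c (Hv i) (Hv' i) Lri).
by rewrite (semi_innerC _ _ (SB _) _ _ Lri (wdiv_L2 (Hv i)))
  (semi_innerC _ _ (SB _) _ _ Lri (wdiv_L2 (Hv' i))).
Qed.

Lemma bform_linr (u : Uspace) : inU Om T u -> linear_on (inV Om T) (bform Om T u).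
Proof.
move=> Uu; have [Lu Ls [_ [w ew]] [_ [q eq]]] := Uu.
move=> c v v' Vv Vv'; have Vvv := inV_lin hT c Vv Vv'.
rewrite !(bformE Uu ew eq)//.
have [Lv1 Hv1 Lv2 Hv2] := Vv; have [Lv1' Hv1' Lv2' Hv2'] := Vv'.
have [[Hw _] [Hq _]] := (ew, eq).
have Lg := grad_L2v Hw; have Lwq := wdiv_L2 Hq.
rewrite -[(c *: v + v').1]/(c *: v.1 + v'.1) -[(c *: v + v').2]/(c *: v.2 + v'.2).
rewrite (ipv_gradT_lin c Ls Hv1 Hv1') (ipv_gradT_lin c Hq.1 Hv1 Hv1').
rewrite (ip_divT_lin c Lu Hv2 Hv2') (ip_divT_lin c Hw.1 Hv2 Hv2').
rewrite (semi_inner_linear_onr _ _ (SB Om) _ Lu c _ _ Lv1 Lv1').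
rewrite (semi_inner_linear_onr _ _ (SB Om) _ Lwq c _ _ Lv1 Lv1').
rewrite (semi_inner_linear_onr _ _ (SV Om) _ Ls c _ _ Lv2 Lv2').
rewrite (semi_inner_linear_onr _ _ (SV Om) _ Lg c _ _ Lv2 Lv2').
move: (ip _ _ _) (ip _ _ _) (ip _ _ _) (ip _ _ _)  (ip _ _ _) (ip _ _ _) (ip _ _ _) (ip _ _ _)
  (ipv _ _ _) (ipv _ _ _) (ipv _ _ _) (ipv _ _ _)  (ipv _ _ _) (ipv _ _ _) (ipv _ _ _) (ipv _ _ _).
by move=> *; ring.
Qed.

Lemma bform_linl (c : R) (u u' : Uspace) (v : Vspace) : inU Om T u ->
  inU Om T u' -> inV Om T v ->
  bform Om T (c *: u + u') v = c * bform Om T u v + bform Om T u' v.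
Proof.
move=> Uu Uu' Vv; have Uuu := inU_lin oOm hT c Uu Uu'.
have [Lu Ls [_ [w ew]] [_ [q eq]]] := Uu.
have [Lu' Ls' [_ [w' ew']] [_ [q' eq']]] := Uu'.
rewrite (bformE Uuu (ext12_lin oOm hT c ew ew') (extm12_lin oOm hT c eq eq') Vv).
rewrite (bformE Uu ew eq Vv) (bformE Uu' ew' eq' Vv).
have [Lv1 Hv1 Lv2 Hv2] := Vv.
have [[Hw _] [Hq _]] := (ew, eq); have [[Hw' _] [Hq' _]] := (ew', eq').
have Lgv := gradT_L2v hT Hv1; have Ldv := divT_L2 hT Hv2.
rewrite -[U_sigma (c *: u + u')]/(c *: U_sigma u + U_sigma u').
rewrite -[U_u (c *: u + u')]/(c *: U_u u + U_u u').
rewrite (semi_inner_linl _ _ (SV Om) c _ _ _ Ls Ls' Lgv).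
rewrite (semi_inner_linl _ _ (SV Om) c _ _ _ Hq.1 Hq'.1 Lgv).
rewrite (semi_inner_linl _ _ (SB Om) c _ _ _ Lu Lu' Ldv).
rewrite (semi_inner_linl _ _ (SB Om) c _ _ _ Hw.1 Hw'.1 Ldv).
rewrite (semi_inner_linl _ _ (SB Om) c _ _ _ Lu Lu' Lv1).
rewrite (wdiv_lin oOm c Hq Hq' Lv1) (grad_lin oOm c Hw Hw' Lv2).
rewrite (semi_inner_linl _ _ (SV Om) c _ _ _ Ls Ls' Lv2).
move: (ip _ _ _) (ip _ _ _) (ip _ _ _) (ip _ _ _)  (ip _ _ _) (ip _ _ _) (ip _ _ _) (ip _ _ _)
  (ipv _ _ _) (ipv _ _ _) (ipv _ _ _) (ipv _ _ _)  (ipv _ _ _) (ipv _ _ _) (ipv _ _ _) (ipv _ _ _).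
by move=> *; ring.
Qed.

Lemma inV_components (v : Vspace) : inV Om T v ->
  [/\ snorm (ip Om) v.1 <= normV Om T v,
      snorm (ipv Om) (gradT T v.1) <= normV Om T v,
      snorm (ipv Om) v.2 <= normV Om T v &
      snorm (ip Om) (divT T v.2) <= normV Om T v].
Proof.
move=> [Lv1 Hv1 Lv2 Hv2].
have := semi_inner_ge0 _ _ (SB Om) _ Lv1.
have := semi_inner_ge0 _ _ (SB Om) _ (divT_L2 hT Hv2).
have := semi_inner_ge0 _ _ (SV Om) _ Lv2.
have := semi_inner_ge0 _ _ (SV Om) _ (gradT_L2v hT Hv1).
rewrite /normV /ipV /snorm.
move: (ip _ _ _) (ip _ _ _) (ipv _ _ _) (ipv _ _ _) => a b a' b' *.
by split; apply: ler_wsqrtr; lra.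
Qed.

(** Each of [u], [sigma], [w] and [q] occurs in two of the eight pairings, whence the factors 2. *)
Lemma bform_le_ext (u : Uspace) w q (v : Vspace) : inU Om T u ->
  ext12 Om T (U_uhat u) w -> extm12 Om T (U_sigmahat u) q -> inV Om T v ->
  `|bform Om T u v| <= (2 * snorm (ip Om) (U_u u) + 2 * snorm (ipv Om) (U_sigma u)
     + 2 * normH1 Om w + 2 * normHdiv Om q) * normV Om T v.
Proof.
move=> Uu ew eq Vv; rewrite (bformE Uu ew eq Vv).
have [c1 c2 c3 c4] := inV_components Vv.
have [Lu Ls _ _] := Uu; have [Lv1 Hv1 Lv2 Hv2] := Vv.
have [[Hw _] [Hq _]] := (ew, eq); have Lg := grad_L2v Hw; have Lwq := wdiv_L2 Hq.
have Lgv := gradT_L2v hT Hv1; have Ldv := divT_L2 hT Hv2.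
have w1 : snorm (ip Om) w <= normH1 Om w by apply: ler_wsqrtr; exact: (ip_H1_le Hw).
have w2 : snorm (ipv Om) (grad Om w) <= normH1 Om w.
  by apply: ler_wsqrtr; exact: (ipv_grad_le Hw).
have q1 : snorm (ipv Om) q <= normHdiv Om q by apply: ler_wsqrtr; exact: (ipv_Hdiv_le Hq).
have q2 : snorm (ip Om) (wdiv Om q) <= normHdiv Om q.
  by apply: ler_wsqrtr; exact: (ip_wdiv_le Hq).
have b1 := semi_inner_CS _ _ (SV Om) _ _ Ls Lgv.
have b2 := semi_inner_CS _ _ (SB Om) _ _ Lu Lv1.
have b3 := semi_inner_CS _ _ (SV Om) _ _ Hq.1 Lgv.
have b4 := semi_inner_CS _ _ (SB Om) _ _ Lwq Lv1.
have b5 := semi_inner_CS _ _ (SV Om) _ _ Ls Lv2.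
have b6 := semi_inner_CS _ _ (SB Om) _ _ Lu Ldv.
have b7 := semi_inner_CS _ _ (SV Om) _ _ Lg Lv2.
have b8 := semi_inner_CS _ _ (SB Om) _ _ Hw.1 Ldv.
have mono (x a b A B : R) : `|x| <= a * b -> 0 <= b -> 0 <= A -> a <= A -> b <= B -> `|x| <= A * B.
  by move=> h b0 A0 aA bB; apply: le_trans h _; apply: le_trans (ler_wpM2r b0 aA) (ler_wpM2l A0 bB).
have n0 := @snorm_ge0.
have z0 : 0 <= normH1 Om w by exact: sqrtr_ge0.
have z1 : 0 <= normHdiv Om q by exact: sqrtr_ge0.
have {}b1 := mono _ _ _ _ _ b1 (n0 _ _ _ _) (n0 _ _ _ _) (lexx _) c2.
have {}b2 := mono _ _ _ _ _ b2 (n0 _ _ _ _) (n0 _ _ _ _) (lexx _) c1.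
have {}b3 := mono _ _ _ _ _ b3 (n0 _ _ _ _) z1 q1 c2.
have {}b4 := mono _ _ _ _ _ b4 (n0 _ _ _ _) z1 q2 c1.
have {}b5 := mono _ _ _ _ _ b5 (n0 _ _ _ _) (n0 _ _ _ _) (lexx _) c3.
have {}b6 := mono _ _ _ _ _ b6 (n0 _ _ _ _) (n0 _ _ _ _) (lexx _) c4.
have {}b7 := mono _ _ _ _ _ b7 (n0 _ _ _ _) z0 w2 c3.
have {}b8 := mono _ _ _ _ _ b8 (n0 _ _ _ _) z0 w1 c4.
move: b1 b2 b3 b4 b5 b6 b7 b8.
move: (normV _ _ _) (snorm _ _) (snorm _ _) (normH1 _ _) (normHdiv _ _).
move: (ip _ _ _) (ip _ _ _) (ip _ _ _) (ip _ _ _) (ipv _ _ _) (ipv _ _ _) (ipv _ _ _) (ipv _ _ _).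
move=> x1 x2 x3 x4 y1 y2 y3 y4 V a b h k.
rewrite !ler_norml => /andP[? ?] /andP[? ?] /andP[? ?] /andP[? ?] /andP[? ?] /andP[? ?] /andP[? ?] /andP[? ?].
by apply/andP; split; lra.
Qed.

End ultraweak_form.

(** * The operator Theta, the boundary pairing and continuity of the forms *)

Section ultraweak_operator.
Context {R : realType} {d : nat} (Om : set 'rV[R]_d) (oOm : open Om).
Context (N : nat) (T : 'I_N -> set 'rV[R]_d) (hT : is_mesh Om T).
Local Notation E := 'rV[R]_d.
Local Notation leb := (@lebesgue_rV R d).
Implicit Types (w phi : E -> R) (p q r : E -> E).

Let SB D := @L2_semi_inner R d D.
Let SV D := @L2v_semi_inner R d D.
Let SHO := H1_semi_inner oOm.
Let SW := V_semi_inner hT.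

Lemma norm12S_ge0 uh : H12S Om T uh -> 0 <= norm12S Om T uh.
Proof.
move=> [_ [w ew]]; apply: ge0_inf; first by exists (normH1 Om w); exists w.
by move=> _ [z _ <-]; exact: sqrtr_ge0.
Qed.

Lemma norm12S_le uh w : ext12 Om T uh w -> norm12S Om T uh <= normH1 Om w.
Proof.
move=> ew; apply: inf_le_ge0; last by exists w.
by move=> _ [z _ <-]; exact: sqrtr_ge0.
Qed.

Lemma normm12S_ge0 sh : Hm12S Om T sh -> 0 <= normm12S Om T sh.
Proof.
move=> [_ [w ew]]; apply: ge0_inf; first by exists (normHdiv Om w); exists w.
by move=> _ [z _ <-]; exact: sqrtr_ge0.
Qed.

Lemma normm12S_le sh q : extm12 Om T sh q -> normm12S Om T sh <= normHdiv Om q.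
Proof.
move=> eq; apply: inf_le_ge0; last by exists q.
by move=> _ [z _ <-]; exact: sqrtr_ge0.
Qed.

Lemma ler_norm12S uh (x c k : R) : H12S Om T uh -> 0 <= k ->
  (forall w, ext12 Om T uh w -> x <= c + k * normH1 Om w) ->
  x <= c + k * norm12S Om T uh.
Proof.
move=> [_ [w ew]] k0 H; apply: ler_inf_affine => //.
  by exists (normH1 Om w); exists w.
by move=> _ [z ez <-]; exact: H.
Qed.

Lemma ler_normm12S sh (x c k : R) : Hm12S Om T sh -> 0 <= k ->
  (forall q, extm12 Om T sh q -> x <= c + k * normHdiv Om q) ->
  x <= c + k * normm12S Om T sh.
Proof.
move=> [_ [w ew]] k0 H; apply: ler_inf_affine => //.
  by exists (normHdiv Om w); exists w.
by move=> _ [z ez <-]; exact: H.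
Qed.

Lemma normU_ge0 (u : Uspace) : 0 <= normU Om T u.
Proof. exact: sqrtr_ge0. Qed.

Lemma sqr_normU (u : Uspace) : inU Om T u -> normU Om T u ^+ 2 =
  ip Om (U_u u) (U_u u) + ipv Om (U_sigma u) (U_sigma u) +
  norm12S Om T (U_uhat u) ^+ 2 + normm12S Om T (U_sigmahat u) ^+ 2.
Proof.
move=> [Lu Ls Hu Hm]; rewrite sqr_sqrtr// !addr_ge0 ?sqr_ge0//.
  exact: (semi_inner_ge0 _ _ (SB Om) _ Lu).
exact: (semi_inner_ge0 _ _ (SV Om) _ Ls).
Qed.

Lemma normU_components (u : Uspace) : inU Om T u ->
  [/\ snorm (ip Om) (U_u u) <= normU Om T u,
      snorm (ipv Om) (U_sigma u) <= normU Om T u,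
      norm12S Om T (U_uhat u) <= normU Om T u &
      normm12S Om T (U_sigmahat u) <= normU Om T u].
Proof.
move=> [Lu Ls Hu Hm].
have a0 := semi_inner_ge0 _ _ (SB Om) _ Lu; have b0 := semi_inner_ge0 _ _ (SV Om) _ Ls.
have c0 := norm12S_ge0 Hu; have d0 := normm12S_ge0 Hm.
have key (x s : R) : 0 <= x -> x ^+ 2 <= s -> x <= Num.sqrt s.
  by move=> x0 h; rewrite -[x]ger0_norm// -sqrtr_sqr ler_wsqrtr.
have := sqr_ge0 (norm12S Om T (U_uhat u)).
have := sqr_ge0 (normm12S Om T (U_sigmahat u)).
have := sqr_snorm _ _ (SB Om) _ Lu; have := sqr_snorm _ _ (SV Om) _ Ls.
rewrite /normU; split; apply: key => //; try exact: snorm_ge0; lra.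
Qed.

(** Take the infimum over [q], then over [w]; each of the four resulting norms has weight 2 and is
    at most the norm of U. The value 8 serves to have some continuity constant, for Riesz and for
    the theorem. *)
Lemma bform_le (u : Uspace) (v : Vspace) : inU Om T u -> inV Om T v ->
  `|bform Om T u v| <= 8 * normU Om T u * normV Om T v.
Proof.
move=> Uu Vv; have [n1 n2 n3 n4] := normU_components Uu.
have [Lu Ls Hu Hm] := Uu.
have V0 : 0 <= normV Om T v by exact: sqrtr_ge0.
set a := snorm _ _ in n1; set b := snorm _ _ in n2.
have V2 : 0 <= 2 * normV Om T v by rewrite mulr_ge0.
have : `|bform Om T u v| <= (2 * a + 2 * b + 2 * norm12S Om T (U_uhat u)) * normV Om T v +
    2 * normV Om T v * normm12S Om T (U_sigmahat u).
  apply: (ler_normm12S Hm V2) => q eq.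
  have -> : (2 * a + 2 * b + 2 * norm12S Om T (U_uhat u)) * normV Om T v +
      2 * normV Om T v * normHdiv Om q = (2 * a + 2 * b + 2 * normHdiv Om q) * normV Om T v
      + 2 * normV Om T v * norm12S Om T (U_uhat u).
    by move: (normV _ _ _) (normHdiv _ _) (norm12S _ _ _) a b n1 n2 => *; ring.
  apply: (ler_norm12S Hu V2) => w ew.
  have := bform_le_ext hT Uu ew eq Vv; rewrite -/a -/b.
  have -> : (2 * a + 2 * b + 2 * normHdiv Om q) * normV Om T v + 2 * normV Om T v * normH1 Om w =
      (2 * a + 2 * b + 2 * normH1 Om w + 2 * normHdiv Om q) * normV Om T v.
    by move: (normV _ _ _) (normHdiv _ _) (normH1 _ _) a b n1 n2 => *; ring.
  exact.
move: V0 (norm12S _ _ _) (normm12S _ _ _) (normU _ _ _) n1 n2 n3 n4.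
move: (normV _ _ _) `|_| a b {V2} => V B a b V0 h k n n1 n2 n3 n4 H.
have m : (2 * a + 2 * b + 2 * h + 2 * k) * V <= (8 * n) * V by apply: ler_wpM2r => //; lra.
by lra.
Qed.

Lemma continuity_constant_ex : is_continuity_constant Om T 8.
Proof. by split=> // u v Uu Vv; exact: bform_le. Qed.

Lemma ThetaP (u : Uspace) : inU Om T u -> inV Om T (Theta Om T u) /\
  forall v, inV Om T v -> ipV Om T (Theta Om T u) v = bform Om T u v.
Proof.
move=> Uu; apply: (@xgetPex _ 0 [set z | inV Om T z /\
  forall v, inV Om T v -> ipV Om T z v = bform Om T u v]).
have [z Vz Hz] := riesz _ _ SW (bform Om T u) (8 * normU Om T u)
  (V_complete hT) (bform_linr hT Uu) (fun v => @bform_le u v Uu).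
by exists z.
Qed.

Lemma Theta_inV (u : Uspace) : inU Om T u -> inV Om T (Theta Om T u).
Proof. by move=> /ThetaP[]. Qed.

Lemma ThetaE (u : Uspace) v : inU Om T u -> inV Om T v ->
  ipV Om T (Theta Om T u) v = bform Om T u v.
Proof. by move=> /ThetaP[_]; apply. Qed.

Lemma bform_Theta_le (u : Uspace) v : inU Om T u -> inV Om T v ->
  `|bform Om T u v| <= normV Om T (Theta Om T u) * normV Om T v.
Proof.
by move=> Uu Vv; rewrite -ThetaE//; exact: (semi_inner_CS _ _ SW _ _ (Theta_inV Uu) Vv).
Qed.

(** Test the continuity of [b] with [Theta u] itself, where [b] equals the squared norm, and cancel
    one factor. *)
Lemma normV_Theta_le C2 (u : Uspace) : is_continuity_constant Om T C2 ->
  inU Om T u -> normV Om T (Theta Om T u) <= C2 * normU Om T u.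
Proof.
move=> [C0 HC] Uu; have VT := Theta_inV Uu.
have := HC _ _ Uu VT; rewrite -ThetaE//.
rewrite -(sqr_snorm _ _ SW _ VT) -[snorm _ _]/(normV Om T (Theta Om T u)).
have n0 := normU_ge0 u; have v0 : 0 <= normV Om T (Theta Om T u) by exact: sqrtr_ge0.
rewrite ger0_norm ?sqr_ge0//.
move: v0 n0 (mulr_ge0 (ltW C0) n0); move: (normV _ _ _) (normU _ _ _) => V n v0 n0 c0.
move: v0; rewrite le_eqVlt => /orP[/eqP<- _//|v0].
by rewrite expr2 ler_pM2r.
Qed.

Lemma bform_betaE (beta : R) (u v : Uspace) : inU Om T u -> inU Om T v ->
  bform Om T u (beta *: Theta Om T v) = beta * ipV Om T (Theta Om T u) (Theta Om T v).
Proof.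
move=> Uu Uv; have VT := Theta_inV Uv.
by rewrite (linear_onZ _ _ SW _ _ _ (bform_linr hT Uu) VT) ThetaE.
Qed.

Lemma gamma0_ext (u : Uspace) : inU Om T u -> ext12 Om T (U_uhat u) (gamma0 Om T u).
Proof. by move=> [_ _ [_ h] _]; exact: (@xgetPex _ 0 _ h). Qed.

(** Well-definedness of the restriction to the boundary: two extensions differ by a function with
    zero trace on every element, to which [H10_mesh] applies. *)
Lemma ext12_same_trace uh w w' : ext12 Om T uh w -> ext12 Om T uh w' ->
  same_trace Om w w'.
Proof.
move=> [Hw ew] [Hw' ew']; apply: (H10_mesh oOm hT); first exact: (semi_innerB _ _ SHO).
move=> i; have -> : w - w' = -1 *: (uh i - w) + (uh i - w').
  by rewrite scaleN1r opprB addrA subrK.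
exact: (H10_lin (mesh_open hT i) _ (ew i) (ew' i)).
Qed.

Lemma gammanE (u : Uspace) q w : inU Om T u -> extm12 Om T (U_sigmahat u) q ->
  H1 Om w -> gamman Om T u w = ntrace Om q w.
Proof.
move=> [_ _ _ [_ h]] [Hq eq] Hw; rewrite /gamman.
have [] := @xgetPex _ 0 _ h; move: (xget _ _) => q0 Hq0 eq0.
rewrite (ntrace_mesh hT Hq0 Hw) (ntrace_mesh hT Hq Hw); apply: eq_bigr => i _.
by have Hi := H1_mesh hT i Hw; rewrite -(eq _ _ Hi) -(eq0 _ _ Hi).
Qed.

Lemma pairingE (u v : Uspace) q w : inU Om T u -> inU Om T v ->
  extm12 Om T (U_sigmahat u) q -> ext12 Om T (U_uhat v) w ->
  gamman Om T u (gamma0 Om T v) = ntrace Om q w.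
Proof.
move=> Uu Uv eq ew; have e0 := gamma0_ext Uv; have [H0 _] := e0; have [Hw _] := ew.
rewrite (gammanE Uu eq H0); have [Hq _] := eq.
exact: (ntrace_same_trace oOm Hq H0 Hw (ext12_same_trace e0 ew)).
Qed.

Lemma pairing_linl (c : R) (u u' v : Uspace) : inU Om T u -> inU Om T u' ->
  inU Om T v -> gamman Om T (c *: u + u') (gamma0 Om T v) =
    c * gamman Om T u (gamma0 Om T v) + gamman Om T u' (gamma0 Om T v).
Proof.
move=> Uu Uu' Uv; have [H0 _] := gamma0_ext Uv.
have [_ _ _ [_ [q eq]]] := Uu; have [_ _ _ [_ [q' eq']]] := Uu'.
rewrite (gammanE (inU_lin oOm hT c Uu Uu') (extm12_lin oOm hT c eq eq') H0).
rewrite (gammanE Uu eq H0) (gammanE Uu' eq' H0).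
exact: (ntrace_linl c oOm eq.1 eq'.1 H0).
Qed.

Lemma pairing_linr (c : R) (u v v' : Uspace) : inU Om T u -> inU Om T v ->
  inU Om T v' -> gamman Om T u (gamma0 Om T (c *: v + v')) =
    c * gamman Om T u (gamma0 Om T v) + gamman Om T u (gamma0 Om T v').
Proof.
move=> Uu Uv Uv'; have [_ _ _ [_ [q eq]]] := Uu.
have e0 := gamma0_ext Uv; have e0' := gamma0_ext Uv'.
have Uc := inU_lin oOm hT c Uv Uv'.
have ec : ext12 Om T (U_uhat (c *: v + v')) (c *: gamma0 Om T v + gamma0 Om T v').
  exact: (ext12_lin oOm hT c e0 e0').
have P := pairingE Uu Uc eq ec.
apply: (etrans P).
apply: (etrans (ntrace_lin oOm eq.1 c e0.1 e0'.1)).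
exact: (esym (congr2 (fun a b => c * a + b) (gammanE Uu eq e0.1) (gammanE Uu eq e0'.1))).
Qed.

(** [ntrace_le] for every pair of extensions, then the infimum over each of them. *)
Lemma pairing_le (u v : Uspace) : inU Om T u -> inU Om T v ->
  `|gamman Om T u (gamma0 Om T v)| <= normU Om T u * normU Om T v.
Proof.
move=> Uu Uv; have [_ _ h0 _] := Uv; have [_ _ _ k0] := Uu.
have n0 := norm12S_ge0 h0; have m0 := normm12S_ge0 k0.
have [_ _ c1 _] := normU_components Uv; have [_ _ _ c2] := normU_components Uu.
apply: (@le_trans _ _ (normm12S Om T (U_sigmahat u) * norm12S Om T (U_uhat v))).
  rewrite -[leRHS]add0r mulrC; apply: (ler_normm12S k0 n0) => q eq.
  rewrite add0r mulrC -[leRHS]add0r.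
  apply: (ler_norm12S h0 (sqrtr_ge0 _)) => w ew; rewrite add0r.
  by rewrite (pairingE Uu Uv eq ew); exact: (ntrace_le oOm eq.1 ew.1).
apply: le_trans (ler_wpM2r n0 c2) _; apply: ler_wpM2l => //; exact: normU_ge0.
Qed.

(** [Theta (c *: u + v)] is a separate choice, equal to the combination of choices only up to null
    vectors. Symmetry of [ipV] moves the dependence into the first argument of [b], where linearity
    holds. *)
Lemma bform_beta_linr beta (c : R) (u v w : Uspace) : inU Om T u ->
  inU Om T v -> inU Om T w ->
  bform Om T w (beta *: Theta Om T (c *: u + v)) =
    c * bform Om T w (beta *: Theta Om T u) + bform Om T w (beta *: Theta Om T v).
Proof.
move=> Uu Uv Uw; have Uc := inU_lin oOm hT c Uu Uv; have VT := Theta_inV.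
have S z : inU Om T z -> bform Om T w (beta *: Theta Om T z) =
    beta * bform Om T z (Theta Om T w).
  move=> Uz; rewrite (bform_betaE beta Uw Uz).
  by rewrite (semi_innerC _ _ SW _ _ (VT _ Uw) (VT _ Uz)) (ThetaE Uz (VT _ Uw)).
apply: (etrans (S _ Uc)); rewrite (S _ Uu) (S _ Uv).
rewrite (bform_linl oOm hT c Uu Uv (VT _ Uw)).
by move: (bform _ _ _ _) (bform _ _ _ _) => *; ring.
Qed.

Lemma aform_lin star beta (c : R) (u v w : Uspace) : inU Om T u ->
  inU Om T v -> inU Om T w ->
  aform Om T star beta (c *: u + v) w =
    c * aform Om T star beta u w + aform Om T star beta v w /\
  aform Om T star beta w (c *: u + v) =
    c * aform Om T star beta w u + aform Om T star beta w v.
Proof.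
move=> Uu Uv Uw; have Uc := inU_lin oOm hT c Uu Uv; rewrite /aform.
have VT := Theta_inV.
have E1 : bform Om T (c *: u + v) (beta *: Theta Om T w) =
    c * bform Om T u (beta *: Theta Om T w) + bform Om T v (beta *: Theta Om T w).
  by apply: bform_linl => //; exact: (semi_innerZ _ _ SW _ _ (VT _ Uw)).
have E2 := bform_beta_linr beta c Uu Uv Uw.
have P1 := pairing_linl c Uu Uv Uw; have P2 := pairing_linr c Uw Uu Uv.
have addlin (a a1 a2 b b1 b2 : R) : a = c * a1 + a2 -> b = c * b1 + b2 ->
    a + b = c * (a1 + b1) + (a2 + b2) by move=> -> ->; ring.
have addlin2 (a a1 a2 b b1 b2 b' b1' b2' : R) : a = c * a1 + a2 ->
    b = c * b1 + b2 -> b' = c * b1' + b2' ->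
    a + 2^-1 * (b + b') = c * (a1 + 2^-1 * (b1 + b1')) + (a2 + 2^-1 * (b2 + b2')).
  by move=> -> -> ->; ring.
case: star; split.
- exact: addlin E1 P1.
- exact: addlin E2 P2.
- exact: addlin E1 P2.
- exact: addlin E2 P1.
- exact: addlin2 E1 P1 P2.
- exact: addlin2 E2 P2 P1.
Qed.

Lemma ler_norm_half (x y z : R) : `|x| <= z -> `|y| <= z -> `|2^-1 * (x + y)| <= z.
Proof.
move=> xz yz; rewrite normrM ger0_norm//.
by have := ler_normD x y; lra.
Qed.

Lemma aform_le star beta C2 (u v : Uspace) : 0 <= beta ->
  is_continuity_constant Om T C2 -> inU Om T u -> inU Om T v ->
  `|aform Om T star beta u v| <= (C2 ^+ 2 * beta + 1) * normU Om T u * normU Om T v.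
Proof.
move=> b0 HC Uu Uv.
have B : `|bform Om T u (beta *: Theta Om T v)| <= C2 ^+ 2 * beta * (normU Om T u * normU Om T v).
  rewrite bform_betaE// normrM ger0_norm//.
  have := semi_inner_CS _ _ SW _ _ (Theta_inV Uu) (Theta_inV Uv).
  move/le_trans => /(_ _ (ler_pM (sqrtr_ge0 _) (sqrtr_ge0 _) (normV_Theta_le HC Uu) (normV_Theta_le HC Uv))).
  move=> /(ler_wpM2l b0) /le_trans; apply.
  rewrite le_eqVlt; apply/orP; left; apply/eqP.
  by move: (normU _ _ _) (normU _ _ _) => *; ring.
have p1 := pairing_le Uu Uv; have p2 := pairing_le Uv Uu.
rewrite -mulrA mulrDl mul1r /aform; apply: le_trans (ler_normD _ _) _; apply: lerD => //.
have {}p2 : `|gamman Om T v (gamma0 Om T u)| <= normU Om T u * normU Om T v.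
  by rewrite [X in _ <= X]mulrC.
case: star; [exact: p1|exact: p2|].
exact: ler_norm_half p1 p2.
Qed.

End ultraweak_operator.

(** * Coercivity: elementary inequalities, minimal extensions and test functions *)

Lemma ler_sqr_cancel (R : realType) (g k : R) : 0 <= g -> 0 <= k ->
  g ^+ 2 <= k * g -> g <= k.
Proof.
rewrite le_eqVlt => /orP[/eqP<- //|g0 k0].
by rewrite expr2 ler_pM2r.
Qed.

Lemma ler_CS2 (R : realType) (x y a b c d : R) : `|x| <= a * b -> `|y| <= c * d ->
  0 <= a -> 0 <= b -> 0 <= c -> 0 <= d ->
  `|x + y| <= Num.sqrt (a ^+ 2 + c ^+ 2) * Num.sqrt (b ^+ 2 + d ^+ 2).
Proof.
move=> hx hy a0 b0 c0 d0; rewrite -sqrtrM ?addr_ge0 ?sqr_ge0//.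
apply: le_trans (ler_normD _ _) _; apply: le_trans (lerD hx hy) _.
rewrite -[X in X <= _]ger0_norm ?addr_ge0 ?mulr_ge0// -sqrtr_sqr; apply: ler_wsqrtr.
rewrite -subr_ge0.
have -> : (a ^+ 2 + c ^+ 2) * (b ^+ 2 + d ^+ 2) - (a * b + c * d) ^+ 2 = (a * d - b * c) ^+ 2.
  by ring.
exact: sqr_ge0.
Qed.

Lemma ler_diff_cancel (R : realType) (x n b g : R) : 0 <= n -> 0 <= b -> 0 <= g ->
  `|x - n ^+ 2| <= b * n -> `|x| <= g * n -> n <= b + g.
Proof.
move=> n0 b0 g0; rewrite !ler_norml => /andP[h1 _] /andP[_ h2].
apply: ler_sqr_cancel => //; first exact: addr_ge0.
by rewrite mulrDl; lra.
Qed.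

(** With [beta >= 2] the form is at least [b ^+ 2 + W ^+ 2 / 2], while the squared norm is at most
    [(b + W) ^+ 2 + 2 * (2 * b + W) ^+ 2]. Eighteen times the former minus the latter is
    [9 b^2 - 10 b W + 6 W^2], a positive form, written below as a sum of squares. *)
Lemma ler_coercive (R : realType) (beta b W g h k P : R) : 2 <= beta ->
  0 <= b -> 0 <= W -> 0 <= g -> 0 <= h -> 0 <= k ->
  g <= b + W -> h <= b + g -> k <= b + g -> 2^-1 * W ^+ 2 - b ^+ 2 <= P ->
  g ^+ 2 + h ^+ 2 + k ^+ 2 <= 18 * (beta * b ^+ 2 + P).
Proof.
move=> b2 b0 W0 g0 h0 k0 gle hle kle Ple.
have G2 : g ^+ 2 <= (b + W) ^+ 2 by rewrite ler_pXn2r// nnegrE addr_ge0.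
have K x : 0 <= x -> x <= b + g -> x ^+ 2 <= (2 * b + W) ^+ 2.
  by move=> x0 xle; rewrite ler_pXn2r// ?nnegrE ?addr_ge0 ?mulr_ge0//; lra.
have H2 := K _ h0 hle; have K2 := K _ k0 kle.
have B2 : 2 * b ^+ 2 <= beta * b ^+ 2 by rewrite ler_wpM2r// sqr_ge0.
have : 0 <= (3 * b - 5 / 3 * W) ^+ 2 + 29 / 9 * W ^+ 2.
  apply: addr_ge0; first exact: sqr_ge0.
  by apply: mulr_ge0; [lra|exact: sqr_ge0].
have -> : (3 * b - 5 / 3 * W) ^+ 2 + 29 / 9 * W ^+ 2 =
    18 * b ^+ 2 + 9 * W ^+ 2 - ((b + W) ^+ 2 + 2 * (2 * b + W) ^+ 2) by field.
move: G2 H2 K2 B2 Ple.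
move: (g ^+ 2) (h ^+ 2) (k ^+ 2) (beta * _) ((b + W) ^+ 2) ((2 * b + W) ^+ 2).
by move: (b ^+ 2) (W ^+ 2) => *; lra.
Qed.

(** Young's inequality [b * n <= b ^+ 2 + n ^+ 2 / 4], with [n ^+ 2 = 2 * W ^+ 2] the squared norm
    of the test function. *)
Lemma ler_pairing_lower (R : realType) (W P n b : R) : n ^+ 2 = 2 * W ^+ 2 ->
  W ^+ 2 - P <= b * n -> 2^-1 * W ^+ 2 - b ^+ 2 <= P.
Proof.
move=> n2 h; have : 0 <= (b - n / 2) ^+ 2 by exact: sqr_ge0.
have -> : (b - n / 2) ^+ 2 = b ^+ 2 - b * n + n ^+ 2 / 4 by field.
by rewrite n2; lra.
Qed.

Section orthogonality.
Context {R : realType} {d : nat} (D : set 'rV[R]_d) (oD : open D).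
Local Notation E := 'rV[R]_d.
Implicit Types (w phi : E -> R) (p q r : E -> E).

Let mD : measurable D := open_measurable_rV oD.
Let SB := @L2_semi_inner R d.
Let SV := @L2v_semi_inner R d.
Let SH := H1_semi_inner oD.
Let SD := Hdiv_semi_inner oD.

Lemma grad_testfun w phi : H1 D w -> testfun D phi ->
  ipv D (grad D w) (grad D phi) = ipv D (grad D w) (cgrad phi).
Proof.
move=> Hw tphi; have Lg := grad_L2v Hw; have Lc := testfun_cgrad_L2v oD tphi.
rewrite (semi_innerC _ _ (SV D) _ _ Lg (grad_L2v (testfun_H1 oD tphi))).
rewrite (gradE oD (testfun_L2 mD tphi) (testfun_is_wgrad oD tphi) Lg).
exact: (semi_innerC _ _ (SV D) _ _ Lc Lg).
Qed.

(** The Euler-Lagrange equation of a minimal extension: orthogonality to test functions in [H1] says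
    that the divergence of the gradient of [w] is [w]. [D'] is either the whole domain or one
    element. *)
Lemma orth_is_wdiv (D' : set E) w : measurable D' -> D' `<=` D -> H1 D w ->
  (forall phi, testfun D' phi -> ipH1 D w phi = 0) -> is_wdiv D' (grad D w) w.
Proof.
move=> mD' DD Hw H; split; first exact: (L2_sub mD' DD Hw.1).
move=> phi tphi; have tD := testfun_sub DD tphi.
rewrite (ipv_sub _ DD); last first.
  by move=> x nx; apply/rowP => i; rewrite !mxE; exact: testfun_out (testfun_partial i tphi) nx.
rewrite (ip_sub _ DD); last by move=> x; exact: testfun_out tphi.
rewrite -(grad_testfun Hw tD); have := H _ tphi; rewrite /ipH1.
by move: (ip _ _ _) (ipv _ _ _) => *; lra.
Qed.

Lemma single_is_wdiv j phi : testfun D phi ->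
  is_wdiv D (single j phi) (partial j phi).
Proof.
move=> tphi; have tp := testfun_partial j tphi.
split; first exact: (testfun_L2 mD tp).
move=> psi tpsi; have Lphi := testfun_L2 mD tphi.
have Lc := testfun_cgrad_L2v oD tpsi.
rewrite (semi_innerC _ _ (SV D) _ _ (single_L2v j Lphi) Lc).
rewrite (ipv_single j Lc Lphi) cmp_cgrad (semi_innerC _ _ (SB D)) //.
- by rewrite (testfun_parts j tphi tpsi).
- exact: (testfun_L2 mD (testfun_partial j tpsi)).
Qed.

Lemma single_Hdiv j phi : testfun D phi -> Hdiv D (single j phi).
Proof.
move=> tphi; apply: is_wdiv_Hdiv (single_is_wdiv j tphi).
exact: (single_L2v j (testfun_L2 mD tphi)).
Qed.

(** The counterpart in [Hdiv]: orthogonality to the fields [single j phi] says that the gradient of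
    the divergence of [q] is [q]. *)
Lemma orth_is_wgrad (D' : set E) q : measurable D' -> D' `<=` D -> Hdiv D q ->
  (forall j phi, testfun D' phi -> ipHdiv D q (single j phi) = 0) ->
  is_wgrad D' (wdiv D q) q.
Proof.
move=> mD' DD Hq H; split; first exact: (L2v_sub mD' DD Hq.1).
move=> phi tphi j; have tD := testfun_sub DD tphi.
rewrite (ip_sub _ DD); last by move=> x; exact: testfun_out (testfun_partial j tphi).
rewrite (ip_sub _ DD); last by move=> x; exact: testfun_out tphi.
have Lphi := testfun_L2 mD tD; have Lw := wdiv_L2 Hq.
have Lp := testfun_L2 mD (testfun_partial j tD).
have := H j _ tphi; rewrite /ipHdiv (ipv_single j Hq.1 Lphi).
rewrite (semi_innerC _ _ (SB D) _ _ Lw (wdiv_L2 (single_Hdiv j tD))).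
rewrite (wdivE oD (single_Hdiv j tD).1 (single_is_wdiv j tD) Lw).
rewrite (semi_innerC _ _ (SB D) _ _ Lp Lw) /cmp.
by move: (ip _ _ _) (ip _ _ _) => *; lra.
Qed.

Lemma ntrace_linear_onl w : H1 D w -> linear_on (Hdiv D) (fun p => ntrace D p w).
Proof. by move=> Hw c p q Hp Hq; exact: (ntrace_linl c oD Hp Hq Hw). Qed.

Lemma ip_wdiv_linear_on u : L2 D u -> linear_on (Hdiv D) (fun p => ip D u (wdiv D p)).
Proof.
move=> Lu c p q Hp Hq; have Hpq := Hdiv_lin oD c Hp Hq.
rewrite (semi_innerC _ _ (SB D) _ _ Lu (wdiv_L2 Hpq)) (wdiv_lin oD c Hp Hq Lu).
by rewrite (semi_innerC _ _ (SB D) _ _ Lu (wdiv_L2 Hp)) (semi_innerC _ _ (SB D) _ _ Lu (wdiv_L2 Hq)).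
Qed.

Lemma ipHdiv_is_wdiv p u : L2v D p -> is_wdiv D p u ->
  ipHdiv D p p = ipv D p p + ip D u u.
Proof.
move=> Lp pu; have Hp := is_wdiv_Hdiv Lp pu; have Lw := wdiv_L2 Hp; have [Lu _] := pu.
rewrite /ipHdiv (wdivE oD Lp pu Lw) (semi_innerC _ _ (SB D) _ _ Lu Lw).
by rewrite (wdivE oD Lp pu Lu).
Qed.

Lemma ipH1_is_wgrad u p : L2 D u -> is_wgrad D u p ->
  ipH1 D u u = ip D u u + ipv D p p.
Proof.
move=> Lu up; have Hu := is_wgrad_H1 Lu up; have Lw := grad_L2v Hu; have [Lp _] := up.
rewrite /ipH1 (gradE oD Lu up Lw) (semi_innerC _ _ (SV D) _ _ Lp Lw).
by rewrite (gradE oD Lu up Lp).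
Qed.

(** These fields have compact support, so they are directions in which normal traces stay fixed, as
    the minimality of an extension requires. *)
Lemma ntrace_single j phi v : testfun D phi -> H1 D v ->
  ntrace D (single j phi) v = 0.
Proof.
move=> tphi Hv; have Lphi := testfun_L2 mD tphi; have Lg := grad_L2v Hv.
have Ls := single_L2v j Lphi; have Lp := testfun_L2 mD (testfun_partial j tphi).
rewrite /ntrace (wdivE oD Ls (single_is_wdiv j tphi) Hv.1).
rewrite (semi_innerC _ _ (SV D) _ _ Ls Lg) (ipv_single j Lg Lphi).
rewrite (semi_innerC _ _ (SB D) _ _ Lp Hv.1).
have [_ ->//] := gradP Hv; rewrite /cmp.
by move: (ip _ _ _) => *; lra.
Qed.

Lemma ntrace_eq_on q q' v : (forall x, D x -> q x = q' x) ->
  ntrace D q v = ntrace D q' v.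
Proof. by move=> qq; rewrite /ntrace (wdiv_eq_on qq) (ipv_eq_on qq (fun x _ => erefl)). Qed.

Lemma harmonic_extension w : H1 D w -> exists z, [/\ H1 D z, H10 D (w - z) &
  forall phi, H10 D phi -> ipH1 D z phi = 0].
Proof.
move=> Hw; apply: (orthogonal_complement_proj SH (H1_complete oD) _ _ _ (H10_closed oD) Hw).
- by move=> v [].
- exact: H10_0.
- by move=> c u v; exact: H10_lin.
Qed.

End orthogonality.

Section coercivity.
Context {R : realType} {d : nat} (Om : set 'rV[R]_d) (oOm : open Om).
Context (N : nat) (T : 'I_N -> set 'rV[R]_d) (hT : is_mesh Om T).
Local Notation E := 'rV[R]_d.
Implicit Types (w phi : E -> R) (p q r : E -> E).

Let mT i : measurable (T i) := open_measurable_rV (mesh_open hT i).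
Let mOm : measurable Om := open_measurable_rV oOm.
Let SB D := @L2_semi_inner R d D.
Let SV D := @L2v_semi_inner R d D.
Let SHO := H1_semi_inner oOm.
Let SDO := Hdiv_semi_inner oOm.
Let SH i := H1_semi_inner (mesh_open hT i).
Let SD i := Hdiv_semi_inner (mesh_open hT i).
Let SW := V_semi_inner hT.

Lemma bform_conf (u : Uspace) w q v p : inU Om T u ->
  ext12 Om T (U_uhat u) w -> extm12 Om T (U_sigmahat u) q ->
  H1 Om v -> Hdiv Om p ->
  bform Om T u (v, p) =
    ipv Om (U_sigma u) (grad Om v) + ip Om (U_u u) v - ntrace Om q v
    + ipv Om (U_sigma u) p + ip Om (U_u u) (wdiv Om p) - ntrace Om p w.
Proof.
move=> Uu ew eq Hv Hp; rewrite (bformE hT Uu ew eq (conf_inV hT Hv Hp)) /=.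
have [Lu Ls _ _] := Uu; have [[Hw _] [Hq _]] := (ew, eq).
rewrite (ipv_gradT_conf hT Ls Hv) (ipv_gradT_conf hT Hq.1 Hv).
rewrite (ip_divT_conf hT Lu Hp) (ip_divT_conf hT Hw.1 Hp) /ntrace.
have Lg := grad_L2v Hw; have Lwd := wdiv_L2 Hp.
by rewrite (semi_innerC _ _ (SV _) _ _ Lg Hp.1) (semi_innerC _ _ (SB _) _ _ Hw.1 Lwd).
Qed.

Lemma sqr_normV (v : Vspace) : inV Om T v -> normV Om T v ^+ 2 = ipV Om T v v.
Proof. exact: (sqr_snorm _ _ SW). Qed.

Lemma pairing_lower (u : Uspace) w q z : inU Om T u ->
  ext12 Om T (U_uhat u) w -> extm12 Om T (U_sigmahat u) q ->
  H1 Om z -> H10 Om (w - z) -> (forall phi, H10 Om phi -> ipH1 Om z phi = 0) ->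
  2^-1 * normH1 Om z ^+ 2 - normV Om T (Theta Om T u) ^+ 2 <= ntrace Om q w.
Proof.
move=> Uu ew eq Hz wz orth.
have Dz : is_wdiv Om (grad Om z) z.
  apply: (orth_is_wdiv oOm mOm _ Hz) => // phi tphi.
  by apply: orth; exact: testfun_H10.
have Lg := grad_L2v Hz; have Hg := is_wdiv_Hdiv Lg Dz.
set g := -1 *: grad Om z.
have HNg : Hdiv Om g by exact: (semi_innerZ _ _ SDO).
have VNz := conf_inV hT Hz HNg.
have [Hw _] := ew; have [Hq _] := eq.
have [Lu Ls _ _] := Uu.
have nz : normH1 Om z ^+ 2 = ip Om z z + ipv Om (grad Om z) (grad Om z).
  exact: (sqr_snorm _ _ SHO _ Hz).
have eN : ipHdiv Om g g = normH1 Om z ^+ 2.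
  rewrite -(sqr_snorm _ _ SDO _ HNg) (snormZ _ _ SDO _ _ Hg) normrN1 mul1r.
  by rewrite (sqr_snorm _ _ SDO _ Hg) nz (ipHdiv_is_wdiv oOm Lg Dz) addrC.
have n2 : normV Om T (z, g) ^+ 2 = 2 * normH1 Om z ^+ 2.
  rewrite (sqr_normV VNz) (conf_ipV hT Hz HNg Hz HNg) eN.
  by rewrite -(sqr_snorm _ _ SHO _ Hz) mulr_natl mulr2n.
have b1 := bform_Theta_le hT Uu VNz.
have t1 : ntrace Om g w = - normH1 Om z ^+ 2.
  rewrite (linear_onZ _ _ SDO _ _ _ (ntrace_linear_onl oOm Hw) Hg) mulN1r.
  congr (- _); rewrite -(subrK z w) (linear_onD _ _ _ _ (ntrace_lin oOm Hg) wz.1 Hz).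
  rewrite (ntrace_H10 oOm Hg wz) add0r /ntrace (wdivE oOm Lg Dz Hz.1) nz.
  exact: addrC.
have t2 : ntrace Om q w = ntrace Om q z.
  rewrite -[in LHS](subrK z w) (linear_onD _ _ _ _ (ntrace_lin oOm Hq) wz.1 Hz).
  by rewrite (ntrace_H10 oOm Hq wz) add0r.
(* The sign of [g] and the equation for [z] cancel all terms with [u] and [sigma]. Both boundary
   terms are evaluated at the trace of [w], which is that of [z]. *)
have be : bform Om T u (z, g) = normH1 Om z ^+ 2 - ntrace Om q w.
  rewrite (bform_conf Uu ew eq Hz HNg) t1 t2.
  rewrite (linear_onZ _ _ SDO _ _ _ (ip_wdiv_linear_on oOm Lu) Hg).
  rewrite (linear_onZ _ _ (SV Om) _ _ _ (semi_inner_linear_onr _ _ (SV Om) _ Ls) Lg).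
  rewrite (semi_innerC _ _ (SB Om) _ _ Lu (wdiv_L2 Hg)) (wdivE oOm Lg Dz Lu).
  rewrite (semi_innerC _ _ (SB Om) _ _ Lu Hz.1).
  move: (normH1 _ _) (ip _ _ _) (ipv _ _ _) (ntrace _ _ _) => *; ring.
rewrite be in b1.
move: b1 n2; rewrite -[z in normV _ _ (z, _)]/z.
move: (normH1 _ _) (ntrace _ _ _) (normV Om T (z, g)) (normV _ _ _).
move=> W P n b; rewrite ler_norml => /andP[_ h] n2.
exact: ler_pairing_lower n2 h.
Qed.

(** Solves a homogeneous Dirichlet problem whose test pair has exactly the norm of [(u, sigma)] and
    reproduces its square in [b]. As [v] has zero trace, the normal trace of [q] drops out, and the
    other boundary term costs the norm of [z]. *)
Lemma L2_part_le (u : Uspace) w q z : inU Om T u ->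
  ext12 Om T (U_uhat u) w -> extm12 Om T (U_sigmahat u) q ->
  H1 Om z -> H10 Om (w - z) ->
  Num.sqrt (ip Om (U_u u) (U_u u) + ipv Om (U_sigma u) (U_sigma u)) <=
  normV Om T (Theta Om T u) + normH1 Om z.
Proof.
move=> Uu ew eq Hz wz; have [Lu Ls _ _] := Uu; have [[Hw _] [Hq _]] := (ew, eq).
pose l v := ip Om (U_u u) v + ipv Om (U_sigma u) (grad Om v).
have llin : linear_on (H1 Om) l.
  move=> c v v' Hv Hv'; rewrite /l.
  rewrite (semi_inner_linear_onr _ _ (SB Om) _ Lu c _ _ Hv.1 Hv'.1).
  have Hvv := H1_lin oOm c Hv Hv'.
  rewrite (semi_innerC _ _ (SV Om) _ _ Ls (grad_L2v Hvv)) (grad_lin oOm c Hv Hv' Ls).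
  rewrite (semi_innerC _ _ (SV Om) _ _ Ls (grad_L2v Hv)).
  rewrite (semi_innerC _ _ (SV Om) _ _ Ls (grad_L2v Hv')).
  by move: (ip _ _ _) (ip _ _ _) (ipv _ _ _) (ipv _ _ _) => *; ring.
have lle v : H1 Om v -> `|l v| <= (snorm (ip Om) (U_u u) + snorm (ipv Om) (U_sigma u)) * snorm (ipH1 Om) v.
  move=> Hv; rewrite mulrDl; apply: le_trans (ler_normD _ _) _; apply: lerD.
    apply: le_trans (semi_inner_CS _ _ (SB Om) _ _ Lu Hv.1) _.
    by apply: ler_wpM2l; [exact: snorm_ge0|apply: ler_wsqrtr; exact: (ip_H1_le Hv)].
  apply: le_trans (semi_inner_CS _ _ (SV Om) _ _ Ls (grad_L2v Hv)) _.
  by apply: ler_wpM2l; [exact: snorm_ge0|apply: ler_wsqrtr; exact: (ipv_grad_le Hv)].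
have [v H10v Hv] := variational_equality _ _ SHO _ l _ (H1_complete oOm)
  (fun v (h : H10 Om v) => h.1) (H10_0 oOm) (@H10_lin _ _ _ oOm) (H10_closed oOm) llin lle.
have [H1v _] := H10v; have Lg := grad_L2v H1v.
set p := U_sigma u - grad Om v.
have Lp : L2v Om p by exact: (semi_innerB _ _ (SV Om)).
have Luv : L2 Om (U_u u - v) by exact: (semi_innerB _ _ (SB Om) _ _ Lu H1v.1).
(* The equation for [v], tested with [phi], is the statement that [sigma - grad v] has divergence
   [u - v]. *)
have Dp : is_wdiv Om p (U_u u - v).
  split => // phi tphi; have Lc := testfun_cgrad_L2v oOm tphi.
  have Lphi := testfun_L2 mOm tphi; have Hphi := testfun_H1 oOm tphi.
  rewrite (linear_onB _ _ (SV Om) _ _ _ (semi_inner_linear_onl _ _ (SV Om) _ Lc) Ls Lg).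
  rewrite (linear_onB _ _ (SB Om) _ _ _ (semi_inner_linear_onl _ _ (SB Om) _ Lphi) Lu H1v.1).
  have := Hv _ (testfun_H10 oOm tphi); rewrite /ipH1 /l (grad_testfun oOm H1v tphi).
  rewrite (semi_innerC _ _ (SV Om) _ _ Ls (grad_L2v Hphi)).
  rewrite (gradE oOm Lphi (testfun_is_wgrad oOm tphi) Ls).
  rewrite (semi_innerC _ _ (SV Om) _ _ Lc Ls).
  by move: (ip _ _ _) (ip _ _ _) (ipv _ _ _) (ipv _ _ _) => *; lra.
have Hp := is_wdiv_Hdiv Lp Dp; have Vp := conf_inV hT H1v Hp.
have Ev := Hv _ H10v.
have np : ipHdiv Om p p = ipv Om (U_sigma u) (U_sigma u) + ip Om (U_u u) (U_u u)
    - 2 * l v + ipH1 Om v v.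
  rewrite (ipHdiv_is_wdiv oOm Lp Dp) /l /ipH1.
  rewrite (semi_innerBB (SV Om) Ls Lg) (semi_innerBB (SB Om) Lu H1v.1).
  move: (ip _ _ _) (ip _ _ _) (ip _ _ _) (ipv _ _ _) (ipv _ _ _) (ipv _ _ _) => *; ring.
(* Expanding the squares leaves [2 * ipH1 Om v v - 2 * l v] as excess, which vanishes on testing the
   equation with [v]. *)
have n2 : normV Om T (v, p) ^+ 2 =
    ip Om (U_u u) (U_u u) + ipv Om (U_sigma u) (U_sigma u).
  rewrite (sqr_normV Vp) (conf_ipV hT H1v Hp H1v Hp) np -Ev.
  by move: (ipH1 _ _ _) (ip _ _ _) (ipv _ _ _) => *; ring.
have be : bform Om T u (v, p) =
    ip Om (U_u u) (U_u u) + ipv Om (U_sigma u) (U_sigma u) - ntrace Om p w.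
  rewrite (bform_conf Uu ew eq H1v Hp) (ntrace_H10 oOm Hq H10v).
  rewrite (linear_onB _ _ (SV Om) _ _ _ (semi_inner_linear_onr _ _ (SV Om) _ Ls) Ls Lg).
  rewrite (semi_innerC _ _ (SB Om) _ _ Lu (wdiv_L2 Hp)) (wdivE oOm Lp Dp Lu).
  rewrite (semi_innerC _ _ (SB Om) _ _ Luv Lu).
  rewrite (linear_onB _ _ (SB Om) _ _ _ (semi_inner_linear_onr _ _ (SB Om) _ Lu) Lu H1v.1).
  by move: (ip _ _ _) (ip _ _ _) (ntrace _ _ _) (ipv _ _ _) (ipv _ _ _) => *; ring.
have t : ntrace Om p w = ntrace Om p z.
  rewrite -[in LHS](subrK z w) (linear_onD _ _ _ _ (ntrace_lin oOm Hp) wz.1 Hz).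
  by rewrite (ntrace_H10 oOm Hp wz) add0r.
have tle : `|ntrace Om p w| <= normV Om T (v, p) * normH1 Om z.
  rewrite t; apply: le_trans (ntrace_le oOm Hp Hz) _; apply: ler_wpM2r.
    exact: sqrtr_ge0.
  rewrite /normV (conf_ipV hT H1v Hp H1v Hp); apply: ler_wsqrtr.
  rewrite -[X in X <= _]/(ipHdiv Om p p) lerDr.
  exact: (semi_inner_ge0 _ _ SHO).
have b1 := bform_Theta_le hT Uu Vp; rewrite be -n2 in b1.
rewrite -n2 sqrtr_sqr ger0_norm; last exact: sqrtr_ge0.
apply: ler_sqr_cancel; [exact: sqrtr_ge0|by apply: addr_ge0; exact: sqrtr_ge0|].
move: b1 tle; move: (ntrace _ _ _) (normH1 _ _) (normV Om T (v, p)) (normV Om T (Theta Om T u)).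
move=> P W n b; rewrite !ler_norml => /andP[_ h1] /andP[_ h2].
by rewrite mulrDl [W * n]mulrC; lra.
Qed.

Let G (u : @Uspace R d N) :=
  Num.sqrt (ip Om (U_u u) (U_u u) + ipv Om (U_sigma u) (U_sigma u)).

Lemma L2_pair_le (u : Uspace) (v : E -> R) (p : E -> E) : inU Om T u ->
  L2 Om v -> L2v Om p -> `|ip Om (U_u u) v + ipv Om (U_sigma u) p| <=
    G u * Num.sqrt (ip Om v v + ipv Om p p).
Proof.
move=> [Lu Ls _ _] Lv Lp.
have h1 := semi_inner_CS _ _ (SB Om) _ _ Lu Lv.
have h2 := semi_inner_CS _ _ (SV Om) _ _ Ls Lp.
rewrite /G -(sqr_snorm _ _ (SB Om) _ Lu) -(sqr_snorm _ _ (SB Om) _ Lv).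
rewrite -(sqr_snorm _ _ (SV Om) _ Ls) -(sqr_snorm _ _ (SV Om) _ Lp).
apply: (ler_CS2 h1 h2); exact: snorm_ge0.
Qed.

(** Minimal extension of a skeleton trace: the subspace projected away consists of the functions
    with zero trace on every element, and it contains the test functions of each element. *)
Lemma H10_mesh_proj w : H1 Om w -> exists z, [/\ H1 Om z,
  forall i, H10 (T i) (w - z) &
  forall i phi, testfun (T i) phi -> ipH1 Om z phi = 0].
Proof.
move=> Hw; pose C : set (E -> R) := [set v | H1 Om v /\ forall i, H10 (T i) v].
have Ccl : sclosed (H1 Om) (ipH1 Om) C.
  move=> v Hv H; split=> // i; apply: (H10_closed (mesh_open hT i)).
    exact: (H1_mesh hT i Hv).
  move=> e /H[x [Hx Cx] h]; exists x => //.
  have Hvx := semi_innerB _ _ SHO _ _ Hv Hx.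
  exact: le_lt_trans (ipH1_mesh_le hT i Hvx) h.
have [|||||z [Hz [_ wz] orth]] := orthogonal_complement_proj SHO (H1_complete oOm) (C := C) (x := w).
- by move=> v [].
- by split; [exact: (H10_0 oOm).1|move=> i; exact: (H10_0 (mesh_open hT i))].
- move=> c u v [Hu uC] [Hv vC]; split; first exact: H1_lin.
  by move=> i; exact: (H10_lin (mesh_open hT i)).
- exact: Ccl.
- exact: Hw.
exists z; split=> // i phi tphi; apply: orth; split.
  exact: (testfun_H1 oOm (testfun_mesh hT tphi)).
move=> j; have [->|ij] := eqVneq j i; first exact: (testfun_H10 (mesh_open hT i) tphi).
apply: (H10_eq_on (mesh_open hT j) (u := 0)) (H10_0 (mesh_open hT j)).
move=> x Tx; rewrite (testfun_out tphi)// => Tix.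
by rewrite (mesh_disjoint hT Tx Tix) eqxx in ij.
Qed.

(** Minimal extension of a skeleton normal trace. The subspace of fields with zero normal traces is
    closed by [ntrace_le] on each element. *)
Lemma Hdiv_mesh_proj p : Hdiv Om p -> exists q, [/\ Hdiv Om q,
  forall i v, H1 (T i) v -> ntrace (T i) p v = ntrace (T i) q v &
  forall i j phi, testfun (T i) phi -> ipHdiv Om q (single j phi) = 0].
Proof.
move=> Hp; pose C : set (E -> E) := [set q | Hdiv Om q /\
  forall i v, H1 (T i) v -> ntrace (T i) q v = 0].
have Ccl : sclosed (Hdiv Om) (ipHdiv Om) C.
  move=> q Hq H; split=> // i v Hv.
  apply: (@ler0_small _ _ (normH1 (T i) v)) => [|e e0]; first exact: sqrtr_ge0.
  have [x [Hx Cx] h] := H _ (exprn_gt0 2 e0).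
  have Hqx := semi_innerB _ _ SDO _ _ Hq Hx.
  have -> : ntrace (T i) q v = ntrace (T i) (q - x) v.
    rewrite (linear_onB _ _ (SD i) _ _ _ (ntrace_linear_onl (mesh_open hT i) Hv)).
      by rewrite (Cx _ _ Hv) subr0.
      exact: (Hdiv_mesh hT i Hq).
    exact: (Hdiv_mesh hT i Hx).
  have Hi := Hdiv_mesh hT i Hqx.
  apply: le_trans (ntrace_le (mesh_open hT i) Hi Hv) _.
  apply: ler_wpM2r; first exact: sqrtr_ge0.
  rewrite -[X in _ <= X](ger0_norm (ltW e0)) -sqrtr_sqr /normHdiv; apply: ler_wsqrtr.
  exact: le_trans (ipHdiv_mesh_le hT i Hqx) (ltW h).
have [|||||q [Hq [_ pq] orth]] := orthogonal_complement_proj SDO (Hdiv_complete oOm) (C := C) (x := p).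
- by move=> v [].
- split; first exact: (semi_inner_nonempty _ _ SDO).
  move=> i v Hv; apply: (linear_on0 _ _ (SD i) _ (ntrace_linear_onl (mesh_open hT i) Hv)).
- move=> c u v [Hu uC] [Hv vC]; split; first exact: Hdiv_lin.
  move=> i x Hx.
  rewrite (ntrace_linl c (mesh_open hT i) (Hdiv_mesh hT i Hu) (Hdiv_mesh hT i Hv) Hx).
  by rewrite uC// vC// mulr0 addr0.
- exact: Ccl.
- exact: Hp.
exists q; split; [exact: Hq|move=> i v Hv|move=> i j phi tphi].
  have := pq _ _ Hv.
  rewrite (linear_onB _ _ (SD i) _ _ _ (ntrace_linear_onl (mesh_open hT i) Hv)).
    by move/eqP; rewrite subr_eq0 => /eqP.
    exact: (Hdiv_mesh hT i Hp).
  exact: (Hdiv_mesh hT i Hq).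
have Hs := single_Hdiv oOm j (testfun_mesh hT tphi).
apply: orth; split; first exact: Hs.
move=> k v Hv.
have [ki|ki] := eqVneq k i.
  by rewrite ki in Hv *; exact: (ntrace_single (mesh_open hT i) j tphi Hv).
(* On the other elements the test field is identically zero. *)
have E0 x : T k x -> single j phi x = (0 : E -> E) x.
  move=> Tx; rewrite /single (testfun_out tphi) ?scale0r// => Tix.
  by rewrite (mesh_disjoint hT Tx Tix) eqxx in ki.
rewrite (ntrace_eq_on v E0).
exact: (linear_on0 _ _ (SD k) _ (ntrace_linear_onl (mesh_open hT k) Hv)).
Qed.

(** [grad z] has divergence [z] on each element while its normal component may jump, so it is
    admissible precisely because V is a broken space. The zero first component removes the normal
    trace; the test function has the norm of [z], and one factor of it is cancelled. *)
Lemma norm12S_le_Theta (u : Uspace) : inU Om T u ->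
  norm12S Om T (U_uhat u) <= normV Om T (Theta Om T u) + G u.
Proof.
move=> Uu; have [Lu Ls [_ [w ew]] [_ [q eq]]] := Uu; have [Hw uw] := ew.
have [z [Hz wz orth]] := H10_mesh_proj Hw.
have ez : ext12 Om T (U_uhat u) z.
  split; first exact: Hz.
  move=> i; rewrite /same_trace.
  have -> : U_uhat u i - z = 1 *: (U_uhat u i - w) + (w - z).
    by rewrite scale1r addrA subrK.
  exact: (H10_lin (mesh_open hT i) _ (uw i) (wz i)).
apply: le_trans (norm12S_le ez) _.
have Lg := grad_L2v Hz.
have Di i : is_wdiv (T i) (grad Om z) z.
  exact: (orth_is_wdiv oOm (mT i) (mesh_sub hT i) Hz (orth i)).
have Lgi i : L2v (T i) (grad Om z) := L2v_sub (mT i) (mesh_sub hT i) Lg.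
have Hgi i : Hdiv (T i) (grad Om z) := is_wdiv_Hdiv (Lgi i) (Di i).
have L0 := semi_inner_nonempty _ _ (SB Om).
have Vg : inV Om T (0, grad Om z).
  split; [exact: L0| |exact: Lg|exact: Hgi].
  by move=> i; exact: (semi_inner_nonempty _ _ (SH i)).
have divE v : L2 Om v -> ip Om v (divT T (grad Om z)) = ip Om v z.
  move=> Lv; rewrite (ip_divT hT Lv Hgi) (ip_mesh hT Lv Hz.1); apply: eq_bigr => i _.
  have Lvi : L2 (T i) v := L2_sub (mT i) (mesh_sub hT i) Lv.
  have Lzi : L2 (T i) z := L2_sub (mT i) (mesh_sub hT i) Hz.1.
  rewrite (semi_innerC _ _ (SB _) _ _ Lvi (wdiv_L2 (Hgi i))).
  rewrite (wdivE (mesh_open hT i) (Lgi i) (Di i) Lvi).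
  exact: (semi_innerC _ _ (SB _) _ _ Lzi Lvi).
have z2 : normH1 Om z ^+ 2 = ip Om z z + ipv Om (grad Om z) (grad Om z).
  exact: (sqr_snorm _ _ SHO _ Hz).
have n2 : normV Om T (0, grad Om z) ^+ 2 = normH1 Om z ^+ 2.
  rewrite (sqr_normV Vg) (ipV_mesh hT Vg Vg) z2.
  rewrite (ip_mesh hT Hz.1 Hz.1) (ipv_mesh hT Lg Lg) -big_split; apply: eq_bigr => i _ /=.
  have H0 := semi_inner_nonempty _ _ (SH i).
  rewrite (linear_on0 _ _ (SH i) _ (semi_inner_linear_onl _ _ (SH i) _ H0)) add0r.
  by rewrite (ipHdiv_is_wdiv (mesh_open hT i) (Lgi i) (Di i)) addrC.
have be : bform Om T u (0, grad Om z) =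
    ip Om (U_u u) z + ipv Om (U_sigma u) (grad Om z) - normH1 Om z ^+ 2.
  rewrite (bformE hT Uu ez eq Vg) /= (divE _ Lu) (divE _ Hz.1) z2.
  have Hz0 i : H1 (T i) (0 : E -> R) := semi_inner_nonempty _ _ (SH i).
  have g0 r : L2v Om r -> ipv Om r (gradT T 0) = 0.
    move=> Lr; have := ipv_gradT_lin hT 1 Lr Hz0 Hz0; rewrite scale1r addr0.
    by move: (ipv _ _ _) => x; lra.
  have [Hq _] := eq; have Lwq := wdiv_L2 Hq.
  rewrite (g0 _ Ls) (g0 _ Hq.1).
  rewrite (linear_on0 _ _ (SB Om) _ (semi_inner_linear_onr _ _ (SB Om) _ Lu)).
  rewrite (linear_on0 _ _ (SB Om) _ (semi_inner_linear_onr _ _ (SB Om) _ Lwq)).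
  by move: (ip _ _ _) (ip _ _ _) (ipv _ _ _) (ipv _ _ _) => *; ring.
have b1 := bform_Theta_le hT Uu Vg; rewrite be in b1.
have b2 := L2_pair_le Uu Hz.1 Lg; rewrite -z2 sqrtr_sqr (ger0_norm (sqrtr_ge0 _)) in b2.
have n1 : normV Om T (0, grad Om z) = normH1 Om z.
  by apply/eqP; rewrite -(@eqrXn2 _ 2)// ?n2//; exact: sqrtr_ge0.
rewrite n1 in b1; apply: ler_diff_cancel b1 b2; exact: sqrtr_ge0.
Qed.

(** The dual argument: the divergence of the minimal [q] is in broken [H1] with gradient [q], and
    the zero second component removes the trace [uhat]. *)
Lemma normm12S_le_Theta (u : Uspace) : inU Om T u ->
  normm12S Om T (U_sigmahat u) <= normV Om T (Theta Om T u) + G u.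
Proof.
move=> Uu; have [Lu Ls [_ [w ew]] [_ [p ep]]] := Uu; have [Hp up] := ep.
have [q [Hq pq orth]] := Hdiv_mesh_proj Hp.
have eq : extm12 Om T (U_sigmahat u) q.
  split; first exact: Hq.
  by move=> i v Hv; rewrite (up _ _ Hv) (pq _ _ Hv).
apply: le_trans (normm12S_le eq) _.
have Lv := wdiv_L2 Hq; set v := wdiv Om q in Lv.
have Di i : is_wgrad (T i) v q.
  exact: (orth_is_wgrad oOm (mT i) (mesh_sub hT i) Hq (orth i)).
have Lvi i : L2 (T i) v := L2_sub (mT i) (mesh_sub hT i) Lv.
have Hvi i : H1 (T i) v := is_wgrad_H1 (Lvi i) (Di i).
have L0 := semi_inner_nonempty _ _ (SV Om).
have Vg : inV Om T (v, 0).
  split; [exact: Lv|exact: Hvi|exact: L0|].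
  by move=> i; exact: (semi_inner_nonempty _ _ (SD i)).
have gradE' r : L2v Om r -> ipv Om r (gradT T v) = ipv Om r q.
  move=> Lr; rewrite (ipv_gradT hT Lr Hvi) (ipv_mesh hT Lr Hq.1); apply: eq_bigr => i _.
  have Lri : L2v (T i) r := L2v_sub (mT i) (mesh_sub hT i) Lr.
  have Lqi : L2v (T i) q := L2v_sub (mT i) (mesh_sub hT i) Hq.1.
  rewrite (semi_innerC _ _ (SV _) _ _ Lri (grad_L2v (Hvi i))).
  rewrite (gradE (mesh_open hT i) (Lvi i) (Di i) Lri).
  exact: (semi_innerC _ _ (SV _) _ _ Lqi Lri).
have z2 : normHdiv Om q ^+ 2 = ipv Om q q + ip Om v v.
  exact: (sqr_snorm _ _ SDO _ Hq).
have n2 : normV Om T (v, 0) ^+ 2 = normHdiv Om q ^+ 2.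
  rewrite (sqr_normV Vg) (ipV_mesh hT Vg Vg) z2.
  rewrite (ip_mesh hT Lv Lv) (ipv_mesh hT Hq.1 Hq.1) -big_split; apply: eq_bigr => i _ /=.
  have H0 := semi_inner_nonempty _ _ (SD i).
  rewrite (linear_on0 _ _ (SD i) _ (semi_inner_linear_onl _ _ (SD i) _ H0)) addr0.
  by rewrite (ipH1_is_wgrad (mesh_open hT i) (Lvi i) (Di i)) addrC.
have be : bform Om T u (v, 0) =
    ip Om (U_u u) v + ipv Om (U_sigma u) q - normHdiv Om q ^+ 2.
  rewrite (bformE hT Uu ew eq Vg) /= (gradE' _ Ls) (gradE' _ Hq.1) z2.
  have Hz0 i : Hdiv (T i) (0 : E -> E) := semi_inner_nonempty _ _ (SD i).
  have g0 (r : E -> R) : L2 Om r -> ip Om r (divT T 0) = 0.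
    move=> Lr; have := ip_divT_lin hT 1 Lr Hz0 Hz0; rewrite scale1r addr0.
    by move: (ip _ _ _) => x; lra.
  have [Hw _] := ew; have Lg := grad_L2v Hw.
  rewrite (g0 _ Lu) (g0 _ Hw.1).
  rewrite (linear_on0 _ _ (SV Om) _ (semi_inner_linear_onr _ _ (SV Om) _ Ls)).
  rewrite (linear_on0 _ _ (SV Om) _ (semi_inner_linear_onr _ _ (SV Om) _ Lg)).
  by rewrite -/v; move: (ip _ _ _) (ip _ _ _) (ipv _ _ _) (ipv _ _ _) => *; ring.
have b1 := bform_Theta_le hT Uu Vg; rewrite be in b1.
have b2 := L2_pair_le Uu Lv Hq.1.
rewrite [ip Om v v + _]addrC -z2 sqrtr_sqr (ger0_norm (sqrtr_ge0 _)) in b2.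
have n1 : normV Om T (v, 0) = normHdiv Om q.
  by apply/eqP; rewrite -(@eqrXn2 _ 2)// ?n2//; exact: sqrtr_ge0.
rewrite n1 in b1; apply: ler_diff_cancel b1 b2; exact: sqrtr_ge0.
Qed.

(** On the diagonal the three forms coincide: [beta] times the squared norm of [Theta u] plus the
    boundary pairing. *)
Lemma aform_coercive star beta (u : Uspace) : 2 <= beta -> inU Om T u ->
  normU Om T u ^+ 2 <= 18 * aform Om T star beta u u.
Proof.
move=> b2 Uu; have [Lu Ls Hh Hm] := Uu.
have ew := gamma0_ext Uu; have [_ [q eq]] := Hm; have [Hw _] := ew.
have [z [Hz wz orth]] := harmonic_extension oOm Hw.
have l1 := pairing_lower Uu ew eq Hz wz orth.
rewrite -(pairingE oOm hT Uu Uu eq ew) in l1.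
have l2 := L2_part_le Uu ew eq Hz wz.
have l3 := norm12S_le_Theta Uu; have l4 := normm12S_le_Theta Uu.
have n1 := norm12S_ge0 Hh; have n2 := normm12S_ge0 Hm.
have E : aform Om T star beta u u =
    beta * normV Om T (Theta Om T u) ^+ 2 + gamman Om T u (gamma0 Om T u).
  have VT := Theta_inV hT Uu.
  rewrite /aform (bform_betaE hT beta Uu Uu) (sqr_normV VT).
  have half (x : R) : 2^-1 * (x + x) = x by field.
  by case: star; rewrite ?half.
rewrite E (sqr_normU Uu).
have g2 : ip Om (U_u u) (U_u u) + ipv Om (U_sigma u) (U_sigma u) = G u ^+ 2.
  rewrite sqr_sqrtr// addr_ge0//; first exact: (semi_inner_ge0 _ _ (SB Om) _ Lu).
  exact: (semi_inner_ge0 _ _ (SV Om) _ Ls).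
rewrite g2; exact: (ler_coercive b2 (sqrtr_ge0 _) (sqrtr_ge0 _) (sqrtr_ge0 _) n1 n2 l2 l3 l4 l1).
Qed.

End coercivity.

(** * The Signorini problem and the variational inequality *)

Section signorini_problem.
Context {R : realType} {d : nat} (Om : set 'rV[R]_d) (oOm : open Om).
Local Notation E := 'rV[R]_d.
Local Notation leb := (@lebesgue_rV R d).
Implicit Types (u v w phi f : E -> R).

Let mOm : measurable Om := open_measurable_rV oOm.
Let SB D := @L2_semi_inner R d D.
Let SV D := @L2v_semi_inner R d D.
Let SH := H1_semi_inner oOm.

Lemma lipschitz_on_lin (A : set E) (c : R) (g h : E -> R) :
  [lipschitz g x | x in A] -> [lipschitz h x | x in A] ->
  [lipschitz (c *: g + h) x | x in A].
Proof.
move=> /pinfty_ex_gt0[K1 K10 HK1] /pinfty_ex_gt0[K2 K20 HK2].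
exists (`|c| * K1 + K2); split; first exact: num_real.
move=> M KM [x y] [/= Ax Ay].
have := HK1 (x, y) (conj Ax Ay); have := HK2 (x, y) (conj Ax Ay) => /= h2 h1.
apply: (@le_trans _ _ ((`|c| * K1 + K2) * `|x - y|)); last by rewrite ler_wpM2r// ltW.
rewrite !fctE /=.
have -> : c *: g x + h x - (c *: g y + h y) = c * (g x - g y) + (h x - h y).
  by rewrite -![_ *: _]/(_ * _); ring.
rewrite mulrDl; apply: le_trans (ler_normD _ _) _; apply: lerD => //.
by rewrite normrM -mulrA; apply: ler_wpM2l.
Qed.

Lemma lipschitz_on0 (A : set E) : [lipschitz (0 : E -> R) x | x in A].
Proof.
exists 0; split; first exact: num_real.
move=> M M0 [x y] _ /=; rewrite subrr normr0 mulr_ge0// ltW//.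
Qed.

Definition lipschitz_ge0_trace u := H1 Om u /\
  exists g, lipschitz_trace Om u g /\ forall x, bdry Om x -> 0 <= g x.

Lemma lipschitz_ge0_trace_cone (c : R) u v : 0 <= c ->
  lipschitz_ge0_trace u -> lipschitz_ge0_trace v ->
  lipschitz_ge0_trace (c *: u + v).
Proof.
move=> c0 [Hu [g [[lg [G [lG Gg uG]]] g0]]] [Hv [h [[lh [H [lH Hh vH]]] h0]]].
split; first exact: (H1_lin oOm).
exists (c *: g + h); split; last first.
  by move=> x bx; rewrite !fctE addr_ge0 ?h0//; apply: mulr_ge0 => //; exact: g0.
split; first exact: lipschitz_on_lin.
exists (c *: G + H); split; first exact: lipschitz_on_lin.
  by move=> x bx; rewrite !fctE Gg// Hh.
rewrite /same_trace.
have -> : c *: u + v - (c *: G + H) = c *: (u - G) + (v - H).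
  by rewrite scalerBr opprD addrACA.
exact: (H10_lin oOm c uG vH).
Qed.

(** The zero function is an admissible Lipschitz trace. So the cone contains a linear subspace, on
    which variational inequalities become equations. *)
Lemma H10_lipschitz_ge0_trace phi : H10 Om phi -> lipschitz_ge0_trace phi.
Proof.
move=> hphi; split; first by have [] := hphi.
exists 0; split=> //; split; first exact: lipschitz_on0.
exists 0; split; [exact: lipschitz_on0|by []|].
by rewrite /same_trace subr0.
Qed.

(** The strong closure is closed by construction, which minimisation requires, whereas [ge0_H12] is
    defined by weak sequential limits. Inclusion in [ge0_H12] suffices for the sign of the
    solution. *)
Definition closed_ge0_cone : set (E -> R) := [set u | H1 Om u /\
  forall e, 0 < e -> exists2 v, lipschitz_ge0_trace v & ipH1 Om (u - v) (u - v) < e].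

Lemma closed_ge0_cone_lin (c : R) u v : 0 <= c -> closed_ge0_cone u ->
  closed_ge0_cone v -> closed_ge0_cone (c *: u + v).
Proof.
move=> c0 [Hu Cu] [Hv Cv]; split; first exact: (H1_lin oOm).
move=> e e0; pose se := Num.sqrt e; have se0 : 0 < se by rewrite sqrtr_gt0.
have k0 : 0 < c + 1 by rewrite ltr_wpDl.
have s1 : 0 < se / (c + 1) by rewrite divr_gt0.
have [u' Ku uu] := Cu _ (exprn_gt0 2 s1); have [v' Kv vv] := Cv _ (exprn_gt0 2 s1).
exists (c *: u' + v'); first exact: lipschitz_ge0_trace_cone.
have -> : c *: u + v - (c *: u' + v') = c *: (u - u') + (v - v').
  by rewrite scalerBr opprD addrACA.
have Huu := semi_innerB _ _ SH _ _ Hu Ku.1; have Hvv := semi_innerB _ _ SH _ _ Hv Kv.1.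
have Hc := semi_innerZ _ _ SH c _ Huu; have Hs := semi_innerD _ _ SH _ _ Hc Hvv.
rewrite -[X in _ < X]sqr_sqrtr ?(ltW e0)// -(snorm_lt _ _ SH _ _ Hs se0).
apply: le_lt_trans (ler_snormD _ _ SH _ _ Hc Hvv) _.
rewrite (snormZ _ _ SH _ _ Huu) (ger0_norm c0).
rewrite -(snorm_lt _ _ SH _ _ Huu s1) in uu; rewrite -(snorm_lt _ _ SH _ _ Hvv s1) in vv.
have -> : se = c * (se / (c + 1)) + se / (c + 1) by field; rewrite gt_eqF.
exact: ler_ltD (ler_wpM2l c0 (ltW uu)) vv.
Qed.

Lemma closed_ge0_coneW v : lipschitz_ge0_trace v -> closed_ge0_cone v.
Proof.
move=> Kv; split; first by have [] := Kv.
move=> e e0; exists v; first exact: Kv.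
rewrite subrr.
have H0 := semi_inner_nonempty _ _ SH.
by rewrite (linear_on0 _ _ SH _ (semi_inner_linear_onl _ _ SH _ H0)).
Qed.

Lemma closed_ge0_cone_closed : sclosed (H1 Om) (ipH1 Om) closed_ge0_cone.
Proof.
move=> u Hu H; split=> // e e0; have e2 : 0 < Num.sqrt e / 2.
  by rewrite divr_gt0// sqrtr_gt0.
have [v [Hv Cv] uv] := H _ (exprn_gt0 2 e2).
have [w Kw vw] := Cv _ (exprn_gt0 2 e2); exists w; first exact: Kw.
have Huv := semi_innerB _ _ SH _ _ Hu Hv; have Hvw := semi_innerB _ _ SH _ _ Hv Kw.1.
have Huw := semi_innerB _ _ SH _ _ Hu Kw.1.
have se0 : 0 < Num.sqrt e by rewrite sqrtr_gt0.
rewrite -[X in _ < X]sqr_sqrtr ?(ltW e0)// -(snorm_lt _ _ SH _ _ Huw se0).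
rewrite -(snorm_lt _ _ SH _ _ Huv e2) in uv; rewrite -(snorm_lt _ _ SH _ _ Hvw e2) in vw.
have -> : u - w = (u - v) + (v - w) by rewrite addrA subrK.
apply: le_lt_trans (ler_snormD _ _ SH _ _ Huv Hvw) _.
move: uv vw; move: (snorm _ _) (snorm _ _) (Num.sqrt e) => *; lra.
Qed.

(** Strong convergence implies convergence of every bounded functional. *)
Lemma closed_ge0_cone_ge0 u : closed_ge0_cone u -> ge0_H12 Om u.
Proof.
move=> [Hu Cu]; split=> //.
have /choice[v Kv] : forall n, exists v, lipschitz_ge0_trace v /\
    ipH1 Om (u - v) (u - v) < n.+1%:R^-1 ^+ 2.
  by move=> n; have [|v t h] := Cu (n.+1%:R^-1 ^+ 2); [by rewrite exprn_gt0// invr_gt0|exists v].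
have /choice[g Hg] : forall n, exists g, lipschitz_trace Om (v n) g /\
    forall x, bdry Om x -> 0 <= g x.
  by move=> n; have [[_ [g h]] _] := Kv n; exists g.
exists v, g; split.
  by move=> n; have [[Hv _] _] := Kv n; have [? ?] := Hg n.
move=> l [llin _ [C lC]].
apply/cvgrPdist_lt => e e0.
have C0 : 0 < `|C| + 1 by rewrite ltr_wpDl.
have /ltr_add_invr[N] : 0 < e / (`|C| + 1) by rewrite divr_gt0.
rewrite add0r => Ne; exists N => // n /= Nn.
have [[Hv _] h] := Kv n; have Hd := semi_innerB _ _ SH _ _ Hu Hv.
rewrite -(linear_onB _ _ SH _ _ _ llin Hu Hv).
apply: le_lt_trans (lC _ Hd) _.
have h' : normH1 Om (u - v n) < e / (`|C| + 1).
  rewrite -[normH1 _ _]/(snorm (ipH1 Om) (u - v n)).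
  apply: lt_le_trans (ltW Ne); rewrite (snorm_lt _ _ SH)//.
  apply: lt_le_trans h _; rewrite lerXn2r ?nnegrE ?invr_ge0//.
  by rewrite lef_pV2 ?posrE ?ltr0n// ler_nat.
move: h' (sqrtr_ge0 _ : 0 <= normH1 Om (u - v n)); rewrite ltr_pdivlMr//.
move: (normH1 _ _) => x h' x0; apply: le_lt_trans h'.
rewrite mulrC; apply: ler_wpM2l => //; have := ler_norm C; lra.
Qed.

(** Nonnegativity passes to weak limits, so the sign of a flux needs testing only with Lipschitz
    traces. This lets the minimiser over the strong closure satisfy a condition stated for weak
    limits. *)
Lemma lipschitz_ge0_trace_functional l : Hm12 Om l ->
  (forall v, lipschitz_ge0_trace v -> 0 <= l v) -> ge0_Hm12 Om l.
Proof.
move=> hl H v [Hv [x [g [xg lim]]]].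
rewrite leNgt; apply/negP => lv0.
have /cvgrPdist_lt/(_ (- l v)) := lim l hl; rewrite oppr_gt0 => /(_ lv0)[N _ HN].
have := HN N (leqnn N); rewrite /= ltr_norml => /andP[h _].
have [Hx lx gx] := xg N.
have := H (x N) (conj Hx (ex_intro _ (g N) (conj lx gx))).
by move: (l v) (l (x N)) h => *; lra.
Qed.

(** The residual [r] of the minimiser vanishes on [H10], which is the differential equation; it then
    coincides with the Green functional of the gradient. Its sign on the cone and [r u = 0] are the
    flux and complementarity conditions. *)
Lemma signorini_ex f : L2 Om f -> exists u, signorini Om f u.
Proof.
move=> Lf.
have llin : linear_on (H1 Om) (ip Om f).
  by move=> c u v Hu Hv; exact: (semi_inner_linear_onr _ _ (SB Om) _ Lf c _ _ Hu.1 Hv.1).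
have lle v : H1 Om v -> `|ip Om f v| <= snorm (ip Om) f * snorm (ipH1 Om) v.
  move=> Hv; apply: le_trans (semi_inner_CS _ _ (SB Om) _ _ Lf Hv.1) _.
  by apply: ler_wpM2l; [exact: snorm_ge0|apply: ler_wsqrtr; exact: (ip_H1_le Hv)].
have C0 : closed_ge0_cone 0 by exact/closed_ge0_coneW/H10_lipschitz_ge0_trace/H10_0.
have cvx : convex_on closed_ge0_cone.
  move=> t u v t0 t1 Cu Cv.
  have -> : u + t *: (v - u) = t *: v + ((1 - t) *: u + 0).
    by rewrite scalerBr scalerBl scale1r addr0 addrCA.
  have t1' : 0 <= 1 - t by rewrite subr_ge0.
  exact: closed_ge0_cone_lin t0 Cv (closed_ge0_cone_lin t1' Cu C0).
have [u Cu Hu] := variational_inequality _ _ SH closed_ge0_cone (ip Om f) _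
  (H1_complete oOm) (fun v (h : closed_ge0_cone v) => h.1) (ex_intro _ 0 C0) cvx
  closed_ge0_cone_closed llin lle.
exists u; have [H1u _] := Cu; have Lg := grad_L2v H1u.
pose r v := ipH1 Om u v - ip Om f v.
have rlin : linear_on (H1 Om) r.
  move=> c v w Hv Hw; rewrite /r (llin c _ _ Hv Hw).
  rewrite (semi_inner_linear_onr _ _ SH _ H1u c _ _ Hv Hw).
  by move: (ipH1 _ _ _) (ipH1 _ _ _) (ip _ _ _) (ip _ _ _) => *; ring.
have rge v : closed_ge0_cone v -> 0 <= r (v - u).
  by move=> Cv; rewrite /r subr_ge0; exact: Hu.
have ru : r u = 0.
  (* Tests with 0 and with [2 u], both in the cone. *)
  have h1 := rge _ C0; have := rge _ (closed_ge0_cone_lin ler01 Cu Cu).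
  rewrite scale1r addrK => h2; apply/eqP; rewrite eq_le h2 andbT.
  move: h1; rewrite sub0r -scaleN1r (linear_onZ _ _ SH _ _ _ rlin H1u).
  by move: (r u) => *; lra.
have rC v : closed_ge0_cone v -> 0 <= r v.
  by move=> Cv; have := rge _ Cv; rewrite (linear_onB _ _ SH _ _ _ rlin Cv.1 H1u) ru subr0.
(* Both [phi] and [- phi] have the admissible trace 0. *)
have r0 phi : H10 Om phi -> r phi = 0.
  move=> hphi; have Cp := closed_ge0_coneW (H10_lipschitz_ge0_trace hphi).
  have hN : H10 Om (-1 *: phi + 0) := H10_lin oOm _ hphi (H10_0 oOm).
  have Cn := closed_ge0_coneW (H10_lipschitz_ge0_trace hN).
  have := rC _ Cp; have := rC _ Cn; rewrite addr0.
  rewrite (linear_onZ _ _ SH _ _ _ rlin Cp.1).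
  by move: (r phi) => *; lra.
have Luf : L2 Om (u - f) by exact: (semi_innerB _ _ (SB Om) _ _ H1u.1 Lf).
have Dg : is_wdiv Om (grad Om u) (u - f).
  split => // phi tphi; have Lphi := testfun_L2 mOm tphi.
  rewrite -(grad_testfun oOm H1u tphi).
  rewrite (linear_onB _ _ (SB Om) _ _ _ (semi_inner_linear_onl _ _ (SB Om) _ Lphi) H1u.1 Lf).
  have := r0 _ (testfun_H10 oOm tphi); rewrite /r /ipH1.
  by move: (ip _ _ _) (ip _ _ _) (ipv _ _ _) => *; lra.
have Hg := is_wdiv_Hdiv Lg Dg.
have nE v : H1 Om v -> ntrace Om (grad Om u) v = r v.
  move=> Hv; rewrite /ntrace (wdivE oOm Lg Dg Hv.1) /r /ipH1.
  rewrite (linear_onB _ _ (SB Om) _ _ _ (semi_inner_linear_onl _ _ (SB Om) _ Hv.1) H1u.1 Lf).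
  by move: (ip _ _ _) (ip _ _ _) (ipv _ _ _) => *; ring.
split.
- by [].
(* The chosen divergence agrees with [u - f] in pairings; pairing the difference with itself gives
   the equation almost everywhere. *)
- have Lw := wdiv_L2 Hg.
  have Ld : L2 Om (wdiv Om (grad Om u) - (u - f)) by exact: (semi_innerB _ _ (SB Om)).
  have z : ip Om (wdiv Om (grad Om u) - (u - f)) (wdiv Om (grad Om u) - (u - f)) = 0.
    rewrite (linear_onB _ _ (SB Om) _ _ _ (semi_inner_linear_onl _ _ (SB Om) _ Ld) Lw Luf).
    by rewrite (wdivE oOm Lg Dg Ld) subrr.
  have := ip0_ae Ld z; apply: filterS => x hx Dx; have := hx Dx.
  rewrite !fctE /=; move: (wdiv _ _ _) (u x) (f x) => *; lra.
- exact: closed_ge0_cone_ge0.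
- apply: lipschitz_ge0_trace_functional; first exact: ntrace_Hm12.
  by move=> v Kv; rewrite (nE _ Kv.1); exact/rC/closed_ge0_coneW.
- by rewrite (nE _ H1u).
Qed.

End signorini_problem.

(** Uniqueness as arithmetic, with [e] the difference of the solutions: each inequality is tested
    with the other solution and they are added; the load terms cancel and [a e e <= 0] remains.
    Plain numbers keep the forms opaque to [lra]. *)
Lemma VI_arith (R : realType) (F1 F2 Avv Avu Auu Auv Ave Aue Aee Aue' Buv Buu : R) :
  F1 <= Ave -> F2 <= Aue' ->
  F1 = -1 * Buv + Buu -> F2 = -1 * Buu + Buv ->
  Ave = -1 * Avv + Avu -> Aue' = -1 * Auu + Auv ->
  Aee = -1 * Ave + Aue -> Aue = -1 * Auv + Auu -> 18 * Aee <= 0.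
Proof. move=> *; lra. Qed.

(** * Equivalence of (SP) and (VI) *)

Section variational_problem.
Context {R : realType} {d : nat} (Om : set 'rV[R]_d) (oOm : open Om).
Context (N : nat) (T : 'I_N -> set 'rV[R]_d) (hT : is_mesh Om T).
Context (f : 'rV[R]_d -> R) (Lf : L2 Om f).
Local Notation E := 'rV[R]_d.
Local Notation leb := (@lebesgue_rV R d).
Implicit Types (w phi : E -> R) (p q r : E -> E).

Let mT i : measurable (T i) := open_measurable_rV (mesh_open hT i).
Let mOm : measurable Om := open_measurable_rV oOm.
Let SB D := @L2_semi_inner R d D.
Let SV D := @L2v_semi_inner R d D.
Let SHO := H1_semi_inner oOm.
Let SDO := Hdiv_semi_inner oOm.
Let SH i := H1_semi_inner (mesh_open hT i).
Let SD i := Hdiv_semi_inner (mesh_open hT i).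
Let SW := V_semi_inner hT.

Lemma same_trace_refl (D : set E) u : open D -> same_trace D u u.
Proof. by move=> oD; rewrite /same_trace subrr; exact: H10_0. Qed.

(** The functionals that define weak convergence vanish on [H10], so the same sequence converges to
    both functions. *)
Lemma ge0_H12_same_trace u w : H1 Om u -> same_trace Om w u -> ge0_H12 Om w ->
  ge0_H12 Om u.
Proof.
move=> Hu wu [Hw [v [g [H lim]]]]; split; first exact: Hu.
exists v, g; split; first exact: H.
move=> l hl; have [llin l0 _] := hl.
have -> : l u = l w; last exact: lim.
apply/esym/eqP; rewrite -subr_eq0 -(linear_onB _ _ SHO _ _ _ llin Hw Hu).
by rewrite (l0 _ wu).
Qed.

Section signorini_solution.
Context (u : E -> R) (hu : signorini Om f u).
Let uu := U_of_SP Om T u.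

Let Hu : H1 Om u. Proof. by have [[]] := hu. Qed.
Let Hg : Hdiv Om (grad Om u). Proof. by have [[]] := hu. Qed.

Lemma U_of_SP_ext12 : ext12 Om T (U_uhat uu) u.
Proof. by split; [exact: Hu|move=> i; exact: same_trace_refl (mesh_open hT i)]. Qed.

Lemma U_of_SP_extm12 : extm12 Om T (U_sigmahat uu) (grad Om u).
Proof. by split; first exact: Hg. Qed.

Lemma U_of_SP_inU : inU Om T uu.
Proof.
split; [exact: Hu.1|exact: (grad_L2v Hu)| |].
  by split; [move=> i; exact: (H1_mesh hT i Hu)|exists u; exact: U_of_SP_ext12].
split; last by exists (grad Om u); exact: U_of_SP_extm12.
by move=> i; exact: (ntrace_Hm12 (mesh_open hT i) (Hdiv_mesh hT i Hg)).
Qed.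

Lemma bform_U_of_SP (v : Vspace) : inV Om T v -> bform Om T uu v = ip Om f v.1.
Proof.
move=> Vv; rewrite (bformE hT U_of_SP_inU U_of_SP_ext12 U_of_SP_extm12 Vv).
have [Lv1 _ _ _] := Vv; have [_ ae _ _ _] := hu.
rewrite -[U_sigma uu]/(grad Om u) -[U_u uu]/u.
have -> : ip Om f v.1 = ip Om u v.1 - ip Om (wdiv Om (grad Om u)) v.1.
  have Lw := wdiv_L2 Hg.
  rewrite -(linear_onB _ _ (SB Om) _ _ _ (semi_inner_linear_onl _ _ (SB Om) _ Lv1) Hu.1 Lw).
  apply: ae_ip; [exact: Lf|exact: (semi_innerB _ _ (SB Om) _ _ Hu.1 Lw)|exact: Lv1|].
  by apply: filterS ae => x h Dx; rewrite -(h Dx) !fctE addrC.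
move: (ip _ _ _) (ip _ _ _) (ip _ _ _) (ipv _ _ _) (ipv _ _ _) => *; ring.
Qed.

Lemma Frhs_U_of_SP beta (v : Uspace) : inU Om T v ->
  Frhs Om T f beta v = bform Om T uu (beta *: Theta Om T v).
Proof.
move=> Uv; rewrite bform_U_of_SP//.
exact: (semi_innerZ _ _ SW _ _ (Theta_inV hT Uv)).
Qed.

Lemma U_of_SP_gamma0 : ge0_H12 Om (gamma0 Om T uu).
Proof.
have [_ _ u0 _ _] := hu; have e0 := gamma0_ext U_of_SP_inU.
apply: (ge0_H12_same_trace e0.1 _ u0).
exact: (ext12_same_trace oOm hT U_of_SP_ext12 e0).
Qed.

Lemma U_of_SP_gamman : ge0_Hm12 Om (gamman Om T uu).
Proof.
have [_ _ _ h _] := hu; move=> v v0; have [Hv _] := v0.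
by rewrite (gammanE hT U_of_SP_inU U_of_SP_extm12 Hv); exact: h.
Qed.

Lemma cone_inU star (v : Uspace) : cone Om T star v -> inU Om T v.
Proof. by case. Qed.

Lemma U_of_SP_cone star : cone Om T star uu.
Proof.
split; first exact: U_of_SP_inU.
case: star; [exact: U_of_SP_gamma0|exact: U_of_SP_gamman|].
by split; [exact: U_of_SP_gamma0|exact: U_of_SP_gamman].
Qed.

Lemma U_of_SP_pairing0 : gamman Om T uu (gamma0 Om T uu) = 0.
Proof.
rewrite (pairingE oOm hT U_of_SP_inU U_of_SP_inU U_of_SP_extm12 U_of_SP_ext12).
by have [] := hu.
Qed.

Lemma pairing_subr (x v w : Uspace) : inU Om T x -> inU Om T v -> inU Om T w ->
  gamman Om T x (gamma0 Om T (v - w)) =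
    gamman Om T x (gamma0 Om T v) - gamman Om T x (gamma0 Om T w).
Proof.
move=> Ux Uv Uw; have E1 : v - w = -1 *: w + v by rewrite scaleN1r addrC.
apply: (etrans (congr1 (fun z => gamman Om T x (gamma0 Om T z)) E1)).
apply: (etrans (pairing_linr oOm hT (-1) Ux Uw Uv)).
exact: (etrans (congr1 (fun a => a + _) (mulN1r _)) (addrC _ _)).
Qed.

Lemma pairing_subl (x v w : Uspace) : inU Om T x -> inU Om T v -> inU Om T w ->
  gamman Om T (v - w) (gamma0 Om T x) =
    gamman Om T v (gamma0 Om T x) - gamman Om T w (gamma0 Om T x).
Proof.
move=> Ux Uv Uw; have E1 : v - w = -1 *: w + v by rewrite scaleN1r addrC.
apply: (etrans (congr1 (fun z => gamman Om T z (gamma0 Om T x)) E1)).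
apply: (etrans (pairing_linl oOm hT (-1) Uw Uv Ux)).
exact: (etrans (congr1 (fun a => a + _) (mulN1r _)) (addrC _ _)).
Qed.

(** By complementarity the self-pairing drops out, leaving the pairing of [uu] with [v] in one
    order, in the other, or half their sum. Each cone imposes on [v] the sign its own pairing needs;
    the other factor has its sign from (SP). *)
Lemma U_of_SP_solves_VI star beta : solves_VI Om T star f beta uu.
Proof.
split; first exact: U_of_SP_cone.
move=> v Cv; have Uv := cone_inU Cv; have Uu := U_of_SP_inU.
have Uvu := inU_B oOm hT Uv Uu.
rewrite /aform -(Frhs_U_of_SP beta Uvu) lerDl.
have P0 := etrans (pairing_subr Uu Uv Uu)
  (etrans (congr1 (fun a => _ - a) U_of_SP_pairing0) (subr0 _)).
have Pn := etrans (pairing_subl Uu Uv Uu)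
  (etrans (congr1 (fun a => _ - a) U_of_SP_pairing0) (subr0 _)).
have K0 (v0 : ge0_H12 Om (gamma0 Om T v)) :=
  eq_ind_r (fun a => 0 <= a) (U_of_SP_gamman v0) P0.
have Kn (v0 : ge0_Hm12 Om (gamman Om T v)) :=
  eq_ind_r (fun a => 0 <= a) (v0 _ U_of_SP_gamma0) Pn.
case: star Cv => -[_ h]; [exact: K0|exact: Kn|].
have half0 : 0 <= 2^-1 :> R by rewrite invr_ge0.
exact: mulr_ge0 half0 (addr_ge0 (K0 h.1) (Kn h.2)).
Qed.

Let subE (a b : @Uspace R d N) : a - b = -1 *: b + a.
Proof. by rewrite scaleN1r addrC. Qed.

Lemma solves_VI_normU star beta (v : Uspace) : 2 <= beta ->
  solves_VI Om T star f beta v -> normU Om T (uu - v) = 0.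
Proof.
move=> b2 [Cv Hv]; have [Cu Hu'] := U_of_SP_solves_VI star beta.
have Uv := cone_inU Cv; have Uu := cone_inU Cu.
have h1 := Hv _ Cu; have h2 := Hu' _ Cv; move: h1 h2; rewrite !subE => h1 h2.
have Ue : inU Om T (-1 *: v + uu) by exact: inU_lin.
have Ue' : inU Om T (-1 *: uu + v) by exact: inU_lin.
have F1 := etrans (Frhs_U_of_SP beta Ue) (bform_beta_linr oOm hT beta (-1) Uv Uu Uu).
have F2 := etrans (Frhs_U_of_SP beta Ue') (bform_beta_linr oOm hT beta (-1) Uu Uv Uu).
have [_ A1] := aform_lin oOm hT star beta (-1) Uv Uu Uv.
have [_ A2] := aform_lin oOm hT star beta (-1) Uu Uv Uu.
have [A3 _] := aform_lin oOm hT star beta (-1) Uv Uu Ue.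
have [_ A4] := aform_lin oOm hT star beta (-1) Uv Uu Uu.
have co := aform_coercive oOm hT star b2 Ue.
have n0 := normU_ge0 Om T (-1 *: v + uu).
apply/eqP; rewrite eq_le n0 andbT -(@ler_pXn2r _ 2)// ?nnegrE// expr0n /=.
apply: (le_trans co).
exact: (VI_arith h1 h2 F1 F2 A1 A2 A3 A4).
Qed.

Lemma bform_normU0 (e : Uspace) (v : Vspace) : inU Om T e ->
  normU Om T e = 0 -> inV Om T v -> bform Om T e v = 0.
Proof.
move=> Ue e0 Vv; have := bform_le hT Ue Vv; rewrite e0 mulr0 mul0r normr_le0.
by move/eqP.
Qed.

(** The L2 parts vanish almost everywhere. A trace norm is an infimum that may fail to be attained,
    so the traces are handled by extensions of arbitrarily small norm. *)
Lemma normU0_eqU (v : Uspace) : inU Om T v -> normU Om T (uu - v) = 0 ->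
  eqU Om T uu v.
Proof.
move=> Uv e0; have Uu := U_of_SP_inU; have Ue := inU_B oOm hT Uu Uv.
have [Lu Ls Hh Hm] := Ue; have [n1 n2 n3 n4] := normU_components Ue.
rewrite e0 in n1 n2 n3 n4.
have s0 : snorm (ip Om) (U_u (uu - v)) = 0.
  by apply/eqP; rewrite eq_le n1 snorm_ge0.
have t0 : snorm (ipv Om) (U_sigma (uu - v)) = 0.
  by apply/eqP; rewrite eq_le n2 snorm_ge0.
have z1 : ip Om (U_u (uu - v)) (U_u (uu - v)) = 0.
  by rewrite -(sqr_snorm _ _ (SB Om) _ Lu) s0 expr0n.
have z2 : ipv Om (U_sigma (uu - v)) (U_sigma (uu - v)) = 0.
  by rewrite -(sqr_snorm _ _ (SV Om) _ Ls) t0 expr0n.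
split.
- have := ip0_ae Lu z1; apply: filterS => x h Dx; apply/eqP; rewrite -subr_eq0.
  exact/eqP/(h Dx).
- have ae j : cmp (U_sigma (uu - v)) j = (fun=> 0) %[ae leb in Om].
    apply: ip0_ae; first exact: (Ls j).
    apply/eqP; rewrite eq_le; apply/andP; split; last exact: (semi_inner_ge0 _ _ (SB Om) _ (Ls j)).
    by rewrite -z2; exact: ip_cmp_le.
  have : {ae leb, forall x, forall j, Om x -> cmp (U_sigma (uu - v)) j x = 0}.
    exact: filter_forall.
  apply: filterS => x h Dx; apply/rowP => j; apply/eqP; rewrite -subr_eq0.
  apply/eqP; apply: etrans (h j Dx).
  by rewrite /cmp -[U_sigma (uu - v)]/(U_sigma uu - U_sigma v) !fctE !mxE.
- move=> i; change (H10 (T i) (U_uhat (uu - v) i)).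
  have [Hhi _] := Hh; apply: (H10_closed (mesh_open hT i) (Hhi i)) => eta eta0.
  (* Subtracting a small extension from the trace leaves a member of [H10] as close as desired, and
     [H10] is closed. *)
  have [w ew] : exists2 w, ext12 Om T (U_uhat (uu - v)) w & normH1 Om w < Num.sqrt eta.
    apply: contrapT => H; have : Num.sqrt eta <= 0 + 1 * norm12S Om T (U_uhat (uu - v)).
      apply: (ler_norm12S Hh ler01) => w ew; rewrite add0r mul1r leNgt.
      by apply/negP => h; apply: H; exists w.
    rewrite add0r mul1r => /le_trans/(_ n3); rewrite leNgt sqrtr_gt0.
    by rewrite eta0.
  have [Hw hw] := ew; rewrite ltr_sqrt// => we.
  exists (U_uhat (uu - v) i - w); first exact: hw.
  rewrite subKr; apply: le_lt_trans we; exact: (ipH1_mesh_le hT i Hw).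
- move=> i w Hw; apply/eqP; rewrite -subr_eq0; apply/eqP.
  change (U_sigmahat (uu - v) i w = 0).
  apply: (@ler0_small _ _ (normH1 (T i) w)) => [|eta eta0]; first exact: sqrtr_ge0.
  have c : 0 <= normH1 (T i) w by exact: sqrtr_ge0.
  have : `|U_sigmahat (uu - v) i w| <= 0 + normH1 (T i) w * normm12S Om T (U_sigmahat (uu - v)).
    apply: (ler_normm12S Hm c) => q [Hq hq]; rewrite add0r (hq _ _ Hw).
    apply: le_trans (ntrace_le (mesh_open hT i) (Hdiv_mesh hT i Hq) Hw) _.
    rewrite mulrC; apply: ler_wpM2l => //.
    by apply: ler_wsqrtr; exact: (ipHdiv_mesh_le hT i Hq).
  rewrite add0r => /le_trans; apply; apply: (@le_trans _ _ 0).
    by apply: mulr_ge0_le0.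
  by rewrite mulr_ge0// ltW.
Qed.

Lemma ae0_H10 (D : set E) w : open D -> L2 D w -> w = (fun=> 0) %[ae leb in D] ->
  H10 D w.
Proof.
move=> oD Lw w0; have L0 : L2 D (fun=> 0 : R) by exact: (semi_inner_nonempty _ _ (SB D)).
have Hw : H1 D w.
  apply: (H1_ae oD Lw) (testfun_H1 oD (testfun0 D)).
  by apply: filterS w0 => x h Dx; rewrite (h Dx).
apply: (H10_closed oD Hw) => e e0; exists 0; first exact: H10_0.
rewrite subr0 /ipH1 (grad_ae oD Lw L0 w0).
have h1 := ae_ip_sqr0 Lw L0 w0.
have -> : ip D w w = 0.
  by rewrite -[in LHS](subr0 w); exact: h1.
have H0 := semi_inner_nonempty _ _ (H1_semi_inner oD).
have := linear_on0 _ _ (H1_semi_inner oD) _ (semi_inner_linear_onl _ _ (H1_semi_inner oD) _ H0).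
rewrite /ipH1 (linear_on0 _ _ (SB D) _ (semi_inner_linear_onl _ _ (SB D) _ L0)) add0r => ->.
exact: e0.
Qed.

(** (SP) does not see a change of [u] on a null set: [grad] returns the same field, and the two
    functions have the same trace. *)
Lemma eqU_signorini (v : Uspace) : inU Om T v -> eqU Om T uu v ->
  signorini Om f (U_u v).
Proof.
move=> Uv [uv _ _ _]; have [Lv _ _ _] := Uv.
rewrite -[U_u uu]/u in uv.
have Lu := Hu.1; have gE := grad_ae oOm Lu Lv uv.
have Hv : H1 Om (U_u v) := H1_ae oOm Lv uv Hu.
have [_ h2 h3 h4 h5] := hu.
have uv0 : same_trace Om u (U_u v).
  apply: ae0_H10; [exact: oOm|exact: (semi_innerB _ _ (SB Om))|].
  by apply: filterS uv => x h Dx; rewrite !fctE (h Dx) subrr.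
split.
- by rewrite -gE.
- rewrite -gE; apply: filterS2 h2 uv => x h h' Dx.
  by rewrite -(h Dx) !fctE (h' Dx).
- exact: (ge0_H12_same_trace Hv uv0 h3).
- by rewrite -gE.
- by rewrite -gE -(ntrace_same_trace oOm Hg Hu Hv uv0).
Qed.

(** The identity holds for [uu], and [b] vanishes on [uu - v], whose norm is zero. *)
Lemma solves_VI_bform star beta (v w : Uspace) : 2 <= beta ->
  solves_VI Om T star f beta v -> inU Om T w ->
  bform Om T v (beta *: Theta Om T w) = Frhs Om T f beta w.
Proof.
move=> b2 hv Uw; have Uv := cone_inU hv.1; have Uu := U_of_SP_inU.
have VT : inV Om T (beta *: Theta Om T w).
  exact: (semi_innerZ _ _ SW _ _ (Theta_inV hT Uw)).
rewrite (Frhs_U_of_SP beta Uw).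
have := bform_normU0 (inU_B oOm hT Uu Uv) (solves_VI_normU b2 hv) VT.
rewrite subE (bform_linl oOm hT (-1) Uv Uu VT) => h.
by move: h; move: (bform _ _ _ _) (bform _ _ _ _) => *; lra.
Qed.

End signorini_solution.
End variational_problem.

Unset Implicit Arguments.

Theorem theorem1 (R : realType) (d : nat) (hd : d = 2%N \/ d = 3%N)
    (Om : set 'rV[R]_d) (hOm : lipschitz_domain Om)
    (scOm : simply_connected Om) :
  exists C1 : R, 0 < C1 /\
  forall (N : nat) (T : 'I_N -> set 'rV[R]_d), is_mesh Om T ->
  forall f : 'rV[R]_d -> R, L2 Om f ->
  forall (star : bc_form) (beta : R), 2 <= beta ->
  [/\ (* a is bilinear on U *)
      (forall (c : R) (u v w : Uspace), inU Om T u -> inU Om T v ->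
         inU Om T w ->
         aform Om T star beta (c *: u + v) w =
           c * aform Om T star beta u w + aform Om T star beta v w /\
         aform Om T star beta w (c *: u + v) =
           c * aform Om T star beta w u + aform Om T star beta w v),
      (* coercivity *)
      (forall u, inU Om T u ->
         normU Om T u ^+ 2 <= C1 * aform Om T star beta u u),
      (* boundedness *)
      (exists C2 : R, is_continuity_constant Om T C2) /\
      (forall C2 : R, is_continuity_constant Om T C2 ->
         forall u v, inU Om T u -> inU Om T v ->
         `|aform Om T star beta u v| <=
           (C2 ^+ 2 * beta + 1) * normU Om T u * normU Om T v),
      (* unique solvability of (VI) *)
      (exists u, solves_VI Om T star f beta u /\
         forall u', solves_VI Om T star f beta u' -> eqU Om T u u') &
      (* equivalence of (VI) and (SP), and the variational identity *)
      [/\ forall u : 'rV[R]_d -> R, signorini Om f u ->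
            solves_VI Om T star f beta (U_of_SP Om T u),
          forall u, solves_VI Om T star f beta u -> signorini Om f (U_u u) &
          forall u, solves_VI Om T star f beta u ->
            forall w, inU Om T w ->
            bform Om T u (beta *: Theta Om T w) = Frhs Om T f beta w]].
Proof.
(* The constant of [ler_coercive], fixed before the mesh, [f], [star] and [beta]. *)
have [_ _ [oOm _ _]] := hOm; exists 18; split; first by [].
move=> N T hT f Lf star beta b2.
have b0 : 0 <= beta by exact: le_trans b2.
have [u0 hu0] := signorini_ex oOm Lf.
(* One solution [u0] of (SP) is the reference: every solution of (VI) equals the element of U built
   from it, and both uniqueness and the converse implication follow. *)
have VIE u : solves_VI Om T star f beta u -> eqU Om T (U_of_SP Om T u0) u.
  move=> hu; apply: (normU0_eqU oOm hT hu0 (cone_inU hu.1)).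
  exact: (solves_VI_normU oOm hT Lf hu0 b2 hu).
split.
- by move=> c u v w; exact: (aform_lin oOm hT).
- by move=> u; exact: (aform_coercive oOm hT).
- split; first by exists 8; exact: (continuity_constant_ex hT).
  by move=> C2 HC u v; exact: (aform_le oOm hT).
- exists (U_of_SP Om T u0); split; last exact: VIE.
  exact: (U_of_SP_solves_VI oOm hT Lf hu0).
- split.
  + by move=> u hu; exact: (U_of_SP_solves_VI oOm hT Lf hu).
  + move=> u hu; exact: (eqU_signorini oOm hu0 (cone_inU hu.1) (VIE _ hu)).
  + by move=> u hu w; exact: (solves_VI_bform oOm hT Lf hu0 b2 hu).
Qed.
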